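(* For every $t\in\mathbb{R}$ and every $\mathbb{V}\in\mathbb{S}^1$, $\mathbb{V}$ is not a tangent of $\phi(\mathbb{R})$ at $\phi(t)$; that is, for every $t\in\mathbb{R}$ and every $\mathbb{V}\in\mathbb{S}^1$ there exists $\varphi>0$ such that \[ \frac{\mathcal{H}^1_{\infty}\big( ( \phi(\mathbb{R}) \cap B(\phi(t),h) ) \setminus S(\phi(t),\mathbb{V},\varphi) \big)}{h} \] does not converge to $0$ as $h\to0^+$.
   Context: $\phi(t) = \sum_{k \in \mathbb{Z}} \frac{ e^{-4\pi^2 i k^2 t} - 1 }{-4\pi^2 k^2}$ for $t\in\mathbb{R}$, where the $k=0$ term is interpreted as its limit value $it$; we identify $\mathbb{C}$ with $\mathbb{R}^2$ and $\mathbb{S}^1$ with unit complex numbers. The 1-Hausdorff content of $F\subset\mathbb{R}^2$ is $\mathcal{H}^1_\infty(F)=\inf\{\sum_i \operatorname{diam}U_i : F\subset\bigcup_i U_i,\ \{U_i\} \text{ countable}\}$. $B(x,h)$ is the closed (or open) ball of radius $h$ centred at $x$. For $x\in\mathbb{R}^2$, $\mathbb{V}\in\mathbb{S}^1$, $\varphi>0$, $S(x,\mathbb{V},\varphi)$ is the closed double cone with vertex $x$, axis direction $\mathbb{V}$ and opening angle $\varphi$, i.e. the set of points $y$ with $y=x$ or such that the angle between the line through $x$ in direction $\mathbb{V}$ and the vector $y-x$ is at most $\varphi/2$. Definition: $\mathbb{V}\in\mathbb{S}^1$ is a tangent of $\phi(\mathbb{R})$ at $\phi(t)$ if for every $\varphi>0$,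 $\lim_{h\to0}\mathcal{H}^1_{\infty}\big((\phi(\mathbb{R})\cap B(\phi(t),h))\setminus S(\phi(t),\mathbb{V},\varphi)\big)/h=0$. *)

(* Defs.v *)
(* classical real numbers. C is identified with R^2 = R*R. *)
From Stdlib Require Import Reals Lra ClassicalEpsilon.
Open Scope R_scope.

Definition pt := (R * R)%type.

(* k-th term of the series defining phi, as a point of R^2 = C.
   For k <> 0: (e^{-4 pi^2 i k^2 t} - 1) / (-4 pi^2 k^2), where
   e^{-i th} - 1 = (cos th - 1) + i (- sin th).
   For k = 0: the limit value i t = (0, t). *)
Definition phi_term (t : R) (k : Z) : pt :=
  if Z.eq_dec k 0 then (0, t)
  else let th := 4 * PI ^ 2 * (IZR k) ^ 2 * t in
       let den := - (4 * PI ^ 2 * (IZR k) ^ 2) in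
       ((cos th - 1) / den, (- sin th) / den).

Definition phi_partial (t : R) (N : nat) : pt :=
  (sum_f_R0 (fun i => fst (phi_term t (Z.of_nat i - Z.of_nat N)%Z)) (2 * N),
   sum_f_R0 (fun i => snd (phi_term t (Z.of_nat i - Z.of_nat N)%Z)) (2 * N)).

Definition phi_is_sum (t : R) (p : pt) : Prop :=
  Un_cv (fun N => fst (phi_partial t N)) (fst p) /\
  Un_cv (fun N => snd (phi_partial t N)) (snd p).

(* phi(t): the (unique, since the series converges absolutely) sum. *)
Definition phi (t : R) : pt :=
  epsilon (inhabits (0, 0)) (phi_is_sum t).

Definition dist (p q : pt) : R :=
  sqrt ((fst p - fst q) ^ 2 + (snd p - snd q) ^ 2).

Definition norm2 (w : pt) : R := sqrt (fst w ^ 2 + snd w ^ 2).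

Definition dot (v w : pt) : R := fst v * fst w + snd v * snd w.

Definition on_S1 (v : pt) : Prop := fst v ^ 2 + snd v ^ 2 = 1.

Definition ball (x : pt) (h : R) (y : pt) : Prop := dist x y <= h.

(* closed double cone S(x,V,varphi): y = x, or the angle between the line
   through x in direction V (unit vector) and y - x is at most varphi/2.
   That angle is acos(|<V, y-x>| / |y-x|) in [0, pi/2]. *)
Definition cone (x v : pt) (varphi : R) (y : pt) : Prop :=
  y = x \/
  let w := (fst y - fst x, snd y - snd x) in
  acos (Rabs (dot v w) / norm2 w) <= varphi / 2.

(* diameter of a set of points: 0 for the empty set, otherwise the
   supremum of mutual distances (only defined when it is finite). *)
Definition is_diam (U : pt -> Prop) (d : R) : Prop :=
  ((forall x, ~ U x) /\ d = 0) \/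
  is_lub (fun r => exists x y, U x /\ U y /\ r = dist x y) d.

(* s is the total diameter sum_i diam U_i of a countable cover
   (finite covers are included by padding with empty sets; covers with
   a set of infinite diameter or a divergent sum have total +oo and
   never matter for the infimum). *)
Definition cover_value (F : pt -> Prop) (s : R) : Prop :=
  exists (U : nat -> pt -> Prop) (d : nat -> R),
    (forall x, F x -> exists i, U i x) /\
    (forall i, is_diam (U i) (d i)) /\
    infinite_sum d s.

Definition is_H1inf (F : pt -> Prop) (m : R) : Prop :=
  (forall s, cover_value F s -> m <= s) /\
  (forall m', (forall s, cover_value F s -> m' <= s) -> m' <= m).

Definition H1inf (F : pt -> Prop) : R := epsilon (inhabits 0) (is_H1inf F).

Definition phi_image (p : pt) : Prop := exists s, p = phi s.

Definition off_cone_part (t : R) (v : pt) (varphi h : R) (p : pt) : Prop :=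
  phi_image p /\ ball (phi t) h p /\ ~ cone (phi t) v varphi p.

(* Main.v *)
From Stdlib Require Import Reals Lra Lia Psatz ZArith Znumtheory Classical ClassicalEpsilon.
From Coquelicot Require Import Coquelicot.
Require Import Defs.
Open Scope R_scope.

(** Up to scaling, [phi] is [psi x = i x + sum_{k <> 0} (1 - e^{-i k^2 x}) / k^2].  Near
    [x = 2 pi p/q] a Gauss sum factors out: at distances below [1/q^2] the curve is a rotated
    copy, of size [q^(-3/2)], of the curve near [0], where it makes a corner because
    [psi (-x)] is the reflection of [psi x].  This fails only for [q = 2 mod 4], where the Gauss
    sum vanishes.  Every [x] is a limit of rational corners [2 pi p/q] with
    [|psi x - psi (2 pi p/q)| = O(q^(-3/2))], or is itself such a corner; hence on arbitrarily
    small scales [h] the curve leaves every line through [psi x] by an amount comparable to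
    [h].  By connectedness the part of the curve off a narrow cone then has content
    comparable to [h].

    The square root cancellation is obtained without Poisson summation: the quadratic phase
    [e^{-2 pi i p k^2/q}] is expanded in its finite Fourier series, whose coefficients are Gauss
    sums of modulus at most [sqrt (2 q)], and the smooth amplitude is summed by parts twice.
    High frequencies are treated in dyadic blocks [|k| ~ X], each with its own Dirichlet
    approximation of order [X]. *)

(** * Finite sums *)

(** The termwise derivative of the series diverges, so [psi] is compared with truncations [head K]
    whose coefficients are [1/k^2 - 1/max(|k|,K)^2]. Their derivative is a quadratic exponential sum
    with continuous amplitude, and doubling [K] adds a block sum, so block bounds [A/X] give an
    error [O(A/K)] for [psi]. Near [2 pi p/q] the derivative of the head is off by
    [q^(3/2) (K^3 s^2 + K |s| + 1/K)], while the blocks cost [q^(-1/2)/K]. With [n = lam^2 q],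
    [K = lam n] and [|xi| <= 1/n^2] both errors are [O(lam^(-3) q^(-3/2))], against a corner of size
    [lam^(-2) q^(-3/2)]. The same estimate serves two limits: [lam] grows with [q] fixed at a point
    that is itself a corner, and [q] grows with [lam] fixed at a point that is approximated by
    corners. At [2 pi a/b] with [b = 2 mod 4] the obstacle is that the corners used lie at distance
    of order [1/q], not [1/q^2]; the vanishing Gauss sum makes the curve flat enough there to
    restore [O(q^(-3/2))]. Numerical constants are generous throughout. *)

Fixpoint rsum (f : nat -> R) (n : nat) : R :=
  match n with O => 0 | S m => rsum f m + f m end.

Fixpoint csum (f : nat -> C) (n : nat) : C :=
  match n with O => RtoC 0 | S m => (csum f m + f m)%C end.

Lemma rsum_ext f g n :
  (forall i, (i < n)%nat -> f i = g i) -> rsum f n = rsum g n.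
Proof.
  induction n as [|n IH]; intros H; simpl; [reflexivity|].
  rewrite IH by (intros; apply H; lia). now rewrite H by lia.
Qed.

Lemma rsum_le f g n :
  (forall i, (i < n)%nat -> f i <= g i) -> rsum f n <= rsum g n.
Proof.
  induction n as [|n IH]; intros H; simpl; [lra|].
  apply Rplus_le_compat; [apply IH; intros; apply H; lia | apply H; lia].
Qed.

Lemma rsum_const c n : rsum (fun _ => c) n = INR n * c.
Proof.
  induction n as [|n IH]; [simpl; ring|].
  rewrite S_INR; simpl; rewrite IH; ring.
Qed.

Lemma rsum_plus f g n : rsum (fun i => f i + g i) n = rsum f n + rsum g n.
Proof. induction n as [|n IH]; simpl; [|rewrite IH]; ring. Qed.

Lemma rsum_scal c f n : rsum (fun i => c * f i) n = c * rsum f n.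
Proof. induction n as [|n IH]; simpl; [|rewrite IH]; ring. Qed.

Lemma rsum_ge0 f n : (forall i, (i < n)%nat -> 0 <= f i) -> 0 <= rsum f n.
Proof.
  intros H. replace 0 with (rsum (fun _ => 0) n) by (rewrite rsum_const; ring).
  now apply rsum_le.
Qed.

Lemma rsum_le_const c f n :
  (forall i, (i < n)%nat -> f i <= c) -> rsum f n <= INR n * c.
Proof. intros H. rewrite <- rsum_const. now apply rsum_le. Qed.

Lemma rsum_Sl f n : rsum f (S n) = f O + rsum (fun i => f (S i)) n.
Proof.
  induction n as [|n IH]; [simpl; ring|].
  change (rsum f (S (S n))) with (rsum f (S n) + f (S n)). rewrite IH. simpl; ring.
Qed.

Lemma rsum_add f m n : rsum f (m + n) = rsum f m + rsum (fun i => f (m + i)%nat) n.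
Proof.
  induction n as [|n IH]; [rewrite Nat.add_0_r; simpl; ring|].
  rewrite Nat.add_succ_r; simpl; rewrite IH; ring.
Qed.

Lemma rsum_rev f n : rsum f n = rsum (fun i => f (n - 1 - i)%nat) n.
Proof.
  revert f; induction n as [|n IH]; intros f; [reflexivity|].
  rewrite (rsum_Sl (fun i => f (S n - 1 - i)%nat)).
  replace (S n - 1 - 0)%nat with n by lia.
  change (rsum f (S n)) with (rsum f n + f n). rewrite IH, Rplus_comm. f_equal.
  apply rsum_ext. intros i Hi. f_equal; lia.
Qed.

Lemma sum_f_R0_rsum f n : sum_f_R0 f n = rsum f (S n).
Proof. induction n as [|n IH]; simpl; [ring|]. rewrite IH. reflexivity. Qed.

Lemma csum_ext f g n :
  (forall i, (i < n)%nat -> f i = g i) -> csum f n = csum g n.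
Proof.
  induction n as [|n IH]; intros H; simpl; [reflexivity|].
  rewrite IH by (intros; apply H; lia). now rewrite H by lia.
Qed.

Lemma csum_zero n : csum (fun _ => RtoC 0) n = RtoC 0.
Proof. induction n as [|n IH]; simpl; [|rewrite IH]; ring. Qed.

Lemma csum_plus f g n : csum (fun i => (f i + g i)%C) n = (csum f n + csum g n)%C.
Proof. induction n as [|n IH]; simpl; [|rewrite IH]; ring. Qed.

Lemma csum_minus f g n : csum (fun i => (f i - g i)%C) n = (csum f n - csum g n)%C.
Proof. induction n as [|n IH]; simpl; [|rewrite IH]; ring. Qed.

Lemma csum_scal c f n : csum (fun i => (c * f i)%C) n = (c * csum f n)%C.
Proof. induction n as [|n IH]; simpl; [|rewrite IH]; ring. Qed.

Lemma csum_scal_r c f n : csum (fun i => (f i * c)%C) n = (csum f n * c)%C.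
Proof. induction n as [|n IH]; simpl; [|rewrite IH]; ring. Qed.

Lemma csum_switch (f : nat -> nat -> C) m n :
  csum (fun i => csum (f i) n) m = csum (fun j => csum (fun i => f i j) m) n.
Proof.
  induction m as [|m IH]; simpl; [now rewrite csum_zero|].
  rewrite IH, <- csum_plus. reflexivity.
Qed.

Lemma csum_Cmod f n : Cmod (csum f n) <= rsum (fun i => Cmod (f i)) n.
Proof.
  induction n as [|n IH]; simpl; [rewrite Cmod_0; lra|].
  eapply Rle_trans; [apply Cmod_triangle|lra].
Qed.

Lemma csum_Sl f n : csum f (S n) = (f O + csum (fun i => f (S i)) n)%C.
Proof.
  induction n as [|n IH]; [simpl; ring|].
  change (csum f (S (S n))) with (csum f (S n) + f (S n))%C. rewrite IH. simpl; ring.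
Qed.

Lemma csum_single f n j :
  (j < n)%nat -> (forall i, (i < n)%nat -> i <> j -> f i = RtoC 0) -> csum f n = f j.
Proof.
  induction n as [|n IH]; intros Hj H; [lia|]. simpl.
  destruct (Nat.eq_dec j n) as [->|Hn].
  - rewrite (csum_ext f (fun _ => RtoC 0)) by (intros; apply H; lia).
    rewrite csum_zero; ring.
  - rewrite IH by (try lia; intros; apply H; lia). rewrite (H n) by lia. ring.
Qed.

Lemma fst_csum f n : fst (csum f n) = rsum (fun i => fst (f i)) n.
Proof. induction n as [|n IH]; simpl; [|rewrite IH]; reflexivity. Qed.

Lemma snd_csum f n : snd (csum f n) = rsum (fun i => snd (f i)) n.
Proof. induction n as [|n IH]; simpl; [|rewrite IH]; reflexivity. Qed.

Lemma csum_conj f n : Cconj (csum f n) = csum (fun i => Cconj (f i)) n.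
Proof.
  induction n as [|n IH]; simpl.
  - unfold Cconj, RtoC; simpl. f_equal; ring.
  - rewrite <- IH. unfold Cconj, Cplus; simpl. f_equal; ring.
Qed.

(** * Unit complex numbers *)

Definition cis (y : R) : C := (cos y, sin y).

Lemma cis_add x y : cis (x + y) = (cis x * cis y)%C.
Proof.
  unfold cis, Cmult; simpl. rewrite cos_plus, sin_plus. f_equal; ring.
Qed.

Lemma cis_0 : cis 0 = RtoC 1.
Proof. unfold cis; now rewrite cos_0, sin_0. Qed.

Lemma Cmod_cis y : Cmod (cis y) = 1.
Proof.
  unfold Cmod, cis; simpl. replace (_ + _) with ((sin y)² + (cos y)²) by (unfold Rsqr; ring).
  rewrite sin2_cos2. apply sqrt_1.
Qed.

Lemma cis_conj y : Cconj (cis y) = cis (- y).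
Proof. unfold Cconj, cis; simpl. now rewrite cos_neg, sin_neg. Qed.

Lemma Cmod_cis_minus_1 y : Cmod (cis y - 1) = 2 * Rabs (sin (y / 2)).
Proof.
  unfold Cmod, cis; simpl.
  replace (cos y) with (1 - 2 * sin (y / 2) * sin (y / 2))
    by (rewrite <- cos_2a_sin; f_equal; field).
  replace (sin y) with (2 * sin (y / 2) * cos (y / 2))
    by (rewrite <- sin_2a; f_equal; field).
  pose proof (sin2_cos2 (y / 2)) as H. unfold Rsqr in H.
  set (s := sin (y / 2)) in *. set (c := cos (y / 2)) in *.
  replace (_ + _) with ((2 * s) * (2 * s) * (s * s + c * c)) by ring.
  rewrite H, Rmult_1_r. change (sqrt (Rsqr (2 * s)) = 2 * Rabs s).
  rewrite sqrt_Rsqr_abs, Rabs_mult. rewrite (Rabs_right 2) by lra. reflexivity.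
Qed.

Lemma Rabs_sin_le y : Rabs (sin y) <= Rabs y.
Proof.
  destruct (MVT_gen sin 0 y cos) as [c [_ Hc]].
  - intros; auto_derive; [trivial|ring].
  - intros; apply continuity_sin.
  - rewrite sin_0 in Hc. replace (sin y) with (cos c * y) by lra.
    rewrite Rabs_mult. pose proof (Rabs_pos y).
    assert (Rabs (cos c) <= 1) by (apply Rabs_le; pose proof (COS_bound c); lra).
    nra.
Qed.

Lemma Cmod_cis_minus x y : Cmod (cis x - cis y) <= Rabs (x - y).
Proof.
  replace (cis x - cis y)%C with (cis y * (cis (x - y) - 1))%C.
  - rewrite Cmod_mult, Cmod_cis, Cmod_cis_minus_1.
    pose proof (Rabs_sin_le ((x - y) / 2)) as H.
    replace (Rabs (x - y)) with (2 * Rabs ((x - y) / 2)); [lra|].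
    unfold Rdiv; rewrite Rabs_mult, (Rabs_right (/ 2)) by lra. lra.
  - replace (cis x) with (cis (y + (x - y))) by (f_equal; ring).
    rewrite cis_add. ring.
Qed.

(** * Gauss sums *)

Definition root (q : nat) (j : Z) : C := cis (2 * PI * IZR j / INR q).

Lemma root_add q i j : root q (i + j) = (root q i * root q j)%C.
Proof.
  unfold root. rewrite <- cis_add, plus_IZR. f_equal. unfold Rdiv; ring.
Qed.

Lemma Cmod_root q j : Cmod (root q j) = 1.
Proof. apply Cmod_cis. Qed.

Lemma root_0 q : root q 0 = RtoC 1.
Proof. unfold root. rewrite <- cis_0. f_equal. unfold Rdiv; ring. Qed.

Lemma cis_2PI_mult (j : Z) : cis (2 * PI * IZR j) = RtoC 1.
Proof.
  assert (Hn : forall n : nat, cis (2 * PI * INR n) = RtoC 1).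
  { induction n as [|n IH].
    - rewrite <- cis_0. f_equal; simpl; ring.
    - rewrite S_INR, Rmult_plus_distr_l, cis_add, IH, Rmult_1_r.
      unfold cis; rewrite cos_2PI, sin_2PI. unfold Cmult, RtoC; simpl; f_equal; ring. }
  destruct (Z_le_gt_dec 0 j).
  - rewrite <- (Z2Nat.id j) by lia. rewrite <- INR_IZR_INZ. apply Hn.
  - specialize (Hn (Z.to_nat (- j))). rewrite INR_IZR_INZ, Z2Nat.id in Hn by lia.
    rewrite opp_IZR in Hn.
    replace (2 * PI * IZR j) with (- (2 * PI * - IZR j)) by ring.
    rewrite <- cis_conj, Hn. unfold Cconj, RtoC; simpl; f_equal; ring.
Qed.

Lemma root_mult q j : (0 < q)%nat -> root q (Z.of_nat q * j) = RtoC 1.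
Proof.
  intros Hq. unfold root. rewrite mult_IZR, <- INR_IZR_INZ.
  rewrite <- (cis_2PI_mult j). f_equal. field. apply not_0_INR; lia.
Qed.

Lemma root_period q i j : (0 < q)%nat -> root q (i + Z.of_nat q * j) = root q i.
Proof. intros Hq. rewrite root_add, root_mult by assumption. ring. Qed.

Lemma root_conj q j : Cconj (root q j) = root q (- j).
Proof.
  unfold root. rewrite cis_conj, opp_IZR. f_equal. unfold Rdiv; ring.
Qed.

Lemma root_eq_1 q j : (0 < q)%nat -> root q j = RtoC 1 -> (Z.of_nat q | j)%Z.
Proof.
  intros Hq H. assert (Hq0 : INR q <> 0) by (apply not_0_INR; lia).
  assert (Hm : Cmod (root q j - 1) = 0).
  { rewrite H. replace (RtoC 1 - 1)%C with (RtoC 0) by ring. apply Cmod_0. }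
  unfold root in Hm. rewrite Cmod_cis_minus_1 in Hm.
  assert (Hs : sin (2 * PI * IZR j / INR q / 2) = 0).
  { destruct (Req_dec (sin (2 * PI * IZR j / INR q / 2)) 0) as [E|E]; [exact E|].
    apply Rabs_no_R0 in E. lra. }
  apply sin_eq_0_0 in Hs. destruct Hs as [k Hk].
  exists k. apply eq_IZR. rewrite mult_IZR, <- INR_IZR_INZ.
  pose proof PI_RGT_0.
  apply (Rmult_eq_reg_l (PI / INR q)).
  - transitivity (2 * PI * IZR j / INR q / 2); [field; exact Hq0|].
    rewrite Hk. field; exact Hq0.
  - apply Rmult_integral_contrapositive_currified; [lra|now apply Rinv_neq_0_compat].
Qed.

Lemma root_orthogonality q (j : Z) :
  (0 < q)%nat ->
  csum (fun m => root q (j * Z.of_nat m)) q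
  = if Zdivide_dec (Z.of_nat q) j then RtoC (INR q) else RtoC 0.
Proof.
  intros Hq. destruct (Zdivide_dec (Z.of_nat q) j) as [[k ->]|Hj].
  - rewrite (csum_ext _ (fun _ => RtoC 1)).
    + clear. induction q as [|q IH]; [reflexivity|].
      change (csum (fun _ => RtoC 1) (S q)) with (csum (fun _ => RtoC 1) q + 1)%C.
      rewrite IH, S_INR, RtoC_plus. reflexivity.
    + intros i _. replace (k * Z.of_nat q * Z.of_nat i)%Z
        with (Z.of_nat q * (k * Z.of_nat i))%Z by ring. now apply root_mult.
  - set (S := csum _ q).
    assert (H : ((root q j - 1) * S)%C = RtoC 0).
    { assert (Hn : forall n, ((root q j - 1) * csum (fun m => root q (j * Z.of_nat m)) n)%C
                       = (root q (j * Z.of_nat n) - 1)%C).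
      { induction n as [|n IH].
        - simpl csum. rewrite Z.mul_0_r, root_0. ring.
        - simpl csum. rewrite Cmult_plus_distr_l, IH.
          replace (j * Z.of_nat (Datatypes.S n))%Z with (j + j * Z.of_nat n)%Z by lia.
          rewrite root_add. ring. }
      unfold S. rewrite Hn, Z.mul_comm, root_mult by assumption. ring. }
    destruct (Ceq_dec (root q j - 1) 0) as [E|E].
    + exfalso. apply Hj, root_eq_1; [assumption|].
      replace (root q j) with ((root q j - 1) + 1)%C by ring. rewrite E. ring.
    + replace S with (/ (root q j - 1) * ((root q j - 1) * S))%C.
      * rewrite H. ring.
      * field. exact E.
Qed.

(** [gauss p q m / q] is the [m]-th finite Fourier coefficient of the [q]-periodic function
    [k -> e^{-2 pi i p k^2/q}]. *)
Definition gauss (p : Z) (q : nat) (m : Z) : C :=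
  csum (fun r => root q (- (p * Z.of_nat r * Z.of_nat r) - m * Z.of_nat r)) q.

(** Fourier inversion on [Z/q]: once the sums are exchanged, orthogonality keeps only the residue
    [r0] of [k]. *)
Lemma gauss_inversion p q (k : Z) :
  (0 < q)%nat ->
  (RtoC (INR q) * root q (- (p * k * k)))%C
  = csum (fun m => (gauss p q (Z.of_nat m) * root q (Z.of_nat m * k))%C) q.
Proof.
  intros Hq. unfold gauss.
  rewrite (csum_ext _ (fun m => csum (fun r =>
     (root q (- (p * Z.of_nat r * Z.of_nat r)) * root q ((k - Z.of_nat r) * Z.of_nat m))%C) q)).
  2:{ intros m _. rewrite <- csum_scal_r. apply csum_ext. intros r _.
      rewrite <- !root_add. f_equal. ring. }
  rewrite csum_switch.
  set (r0 := Z.to_nat (k mod Z.of_nat q)).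
  assert (Hr0 : Z.of_nat r0 = (k mod Z.of_nat q)%Z).
  { unfold r0. apply Z2Nat.id. apply Z.mod_pos_bound; lia. }
  pose proof (Z.mod_pos_bound k (Z.of_nat q) ltac:(lia)) as Hb.
  pose proof (Z.div_mod k (Z.of_nat q) ltac:(lia)) as Hd.
  rewrite (csum_single _ q r0).
  - rewrite csum_scal, root_orthogonality by assumption.
    destruct (Zdivide_dec (Z.of_nat q) (k - Z.of_nat r0)) as [[z Hz]|Hn].
    + rewrite Cmult_comm. f_equal.
      assert (Hk : k = (Z.of_nat r0 + Z.of_nat q * z)%Z) by lia.
      replace (- (p * k * k))%Z with (- (p * Z.of_nat r0 * Z.of_nat r0)
        + Z.of_nat q * (- p * z * (2 * Z.of_nat r0 + Z.of_nat q * z)))%Z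
        by (rewrite Hk; ring).
      now apply root_period.
    + exfalso. apply Hn. exists (k / Z.of_nat q)%Z. lia.
  - lia.
  - intros i Hi Hne. rewrite csum_scal, root_orthogonality by assumption.
    destruct (Zdivide_dec (Z.of_nat q) (k - Z.of_nat i)) as [[z Hz]|Hn]; [|ring].
    exfalso. apply Hne. apply Nat2Z.inj. rewrite Hr0.
    apply (Z.mod_unique k (Z.of_nat q) z); lia.
Qed.

Lemma csum_periodic_shift (f : Z -> C) q (b : nat) :
  (forall k, f (k + Z.of_nat q)%Z = f k) ->
  csum (fun r => f (Z.of_nat r)) q = csum (fun r => f (Z.of_nat r + Z.of_nat b)%Z) q.
Proof.
  intros Hf. induction b as [|b IH].
  - apply csum_ext. intros; f_equal; lia.
  - rewrite IH. destruct q as [|q]; [reflexivity|].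
    rewrite csum_Sl, Cplus_comm.
    change (csum (fun r => f (Z.of_nat r + Z.of_nat (S b))%Z) (S q))
      with (csum (fun r => f (Z.of_nat r + Z.of_nat (S b))%Z) q
            + f (Z.of_nat q + Z.of_nat (S b))%Z)%C.
    f_equal.
    + apply csum_ext. intros; f_equal; lia.
    + transitivity (f (Z.of_nat b)); [f_equal; lia|].
      rewrite <- (Hf (Z.of_nat b)). f_equal. lia.
Qed.

(** In the double sum over [b] and [r] the substitution [r = b + d], legitimate by periodicity,
    cancels the square of [b]. What remains is linear in [b], and orthogonality restricts [d] to the
    solutions of [q | 2 p d]. *)
Lemma gauss_norm p q (m : Z) :
  (0 < q)%nat ->
  (gauss p q m * Cconj (gauss p q m))%C
  = csum (fun d => (root q (- (p * Z.of_nat d * Z.of_nat d) - m * Z.of_nat d)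
       * (if Zdivide_dec (Z.of_nat q) (- 2 * p * Z.of_nat d) then RtoC (INR q) else RtoC 0))%C) q.
Proof.
  intros Hq. unfold gauss. rewrite csum_conj.
  set (f := fun r : Z => root q (- (p * r * r) - m * r)).
  assert (Hp : forall k, f (k + Z.of_nat q)%Z = f k).
  { intros k. unfold f.
    replace (_ - _)%Z with (- (p * k * k) - m * k
      + Z.of_nat q * (- p * (2 * k + Z.of_nat q) - m))%Z by ring.
    now apply root_period. }
  rewrite <- csum_scal.
  rewrite (csum_ext _ (fun b => csum (fun d =>
    (root q (- (p * Z.of_nat d * Z.of_nat d) - m * Z.of_nat d)
       * root q (- 2 * p * Z.of_nat d * Z.of_nat b))%C) q)).
  - rewrite csum_switch. apply csum_ext. intros d _.
    rewrite csum_scal, root_orthogonality by assumption. reflexivity.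
  - intros b _. change (fun i : nat => root q (- (p * Z.of_nat i * Z.of_nat i) - m * Z.of_nat i))
      with (fun i : nat => f (Z.of_nat i)).
    rewrite (csum_periodic_shift f q b Hp), <- csum_scal_r.
    apply csum_ext. intros d _. unfold f. rewrite root_conj, <- !root_add. f_equal. ring.
Qed.

Lemma Cmod_sqr_conj z : RtoC (Cmod z * Cmod z) = (z * Cconj z)%C.
Proof.
  unfold Cmod. rewrite sqrt_sqrt.
  - unfold Cmult, Cconj, RtoC; simpl. f_equal; ring.
  - pose proof (pow2_ge_0 (fst z)). pose proof (pow2_ge_0 (snd z)). lra.
Qed.

Lemma rsum_indicator_le c j n :
  0 <= c -> rsum (fun i => if Nat.eq_dec i j then c else 0) n <= c.
Proof.
  intros Hc. induction n as [|n IH]; simpl; [lra|].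
  destruct (Nat.eq_dec n j) as [->|]; [|lra].
  rewrite (rsum_ext _ (fun _ => 0)).
  - rewrite rsum_const. lra.
  - intros i Hi. destruct (Nat.eq_dec i j); [lia|reflexivity].
Qed.

Lemma dvd_twice_small p q d :
  rel_prime p (Z.of_nat q) -> (d < q)%nat ->
  (Z.of_nat q | - 2 * p * Z.of_nat d)%Z -> d = 0%nat \/ (2 * d = q)%nat.
Proof.
  intros Hp Hd Hdiv.
  assert (H : (Z.of_nat q | 2 * Z.of_nat d)%Z).
  { apply Gauss with p.
    - apply Z.divide_opp_r. now replace (- (p * (2 * Z.of_nat d)))%Z with (- 2 * p * Z.of_nat d)%Z by ring.
    - now apply rel_prime_sym. }
  destruct H as [z Hz]. assert (z = 0 \/ z = 1)%Z by nia. lia.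
Qed.

(** Only [d = 0] and [d = q/2] survive in [gauss_norm], each contributing at most [q]. *)
Lemma gauss_le p q m :
  (0 < q)%nat -> rel_prime p (Z.of_nat q) ->
  Cmod (gauss p q m) * Cmod (gauss p q m) <= 2 * INR q.
Proof.
  intros Hq Hp. pose proof (pos_INR q).
  pose proof (Cmod_sqr_conj (gauss p q m)) as H1. rewrite gauss_norm in H1 by assumption.
  apply (f_equal Cmod) in H1. rewrite Cmod_R in H1.
  rewrite Rabs_right in H1 by (apply Rle_ge, Rmult_le_pos; apply Cmod_ge_0).
  rewrite H1. eapply Rle_trans; [apply csum_Cmod|].
  apply Rle_trans with (rsum (fun i => (if Nat.eq_dec i 0 then INR q else 0)
    + (if Nat.eq_dec i (q / 2) then INR q else 0)) q).
  - apply rsum_le. intros d Hd. rewrite Cmod_mult, Cmod_root, Rmult_1_l.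
    destruct (Zdivide_dec _ _) as [Hdiv|_].
    + rewrite Cmod_R, Rabs_right by lra.
      destruct (dvd_twice_small p q d Hp Hd Hdiv) as [->|<-].
      * destruct (Nat.eq_dec 0 0); [|lia]. destruct (Nat.eq_dec _ _); lra.
      * rewrite Nat.mul_comm, Nat.div_mul by lia.
        destruct (Nat.eq_dec d d); [|lia].
        rewrite Nat.mul_comm. destruct (Nat.eq_dec _ _); lra.
    + rewrite Cmod_0. destruct (Nat.eq_dec d 0), (Nat.eq_dec d (q / 2)); lra.
  - rewrite rsum_plus.
    pose proof (rsum_indicator_le (INR q) 0 q ltac:(lra)).
    pose proof (rsum_indicator_le (INR q) (q / 2) q ltac:(lra)). lra.
Qed.

Lemma csum_pair f n i j :
  (i < n)%nat -> (j < n)%nat -> i <> j ->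
  (forall k, (k < n)%nat -> k <> i -> k <> j -> f k = RtoC 0) ->
  csum f n = (f i + f j)%C.
Proof.
  intros Hi Hj Hij H.
  rewrite (csum_ext f (fun k => ((if Nat.eq_dec k i then f k else 0)
     + (if Nat.eq_dec k i then 0 else f k))%C)).
  - rewrite csum_plus. f_equal.
    + rewrite (csum_single _ n i Hi).
      * destruct (Nat.eq_dec i i); [reflexivity|lia].
      * intros k _ Hk. destruct (Nat.eq_dec k i); [lia|reflexivity].
    + rewrite (csum_single _ n j Hj).
      * destruct (Nat.eq_dec j i); [lia|reflexivity].
      * intros k Hkn Hk. destruct (Nat.eq_dec k i); [reflexivity|now apply H].
  - intros k _. destruct (Nat.eq_dec k i); ring.
Qed.

Lemma gauss_odd p q :
  rel_prime p (Z.of_nat q) -> Nat.odd q = true ->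
  Cmod (gauss p q 0) * Cmod (gauss p q 0) = INR q.
Proof.
  intros Hp Ho. assert (Hq : (0 < q)%nat) by (destruct q; [discriminate|lia]).
  apply Nat.odd_spec in Ho. destruct Ho as [u Hu].
  apply RtoC_inj. rewrite Cmod_sqr_conj, gauss_norm by assumption.
  rewrite (csum_single _ q 0 Hq).
  - simpl Z.of_nat. rewrite Z.mul_0_r.
    replace (root q _) with (RtoC 1) by (rewrite <- (root_0 q); f_equal; ring).
    destruct (Zdivide_dec _ _) as [_|Hn]; [ring|]. destruct Hn. exists 0%Z. ring.
  - intros d Hd Hd0. destruct (Zdivide_dec _ _) as [Hdiv|_]; [|ring].
    destruct (dvd_twice_small p q d Hp Hd Hdiv); lia.
Qed.

(** The surviving term [d = u] is [e^{-pi i p u}], which is [1] for even [u] and [-1] for odd [u],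
    since [p] is odd. This sign separates [q = 0 mod 4] from [q = 2 mod 4]. *)
Lemma gauss_even p u :
  (0 < u)%nat -> rel_prime p (Z.of_nat (2 * u)) ->
  RtoC (Cmod (gauss p (2 * u) 0) * Cmod (gauss p (2 * u) 0))
  = (RtoC (INR (2 * u)) * (1 + root (2 * u) (- (p * Z.of_nat u * Z.of_nat u))))%C.
Proof.
  intros Hu Hp. rewrite Cmod_sqr_conj, gauss_norm by lia.
  rewrite (csum_pair _ (2 * u) 0 u); try lia.
  - destruct (Zdivide_dec _ _) as [_|Hn].
    2:{ destruct Hn. exists 0%Z. simpl Z.of_nat. ring. }
    destruct (Zdivide_dec _ _) as [_|Hn].
    2:{ destruct Hn. exists (- p)%Z. lia. }
    replace (root _ (- (p * Z.of_nat 0 * Z.of_nat 0) - 0 * Z.of_nat 0)) with (RtoC 1)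
      by (rewrite <- (root_0 (2 * u)); f_equal; simpl; ring).
    replace (- (p * Z.of_nat u * Z.of_nat u) - 0 * Z.of_nat u)%Z
      with (- (p * Z.of_nat u * Z.of_nat u))%Z by ring. ring.
  - intros d Hd Hd0 Hdu. destruct (Zdivide_dec _ _) as [Hdiv|_]; [|ring].
    destruct (dvd_twice_small p (2 * u) d Hp Hd Hdiv); lia.
Qed.

Lemma gauss_0mod4 p v :
  (0 < v)%nat -> rel_prime p (Z.of_nat (4 * v)) ->
  Cmod (gauss p (4 * v) 0) * Cmod (gauss p (4 * v) 0) = 2 * INR (4 * v).
Proof.
  intros Hv Hp. replace (4 * v)%nat with (2 * (2 * v))%nat in * by lia.
  apply RtoC_inj. rewrite gauss_even by (assumption || lia).
  replace (- (p * Z.of_nat (2 * v) * Z.of_nat (2 * v)))%Z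
    with (Z.of_nat (2 * (2 * v)) * (- p * Z.of_nat v))%Z by lia.
  rewrite root_mult by lia. rewrite RtoC_mult.
  replace (RtoC 2) with (1 + 1)%C by (rewrite <- RtoC_plus; f_equal; ring). ring.
Qed.

Lemma gauss_2mod4 p v :
  rel_prime p (Z.of_nat (4 * v + 2)) -> gauss p (4 * v + 2) 0 = RtoC 0.
Proof.
  intros Hp. replace (4 * v + 2)%nat with (2 * (2 * v + 1))%nat in * by lia.
  set (u := (2 * v + 1)%nat) in *.
  apply Cmod_eq_0.
  assert (H : Cmod (gauss p (2 * u) 0) * Cmod (gauss p (2 * u) 0) = 0).
  { apply RtoC_inj. rewrite gauss_even by (assumption || lia).
    assert (Hodd : (p mod 2 = 1)%Z).
    { pose proof (Z.mod_pos_bound p 2 ltac:(lia)).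
      destruct (Z.eq_dec (p mod 2) 0) as [E|E]; [|lia]. exfalso.
      apply Z.mod_divide in E; [|lia].
      destruct Hp as [_ _ H2]. specialize (H2 2%Z E ltac:(exists (Z.of_nat u); lia)).
      apply Z.divide_1_r in H2. lia. }
    pose proof (Z.div_mod p 2 ltac:(lia)) as Hd. rewrite Hodd in Hd.
    set (p' := (p / 2)%Z) in *.
    (* As [p] and [u] are odd, [-p u^2] is congruent to [u] modulo [2u], so the root is
       [e^{pi i} = -1]. *)
    replace (- (p * Z.of_nat u * Z.of_nat u))%Z
      with (Z.of_nat u + Z.of_nat (2 * u) * (- p' * Z.of_nat u - Z.of_nat v - 1))%Z
      by (rewrite Hd; unfold u; lia).
    rewrite root_period by lia. unfold root.
    replace (2 * PI * IZR (Z.of_nat u) / INR (2 * u)) with PI.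
    - unfold cis. rewrite cos_PI, sin_PI. unfold Cmult, Cplus, RtoC; simpl. f_equal; ring.
    - rewrite <- INR_IZR_INZ, mult_INR. simpl (INR 2). field. apply not_0_INR. lia. }
  pose proof (Cmod_ge_0 (gauss p (2 * u) 0)). nra.
Qed.

(** * Summation by parts *)

Lemma abel_summation (v E : nat -> C) n :
  csum (fun i => (v i * (E (S i) - E i))%C) n
  = (v n * E n - v O * E O - csum (fun i => ((v (S i) - v i) * E (S i))%C) n)%C.
Proof. induction n as [|n IH]; simpl; [|rewrite IH]; ring. Qed.

Lemma Cmod_minus_le a b : Cmod (a - b) <= Cmod a + Cmod b.
Proof.
  replace (a - b)%C with (a + - b)%C by ring.
  eapply Rle_trans; [apply Cmod_triangle|]. rewrite Cmod_opp; lra.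
Qed.

(* The inverse ratio [c i = 1 / (E (i+1) / E i - 1)] turns [E] into a difference, so
   each summation by parts moves one difference onto the amplitude [F c]. *)
Lemma double_summation_by_parts (F c E : nat -> C) n M d d2 :
  (forall i, (i <= n)%nat -> E i = (c i * (E (S i) - E i))%C) ->
  (forall i, Cmod (E i) <= 1) ->
  (forall i, (i <= S n)%nat -> Cmod (c i) <= M) ->
  (forall i, (i <= n)%nat -> Cmod (c (S i) - c i) <= d) ->
  (forall i, (i < n)%nat -> Cmod (c (S (S i)) - c (S i) - (c (S i) - c i)) <= d2) ->
  F O = RtoC 0 -> F 1%nat = RtoC 0 -> F n = RtoC 0 -> F (S n) = RtoC 0 ->
  Cmod (csum (fun i => (F i * E i)%C) n)
  <= rsum (fun i => M * M * Cmod (F (S (S i)) - F (S i) - (F (S i) - F i))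
       + M * d * (Cmod (F (S (S i)) - F (S i)) + 2 * Cmod (F (S i) - F i))
       + (M * d2 + d * d) * Cmod (F i)) n.
Proof.
  intros HE HE1 Hc Hd Hd2 F0 F1 Fn FSn.
  set (D := fun i => (F (S i) * c (S i) - F i * c i)%C).
  assert (H1 : csum (fun i => (F i * E i)%C) n = (- csum (fun i => (D i * E (S i))%C) n)%C).
  { rewrite (csum_ext _ (fun i => (F i * c i * (E (S i) - E i))%C))
      by (intros i Hi; rewrite (HE i) at 1 by lia; ring).
    rewrite (abel_summation (fun i => (F i * c i)%C)), F0, Fn. unfold D. ring. }
  assert (H2 : csum (fun i => (D i * E (S i))%C) n
     = (- csum (fun i => ((D (S i) * c (S (S i)) - D i * c (S i)) * E (S (S i)))%C) n)%C).
  { rewrite (csum_ext _ (fun i => (D i * c (S i) * (E (S (S i)) - E (S i)))%C))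
      by (intros i Hi; rewrite (HE (S i)) at 1 by lia; ring).
    rewrite (abel_summation (fun i => (D i * c (S i))%C) (fun i => E (S i))).
    unfold D at 1 2. rewrite F0, F1, Fn, FSn. ring. }
  rewrite H1, H2, !Cmod_opp. eapply Rle_trans; [apply csum_Cmod|].
  apply rsum_le. intros i Hi. rewrite Cmod_mult.
  apply Rle_trans with (Cmod (D (S i) * c (S (S i)) - D i * c (S i)) * 1).
  { apply Rmult_le_compat_l; [apply Cmod_ge_0|apply HE1]. }
  rewrite Rmult_1_r.
  set (a := F i). set (b := F (S i)). set (g := F (S (S i))).
  set (x := c i). set (y := c (S i)). set (z := c (S (S i))).
  assert (Hx : Cmod x <= M) by (apply Hc; lia).
  assert (Hy : Cmod y <= M) by (apply Hc; lia).
  assert (Hz : Cmod z <= M) by (apply Hc; lia).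
  assert (Hyx : Cmod (y - x) <= d) by (apply Hd; lia).
  assert (Hzy : Cmod (z - y) <= d) by (apply Hd; lia).
  assert (Hzz : Cmod (z - y - (y - x)) <= d2) by (apply Hd2; lia).
  unfold D. fold a b g x y z.
  (* Discrete Leibniz rule: two differences are distributed over the amplitude and over [c] in every
     possible way. *)
  replace ((g * z - b * y) * z - (b * y - a * x) * y)%C
    with (z * y * (g - b - (b - a)) + z * (z - y) * ((g - b) + (b - a))
          + z * (z - y - (y - x)) * a + (z - y) * y * (b - a)
          + (z - y) * (y - x) * a)%C by ring.
  pose proof (Cmod_ge_0 x). pose proof (Cmod_ge_0 y). pose proof (Cmod_ge_0 z).
  pose proof (Cmod_ge_0 (y - x)). pose proof (Cmod_ge_0 (z - y)).
  pose proof (Cmod_ge_0 (z - y - (y - x))).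
  pose proof (Cmod_ge_0 a). pose proof (Cmod_ge_0 (g - b - (b - a))).
  pose proof (Cmod_ge_0 (b - a)). pose proof (Cmod_ge_0 (g - b)).
  pose proof (Cmod_triangle (g - b) (b - a)).
  pose proof (Cmod_ge_0 ((g - b) + (b - a))).
  eapply Rle_trans; [apply Cmod_triangle|].
  eapply Rle_trans; [apply Rplus_le_compat_r, Cmod_triangle|].
  eapply Rle_trans; [apply Rplus_le_compat_r, Rplus_le_compat_r, Cmod_triangle|].
  eapply Rle_trans;
    [apply Rplus_le_compat_r, Rplus_le_compat_r, Rplus_le_compat_r, Cmod_triangle|].
  rewrite !Cmod_mult.
  assert (Cmod z * Cmod y * Cmod (g - b - (b - a)) <= M * M * Cmod (g - b - (b - a)))
    by (apply Rmult_le_compat_r; [assumption|apply Rmult_le_compat; assumption]).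
  assert (Cmod z * Cmod (z - y) * Cmod (g - b + (b - a))
     <= M * d * (Cmod (g - b) + Cmod (b - a)))
    by (apply Rmult_le_compat; try assumption;
        [now apply Rmult_le_pos|apply Rmult_le_compat; assumption]).
  assert (Cmod z * Cmod (z - y - (y - x)) * Cmod a <= M * d2 * Cmod a)
    by (apply Rmult_le_compat_r; [assumption|apply Rmult_le_compat; assumption]).
  assert (Cmod (z - y) * Cmod y * Cmod (b - a) <= d * M * Cmod (b - a))
    by (apply Rmult_le_compat_r; [assumption|apply Rmult_le_compat; assumption]).
  assert (Cmod (z - y) * Cmod (y - x) * Cmod a <= d * d * Cmod a)
    by (apply Rmult_le_compat_r; [assumption|apply Rmult_le_compat; assumption]).
  nra.
Qed.

Lemma rsum_inv_sq n : rsum (fun i => / (INR (S i) * INR (S i))) n <= 2.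
Proof.
  assert (H : rsum (fun i => / (INR (S i) * INR (S i))) (S n) <= 2 - / INR (S n)).
  { induction n as [|n IH]; [simpl; lra|].
    change (rsum (fun i => / (INR (S i) * INR (S i))) (S (S n)))
      with (rsum (fun i => / (INR (S i) * INR (S i))) (S n) + / (INR (S (S n)) * INR (S (S n)))).
    enough (/ (INR (S (S n)) * INR (S (S n))) <= / INR (S n) - / INR (S (S n))) by lra.
    rewrite (S_INR (S n)). pose proof (lt_0_INR (S n) ltac:(lia)).
    set (x := INR (S n)) in *.
    replace (/ x - / (x + 1)) with (/ (x * (x + 1))) by (field; lra).
    apply Rinv_le_contravar; nra. }
  simpl in H. pose proof (Rinv_0_lt_compat _ (lt_0_INR (S n) ltac:(lia))).
  pose proof (Rinv_0_lt_compat _ (Rmult_lt_0_compat _ _ (lt_0_INR (S n) ltac:(lia)) (lt_0_INR (S n) ltac:(lia)))).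
  simpl in *. lra.
Qed.

Lemma sin_ge_third x : 0 <= x <= PI / 2 -> x / 3 <= sin x.
Proof.
  intros [H0 H1]. pose proof PI_4.
  destruct (pre_sin_bound x 0 H0 ltac:(lra)) as [Hs _].
  unfold sin_approx, sin_term in Hs; simpl in Hs.
  (* [x - x^3/6] is at least [x/3] as soon as [x^2 <= 4], which follows from [PI <= 4]. *)
  assert (0 <= x * (4 - x * x)) by (apply Rmult_le_pos; nra). lra.
Qed.

(** The chord [2 |sin (pi m/q)|] is at least [m/q] or [(q - m)/q], according to the half circle
    containing the root. Adding the two inverse squares, instead of taking the larger, lets the
    later sum over [m] split. *)
Lemma Cmod_root_minus_1 q m :
  (0 < m < q)%nat ->
  / (Cmod (root q (Z.of_nat m) - 1) * Cmod (root q (Z.of_nat m) - 1))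
  <= INR q * INR q * (/ (INR m * INR m) + / (INR (q - m) * INR (q - m))).
Proof.
  intros [Hm Hq]. pose proof PI_RGT_0. pose proof PI2_3_2 as HPI.
  assert (Hm0 : 0 < INR m) by (apply lt_0_INR; lia).
  assert (Hm1 : 0 < INR (q - m)) by (apply lt_0_INR; lia).
  assert (Hqm : INR q = INR m + INR (q - m)) by (rewrite <- plus_INR; f_equal; lia).
  unfold root. rewrite Cmod_cis_minus_1, <- INR_IZR_INZ.
  replace (2 * PI * INR m / INR q / 2) with (PI * INR m / INR q) by (field; lra).
  set (x := PI * INR m / INR q).
  assert (Hinv : forall a, 0 < a -> a / INR q <= 2 * Rabs (sin x) ->
     / (2 * Rabs (sin x) * (2 * Rabs (sin x))) <= INR q * INR q * / (a * a)).
  { intros a Ha Hle.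
    assert (0 < a / INR q) by (apply Rdiv_lt_0_compat; lra).
    replace (INR q * INR q * / (a * a)) with (/ (a / INR q * (a / INR q))) by (field; lra).
    apply Rinv_le_contravar; nra. }
  pose proof (Rinv_0_lt_compat _ (Rmult_lt_0_compat _ _ Hm0 Hm0)).
  pose proof (Rinv_0_lt_compat _ (Rmult_lt_0_compat _ _ Hm1 Hm1)).
  assert (0 < INR q * INR q) by nra.
  assert (Hx : 0 < x) by (apply Rdiv_lt_0_compat; nra).
  assert (Hxx : PI - x = PI * INR (q - m) / INR q) by (unfold x; rewrite Hqm; field; lra).
  pose proof (Rle_abs (sin x)).
  destruct (Rle_lt_dec x (PI / 2)) as [Hc|Hc].
  - apply Rle_trans with (INR q * INR q * / (INR m * INR m)); [|nra].
    apply Hinv; [assumption|].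
    pose proof (sin_ge_third x ltac:(lra)).
    apply Rle_trans with (2 / 3 * x); [|lra].
    replace (2 / 3 * x) with (2 / 3 * (PI * INR m) / INR q) by (unfold x; field; lra).
    unfold Rdiv at 1 2.
    apply Rmult_le_compat_r; [left; apply Rinv_0_lt_compat; lra|nra].
  - apply Rle_trans with (INR q * INR q * / (INR (q - m) * INR (q - m))); [|nra].
    apply Hinv; [assumption|].
    assert (0 < PI - x) by (rewrite Hxx; apply Rdiv_lt_0_compat; nra).
    pose proof (sin_ge_third (PI - x) ltac:(lra)) as Hs. rewrite sin_PI_x in Hs.
    apply Rle_trans with (2 / 3 * (PI - x)); [|lra]. rewrite Hxx.
    replace (2 / 3 * (PI * INR (q - m) / INR q))
      with (2 / 3 * (PI * INR (q - m)) / INR q) by (field; lra).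
    unfold Rdiv at 1 2.
    apply Rmult_le_compat_r; [left; apply Rinv_0_lt_compat; lra|nra].
Qed.

(** The ratio of consecutive exponentials is the constant [root q m], so [c] is constant in
    [double_summation_by_parts] and only the second difference of [F] remains. *)
Lemma linear_phase_sum q m N n (F : nat -> C) :
  (0 < m < q)%nat ->
  F O = RtoC 0 -> F 1%nat = RtoC 0 -> F n = RtoC 0 -> F (S n) = RtoC 0 ->
  Cmod (csum (fun i => (root q (Z.of_nat m * (Z.of_nat i - Z.of_nat N)) * F i)%C) n)
  <= INR q * INR q * (/ (INR m * INR m) + / (INR (q - m) * INR (q - m)))
     * rsum (fun i => Cmod (F (S (S i)) - F (S i) - (F (S i) - F i))) n.
Proof.
  intros Hm F0 F1 Fn FSn.
  set (z := root q (Z.of_nat m)).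
  assert (Hz : (z - 1)%C <> RtoC 0).
  { intros E. apply (f_equal (fun w => (w + 1)%C)) in E.
    replace (z - 1 + 1)%C with z in E by ring. replace (0 + 1)%C with (RtoC 1) in E by ring.
    apply root_eq_1 in E; [|lia]. destruct E as [k Hk].
    assert (k <= 0 \/ 1 <= k)%Z as [|] by lia; nia. }
  set (E := fun i : nat => root q (Z.of_nat m * (Z.of_nat i - Z.of_nat N))).
  rewrite (csum_ext _ (fun i => (F i * E i)%C)) by (intros; apply Cmult_comm).
  eapply Rle_trans.
  - apply (double_summation_by_parts F (fun _ => / (z - 1))%C E n (/ Cmod (z - 1)) 0 0);
      try assumption.
    + intros i _. replace (E (S i)) with (z * E i)%C; [field; exact Hz|].
      unfold E, z. rewrite <- root_add. f_equal. rewrite Nat2Z.inj_succ. ring.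
    + intros i. unfold E. rewrite Cmod_root. lra.
    + intros i _. rewrite Cmod_inv by exact Hz. lra.
    + intros i _. replace (_ - _)%C with (RtoC 0) by ring. rewrite Cmod_0; lra.
    + intros i _. replace (_ - _)%C with (RtoC 0) by ring. rewrite Cmod_0; lra.
  - rewrite (rsum_ext _ (fun i => / Cmod (z - 1) * / Cmod (z - 1)
       * Cmod (F (S (S i)) - F (S i) - (F (S i) - F i)))) by (intros; ring).
    rewrite rsum_scal. apply Rmult_le_compat_r.
    + apply rsum_ge0. intros; apply Cmod_ge_0.
    + rewrite <- Rinv_mult. apply Cmod_root_minus_1. exact Hm.
Qed.

(** Frequency [m = 0] of the Fourier expansion is the main term. Every other one has coefficient at
    most [sqrt (2 q)/q] and costs [q^2 (1/m^2 + 1/(q-m)^2)] by [linear_phase_sum]; these sum to at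
    most [4 q^2], and [8] bounds [4 sqrt 2]. *)
Lemma quadratic_phase_sum p q N n (F : nat -> C) :
  (0 < q)%nat -> rel_prime p (Z.of_nat q) ->
  F O = RtoC 0 -> F 1%nat = RtoC 0 -> F n = RtoC 0 -> F (S n) = RtoC 0 ->
  Cmod (csum (fun i => (root q (- (p * (Z.of_nat i - Z.of_nat N) * (Z.of_nat i - Z.of_nat N)))
                        * F i)%C) n
        - gauss p q 0 * RtoC (/ INR q) * csum F n)
  <= 8 * (INR q * sqrt (INR q)) * rsum (fun i => Cmod (F (S (S i)) - F (S i) - (F (S i) - F i))) n.
Proof.
  intros Hq Hp F0 F1 Fn FSn.
  assert (Hq0 : 0 < INR q) by (apply lt_0_INR; lia).
  set (D := rsum _ n).
  assert (HD : 0 <= D) by (apply rsum_ge0; intros; apply Cmod_ge_0).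
  set (A := csum _ n).
  assert (HA : (RtoC (INR q) * A)%C = csum (fun m => (gauss p q (Z.of_nat m)
     * csum (fun i => (root q (Z.of_nat m * (Z.of_nat i - Z.of_nat N)) * F i)%C) n)%C) q).
  { unfold A. rewrite <- csum_scal.
    rewrite (csum_ext _ (fun i => csum (fun m => (gauss p q (Z.of_nat m)
       * (root q (Z.of_nat m * (Z.of_nat i - Z.of_nat N)) * F i))%C) q)).
    - rewrite csum_switch. apply csum_ext. intros m _. now rewrite csum_scal.
    - intros i _. rewrite Cmult_assoc, gauss_inversion by assumption.
      rewrite <- csum_scal_r. apply csum_ext. intros; ring. }
  destruct q as [|q']; [lia|]. set (q := S q') in *.
  rewrite (csum_Sl _ q') in HA.
  change (Z.of_nat 0) with 0%Z in HA.
  rewrite (csum_ext _ F) in HA by (intros i _; rewrite Z.mul_0_l, root_0; ring).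
  set (B := csum _ q') in HA.
  assert (HB : Cmod B <= sqrt (2 * INR q) * (INR q * INR q) * D * 4).
  { unfold B. eapply Rle_trans; [apply csum_Cmod|].
    apply Rle_trans with (rsum (fun m => sqrt (2 * INR q) * (INR q * INR q) * D
       * (/ (INR (S m) * INR (S m)) + / (INR (q' - m) * INR (q' - m)))) q').
    - apply rsum_le. intros m Hm. rewrite Cmod_mult.
      replace (sqrt (2 * INR q) * (INR q * INR q) * D
        * (/ (INR (S m) * INR (S m)) + / (INR (q' - m) * INR (q' - m))))
        with (sqrt (2 * INR q) * (INR q * INR q
        * (/ (INR (S m) * INR (S m)) + / (INR (q - S m) * INR (q - S m))) * D))
        by (replace (q - S m)%nat with (q' - m)%nat by (unfold q; lia); ring).
      apply Rmult_le_compat; try apply Cmod_ge_0.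
      + rewrite <- (sqrt_square (Cmod (gauss p q (Z.of_nat (S m))))) by apply Cmod_ge_0.
        apply sqrt_le_1_alt. now apply gauss_le.
      + apply linear_phase_sum; try assumption. unfold q; lia.
    - rewrite rsum_scal, rsum_plus. apply Rmult_le_compat_l.
      + pose proof (sqrt_pos (2 * INR q)). apply Rmult_le_pos; [|assumption]. nra.
      + pose proof (rsum_inv_sq q') as H1.
        rewrite (rsum_rev (fun i => / (INR (q' - i) * INR (q' - i)))).
        rewrite (rsum_ext (fun i => / (INR (q' - (q' - 1 - i)) * INR (q' - (q' - 1 - i))))
           (fun i => / (INR (S i) * INR (S i)))); [lra|].
        intros i Hi. replace (q' - (q' - 1 - i))%nat with (S i) by lia. reflexivity. }
  assert (HAB : (A - gauss p q 0 * RtoC (/ INR q) * csum F n)%C = (RtoC (/ INR q) * B)%C).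
  { assert (Hinv : (RtoC (/ INR q) * RtoC (INR q))%C = RtoC 1)
      by (rewrite <- RtoC_mult; f_equal; field; lra).
    replace A with (RtoC (/ INR q) * (RtoC (INR q) * A))%C
      by (rewrite Cmult_assoc, Hinv; ring).
    rewrite HA. ring. }
  rewrite HAB, Cmod_mult, Cmod_R.
  rewrite Rabs_right by (left; apply Rinv_0_lt_compat; assumption).
  apply Rle_trans with (/ INR q * (sqrt (2 * INR q) * (INR q * INR q) * D * 4)).
  { apply Rmult_le_compat_l; [left; now apply Rinv_0_lt_compat|exact HB]. }
  replace (/ INR q * (sqrt (2 * INR q) * (INR q * INR q) * D * 4))
    with (4 * (sqrt (2 * INR q) * INR q) * D) by (field; lra).
  rewrite sqrt_mult by lra.
  apply Rmult_le_compat_r; [assumption|].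
  assert (sqrt 2 <= 2).
  { rewrite <- (sqrt_square 2) at 2 by lra. apply sqrt_le_1_alt; lra. }
  pose proof (sqrt_pos (INR q)).
  assert (0 <= INR q * sqrt (INR q)) by nra. nra.
Qed.

(** * Amplitudes *)

(* Index [i] of a sum over the window [-N .. N] stands for the integer [i - N]. *)
Definition kk (N i : nat) : R := INR i - INR N.

(** The parabola [1 - y^2/K^2] cut off at [|y| = K]. The shape is chosen for the identity
    [headw K y / y^2 = 1/y^2 - tailw K y]; both weights are continuous, with kinks only at
    [|y| = K]. *)
Definition headw (K y : R) : R := 1 - (Rmin (Rabs y) K / K) ^ 2.
Definition tailw (X y : R) : R := / (Rmax (Rabs y) X) ^ 2.

Definition diff2 (f : R -> R) (y : R) : R := f (y + 1) - f y - (f y - f (y - 1)).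

Lemma kk_S N i : kk N (S i) = kk N i + 1.
Proof. unfold kk. rewrite S_INR. ring. Qed.

Lemma Rmin_lipschitz a b K : Rabs (Rmin a K - Rmin b K) <= Rabs (a - b).
Proof.
  unfold Rmin. destruct (Rle_dec a K), (Rle_dec b K); split_Rabs; lra.
Qed.

Lemma Rmax_lipschitz a b K : Rabs (Rmax a K - Rmax b K) <= Rabs (a - b).
Proof.
  unfold Rmax. destruct (Rle_dec a K), (Rle_dec b K); split_Rabs; lra.
Qed.

Lemma headw_bound K y : 0 < K -> 0 <= headw K y <= 1.
Proof.
  intros HK. unfold headw.
  assert (0 <= Rmin (Rabs y) K / K <= 1).
  { split.
    - apply Rmult_le_pos; [|left; now apply Rinv_0_lt_compat].
      apply Rmin_glb; [apply Rabs_pos|lra].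
    - apply Rmult_le_reg_r with K; [lra|]. unfold Rdiv. rewrite Rmult_assoc, Rinv_l by lra.
      pose proof (Rmin_r (Rabs y) K). lra. }
  nra.
Qed.

Lemma headw_lipschitz K x y :
  0 < K -> Rabs (x - y) <= 1 -> Rabs (headw K x - headw K y) <= 2 / K.
Proof.
  intros HK Hxy. unfold headw.
  set (a := Rmin (Rabs x) K). set (b := Rmin (Rabs y) K).
  assert (Ha : 0 <= a <= K) by (split; [apply Rmin_glb; [apply Rabs_pos|lra]|apply Rmin_r]).
  assert (Hb : 0 <= b <= K) by (split; [apply Rmin_glb; [apply Rabs_pos|lra]|apply Rmin_r]).
  assert (Hab : Rabs (a - b) <= 1).
  { eapply Rle_trans; [apply Rmin_lipschitz|]. eapply Rle_trans; [apply Rabs_triang_inv2|lra]. }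
  replace (1 - (a / K) ^ 2 - (1 - (b / K) ^ 2)) with ((b - a) * ((a + b) / (K * K))) by (field; lra).
  rewrite Rabs_mult, (Rabs_minus_sym b a).
  rewrite (Rabs_right ((a + b) / (K * K)))
    by (apply Rle_ge, Rmult_le_pos; [lra|left; apply Rinv_0_lt_compat; nra]).
  apply Rle_trans with (1 * (2 * K / (K * K))).
  - apply Rmult_le_compat; [apply Rabs_pos| |assumption|].
    + apply Rmult_le_pos; [lra|left; apply Rinv_0_lt_compat; nra].
    + apply Rmult_le_compat_r; [left; apply Rinv_0_lt_compat; nra|lra].
  - right; field; lra.
Qed.

Lemma tailw_bound X y : 0 < X -> 0 <= tailw X y <= / X ^ 2.
Proof.
  intros HX. unfold tailw. pose proof (Rmax_r (Rabs y) X). split.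
  - left. apply Rinv_0_lt_compat. nra.
  - apply Rinv_le_contravar; nra.
Qed.

Lemma tailw_lipschitz X x y :
  0 < X -> Rabs (x - y) <= 1 -> Rabs (tailw X x - tailw X y) <= 2 / X ^ 3.
Proof.
  intros HX Hxy. unfold tailw.
  set (a := Rmax (Rabs x) X). set (b := Rmax (Rabs y) X).
  assert (Ha : X <= a) by apply Rmax_r.
  assert (Hb : X <= b) by apply Rmax_r.
  assert (Hab : Rabs (b - a) <= 1).
  { rewrite Rabs_minus_sym.
    eapply Rle_trans; [apply Rmax_lipschitz|]. eapply Rle_trans; [apply Rabs_triang_inv2|lra]. }
  replace (/ a ^ 2 - / b ^ 2) with ((b - a) * (/ (a * b ^ 2) + / (a ^ 2 * b))) by (field; lra).
  assert (HX3 : 0 < X ^ 3) by (apply pow_lt; lra).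
  assert (H1 : / (a * b ^ 2) <= / X ^ 3).
  { apply Rinv_le_contravar; [assumption|]. replace (X ^ 3) with (X * X ^ 2) by ring.
    apply Rmult_le_compat; nra. }
  assert (H2 : / (a ^ 2 * b) <= / X ^ 3).
  { apply Rinv_le_contravar; [assumption|]. replace (X ^ 3) with (X ^ 2 * X) by ring.
    apply Rmult_le_compat; nra. }
  assert (H3 : 0 < / (a * b ^ 2)) by (apply Rinv_0_lt_compat; apply Rmult_lt_0_compat; nra).
  assert (H4 : 0 < / (a ^ 2 * b)) by (apply Rinv_0_lt_compat; apply Rmult_lt_0_compat; nra).
  rewrite Rabs_mult, (Rabs_right (_ + _)) by lra.
  apply Rle_trans with (1 * (/ (a * b ^ 2) + / (a ^ 2 * b))).
  - apply Rmult_le_compat_r; lra.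
  - unfold Rdiv. lra.
Qed.

Lemma headw_inside K y : 0 < K -> Rabs y <= K -> headw K y = 1 - y ^ 2 / K ^ 2.
Proof.
  intros HK Hy. unfold headw. rewrite Rmin_left by assumption.
  rewrite <- (pow2_abs y). field; lra.
Qed.

Lemma headw_outside K y : 0 < K -> K <= Rabs y -> headw K y = 0.
Proof.
  intros HK Hy. unfold headw. rewrite Rmin_right by assumption. field; lra.
Qed.

Lemma tailw_inside X y : Rabs y <= X -> tailw X y = / X ^ 2.
Proof. intros Hy. unfold tailw. now rewrite Rmax_right. Qed.

Lemma tailw_outside X y : X <= Rabs y -> tailw X y = / y ^ 2.
Proof. intros Hy. unfold tailw. rewrite Rmax_left by assumption. now rewrite pow2_abs. Qed.

Lemma headw_diff2 K y : 0 < K -> Rabs (diff2 (headw K) y) <= 4 / K.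
Proof.
  intros HK. unfold diff2. eapply Rle_trans; [apply Rabs_triang|]. rewrite Rabs_Ropp.
  pose proof (headw_lipschitz K (y + 1) y HK ltac:(split_Rabs; lra)).
  pose proof (headw_lipschitz K y (y - 1) HK ltac:(split_Rabs; lra)). lra.
Qed.

Lemma headw_diff2_smooth K y :
  0 < K -> (Rabs y <= K - 1 \/ K + 1 <= Rabs y) ->
  Rabs (diff2 (headw K) y) <= 2 / K ^ 2.
Proof.
  intros HK Hy. unfold diff2.
  assert (HK2 : 0 < / K ^ 2) by (apply Rinv_0_lt_compat; nra).
  destruct Hy as [Hy|Hy].
  - rewrite !headw_inside by (assumption || (split_Rabs; lra)).
    replace (_ - _) with (- (2 / K ^ 2)) by (field; lra).
    rewrite Rabs_Ropp, Rabs_right; unfold Rdiv; lra.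
  - rewrite !headw_outside by (assumption || (split_Rabs; lra)).
    replace (_ - _) with 0 by ring. rewrite Rabs_R0. unfold Rdiv; lra.
Qed.

Lemma tailw_diff2 X y : 0 < X -> Rabs (diff2 (tailw X) y) <= 4 / X ^ 3.
Proof.
  intros HX. unfold diff2. eapply Rle_trans; [apply Rabs_triang|]. rewrite Rabs_Ropp.
  pose proof (tailw_lipschitz X (y + 1) y HX ltac:(split_Rabs; lra)).
  pose proof (tailw_lipschitz X y (y - 1) HX ltac:(split_Rabs; lra)). lra.
Qed.

Lemma tailw_diff2_smooth X y :
  1 <= X -> (Rabs y <= X - 1 \/ X + 1 <= Rabs y) ->
  Rabs (diff2 (tailw X) y) <= 12 / X ^ 4.
Proof.
  intros HX Hy. unfold diff2.
  assert (HX4 : 0 < X ^ 4) by (apply pow_lt; lra).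
  assert (HiX4 : 0 < / X ^ 4) by (now apply Rinv_0_lt_compat).
  destruct Hy as [Hy|Hy].
  - rewrite !tailw_inside by (split_Rabs; lra).
    replace (_ - _) with 0 by ring. rewrite Rabs_R0. unfold Rdiv; lra.
  - rewrite !tailw_outside by (split_Rabs; lra).
    assert (Hy2 : (X + 1) ^ 2 <= y ^ 2) by (rewrite <- (pow2_abs y); nra).
    set (z := y ^ 2) in *. assert (Hz : 4 <= z) by nra.
    assert (y <> 0 /\ y + 1 <> 0 /\ y - 1 <> 0)
      by (repeat split; intros E; unfold z in Hz;
          [rewrite E in Hz | replace y with (-1) in Hz by lra | replace y with 1 in Hz by lra]; lra).
    (* With [z = y^2] this is the exact second difference of [1/y^2]; it is at most [12/z^2] because
       [z >= 4]. *)
    replace (_ - _) with ((6 * z - 2) / (z * (z - 1) ^ 2)).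
    2:{ unfold z. field. repeat split; try tauto.
        replace (y ^ 2 - 1) with ((y + 1) * (y - 1)) by ring.
        apply Rmult_integral_contrapositive_currified; tauto. }
    rewrite Rabs_right
      by (apply Rle_ge, Rmult_le_pos; [lra|left; apply Rinv_0_lt_compat; nra]).
    apply Rle_trans with (12 / z ^ 2).
    + apply Rmult_le_reg_r with (z ^ 2 * (z - 1) ^ 2); [nra|].
      replace ((6 * z - 2) / (z * (z - 1) ^ 2) * (z ^ 2 * (z - 1) ^ 2))
        with ((6 * z - 2) * z) by (field; nra).
      replace (12 / z ^ 2 * (z ^ 2 * (z - 1) ^ 2)) with (12 * (z - 1) ^ 2) by (field; nra).
      nra.
    + unfold Rdiv. apply Rmult_le_compat_l; [lra|]. apply Rinv_le_contravar; [assumption|].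
      replace (X ^ 4) with ((X ^ 2) ^ 2) by ring. apply pow_incr. nra.
Qed.

(** The sum runs over integers [y], and an integer within distance less than [1] of a kink is [K] or
    [-K]. Hence only the indices [K + N - 1] and [N - K - 1] need the crude bound [e]. *)
Lemma kink_sum (f : R -> R) c e (K N n : nat) :
  0 <= c -> 0 <= e -> (0 < K < N)%nat ->
  (forall y, Rabs (diff2 f y) <= e) ->
  (forall y, Rabs y <= INR K - 1 \/ INR K + 1 <= Rabs y -> Rabs (diff2 f y) <= c) ->
  rsum (fun i => Rabs (diff2 f (kk N (S i)))) n <= INR n * c + 2 * e.
Proof.
  intros Hc He HKN H1 H2.
  apply Rle_trans with (rsum (fun i => c + ((if Nat.eq_dec i (K + N - 1) then e else 0)
     + (if Nat.eq_dec i (N - K - 1) then e else 0))) n).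
  - apply rsum_le. intros i _.
    destruct (Nat.eq_dec i (K + N - 1)) as [E1|E1].
    { specialize (H1 (kk N (S i))). destruct (Nat.eq_dec _ _); lra. }
    destruct (Nat.eq_dec i (N - K - 1)) as [E2|E2].
    { specialize (H1 (kk N (S i))). lra. }
    enough (Rabs (diff2 f (kk N (S i))) <= c) by lra.
    apply H2. unfold kk.
    assert (S i + 1 <= N + K /\ N + 1 <= S i + K \/ N + K + 1 <= S i \/ S i + K + 1 <= N)%nat
      as [[A B]|[A|A]] by lia;
      try (apply le_INR in A); try (apply le_INR in B);
      rewrite ?plus_INR in *; simpl (INR 1) in *; rewrite ?S_INR in *;
      simpl (INR 0) in *; split_Rabs; lra.
  - rewrite !rsum_plus, rsum_const.
    pose proof (rsum_indicator_le e (K + N - 1) n He).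
    pose proof (rsum_indicator_le e (N - K - 1) n He). lra.
Qed.

(** Leibniz rule for the amplitudes [a], [b], [g] at [k-1], [k], [k+1] against the chirp
    [e^{-i s k^2}], whose first differences are at most [|s| (2|k| + 1)] and whose second difference
    is at most [2|s| + 4 k^2 s^2]. *)
Lemma chirp_diff2 s k a b g :
  Cmod (cis (- (s * (k + 1) ^ 2)) * RtoC g - cis (- (s * k ^ 2)) * RtoC b
        - (cis (- (s * k ^ 2)) * RtoC b - cis (- (s * (k - 1) ^ 2)) * RtoC a))
  <= Rabs (g - b - (b - a))
     + Rabs s * (2 * Rabs k + 1) * (Rabs (g - b) + Rabs (b - a))
     + (2 * Rabs s + 4 * k ^ 2 * s ^ 2) * Rabs b.
Proof.
  set (e := cis (- (s * k ^ 2))).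
  set (e1 := cis (- (s * (k + 1) ^ 2))). set (e0 := cis (- (s * (k - 1) ^ 2))).
  replace (e1 * RtoC g - e * RtoC b - (e * RtoC b - e0 * RtoC a))%C
    with (e * RtoC (g - b - (b - a)) + ((e1 - e) * RtoC (g - b) + (e0 - e) * RtoC (a - b))
          + (e1 - e + (e0 - e)) * RtoC b)%C by (rewrite !RtoC_minus; ring).
  assert (H1 : Cmod (e1 - e) <= Rabs s * (2 * Rabs k + 1)).
  { eapply Rle_trans; [apply Cmod_cis_minus|].
    replace (_ - _) with (- (s * (2 * k + 1))) by ring.
    rewrite Rabs_Ropp, Rabs_mult. apply Rmult_le_compat_l; [apply Rabs_pos|].
    split_Rabs; lra. }
  assert (H0 : Cmod (e0 - e) <= Rabs s * (2 * Rabs k + 1)).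
  { eapply Rle_trans; [apply Cmod_cis_minus|].
    replace (_ - _) with (s * (2 * k - 1)) by ring.
    rewrite Rabs_mult. apply Rmult_le_compat_l; [apply Rabs_pos|].
    split_Rabs; lra. }
  assert (H2 : Cmod (e1 - e + (e0 - e)) <= 2 * Rabs s + 4 * k ^ 2 * s ^ 2).
  (* Factoring out [e^{-i s k^2}] isolates the even part [2 cos (2 s k) - 2 = -4 sin^2 (s k)], which
     is quadratic in [s k]; bounding the two first differences separately would only give order
     [|s k|]. *)
  { replace (e1 - e + (e0 - e))%C
      with (e * ((cis (- s) - 1) * (cis (- (2 * s * k)) + cis (2 * s * k))
                 + (cis (- (2 * s * k)) + cis (2 * s * k) - 1 - 1)))%C.
    2:{ replace e1 with (e * (cis (- s) * cis (- (2 * s * k))))%C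
          by (unfold e, e1; rewrite <- !cis_add; f_equal; ring).
        replace e0 with (e * (cis (- s) * cis (2 * s * k)))%C
          by (unfold e, e0; rewrite <- !cis_add; f_equal; ring).
        ring. }
    unfold e. rewrite Cmod_mult, Cmod_cis, Rmult_1_l.
    eapply Rle_trans; [apply Cmod_triangle|]. apply Rplus_le_compat.
    - rewrite Cmod_mult.
      apply Rle_trans with (Rabs s * 2); [|lra].
      apply Rmult_le_compat; try apply Cmod_ge_0.
      + rewrite <- cis_0. eapply Rle_trans; [apply Cmod_cis_minus|].
        replace (- s - 0) with (- s) by ring. rewrite Rabs_Ropp; lra.
      + eapply Rle_trans; [apply Cmod_triangle|]. rewrite !Cmod_cis; lra.
    - replace (cis (- (2 * s * k)) + cis (2 * s * k) - 1 - 1)%C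
        with (RtoC (2 * (cos (2 * s * k) - 1))).
      2:{ apply injective_projections; simpl; rewrite ?cos_neg, ?sin_neg; ring. }
      rewrite Cmod_R.
      replace (2 * s * k) with (2 * (s * k)) by ring. rewrite cos_2a_sin.
      replace (2 * (1 - 2 * sin (s * k) * sin (s * k) - 1))
        with (- (4 * (Rabs (sin (s * k)) * Rabs (sin (s * k))))).
      2:{ pose proof (pow2_abs (sin (s * k))). nra. }
      rewrite Rabs_Ropp.
      pose proof (Rabs_pos (sin (s * k))). pose proof (Rabs_sin_le (s * k)).
      rewrite Rabs_right by nra.
      replace (4 * k ^ 2 * s ^ 2) with (4 * (s * k) ^ 2) by ring.
      rewrite <- (pow2_abs (s * k)). nra. }
  eapply Rle_trans; [apply Cmod_triangle|].
  eapply Rle_trans; [apply Rplus_le_compat_r, Cmod_triangle|].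
  apply Rplus_le_compat; [apply Rplus_le_compat|].
  - rewrite Cmod_mult, Cmod_R. unfold e. rewrite Cmod_cis. lra.
  - eapply Rle_trans; [apply Cmod_triangle|]. rewrite !Cmod_mult, !Cmod_R.
    rewrite (Rabs_minus_sym a b). pose proof (Rabs_pos (g - b)). pose proof (Rabs_pos (b - a)).
    nra.
  - rewrite Cmod_mult, Cmod_R. apply Rmult_le_compat_r; [apply Rabs_pos|exact H2].
Qed.

Lemma chirp_sum_diff2 (w : R -> R) s (N n : nat) B B1 Rd :
  (forall y, Rabs (w y) <= B) ->
  (forall x y, Rabs (x - y) <= 1 -> Rabs (w x - w y) <= B1) ->
  (forall i, (i < n)%nat -> Rabs (kk N (S i)) <= Rd) ->
  let F i := (cis (- (s * kk N i ^ 2)) * RtoC (w (kk N i)))%C in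
  rsum (fun i => Cmod (F (S (S i)) - F (S i) - (F (S i) - F i))) n
  <= rsum (fun i => Rabs (diff2 w (kk N (S i)))) n
     + INR n * (Rabs s * (2 * Rd + 1) * (2 * B1) + (2 * Rabs s + 4 * Rd ^ 2 * s ^ 2) * B).
Proof.
  intros HB HB1 HR F. rewrite <- rsum_const, <- rsum_plus. apply rsum_le. intros i Hi.
  unfold F. rewrite (kk_S N (S i)).
  replace (kk N i) with (kk N (S i) - 1) by (rewrite kk_S; ring).
  specialize (HR i Hi). set (k := kk N (S i)) in *.
  eapply Rle_trans; [apply chirp_diff2|]. unfold diff2.
  rewrite Rplus_assoc. apply Rplus_le_compat_l.
  pose proof (HB1 (k + 1) k ltac:(split_Rabs; lra)).
  pose proof (HB1 k (k - 1) ltac:(split_Rabs; lra)).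
  pose proof (HB k). pose proof (Rabs_pos s). pose proof (Rabs_pos k).
  pose proof (Rabs_pos (w k)).
  pose proof (Rabs_pos (w (k + 1) - w k)). pose proof (Rabs_pos (w k - w (k - 1))).
  pose proof (pow2_ge_0 s).
  assert (k ^ 2 <= Rd ^ 2) by (rewrite <- (pow2_abs k); apply pow_incr; lra).
  pose proof (pow2_ge_0 k).
  apply Rplus_le_compat.
  - apply Rmult_le_compat; [nra|lra|nra|lra].
  - apply Rmult_le_compat; [nra|lra|nra|lra].
Qed.

(** * Smoothed quadratic exponential sums *)

Definition window_sum (w : R -> R) (N : nat) (x : R) : C :=
  csum (fun i => (cis (- (x * kk N i ^ 2)) * RtoC (w (kk N i)))%C) (2 * N + 1).

Definition blockw (X y : R) : R := tailw X y - tailw (2 * X) y.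

(** The window reaches one beyond [K], so the amplitude vanishes at its first two indices and at the
    two indices that follow it; these are the boundary conditions for summing by parts twice. *)
Definition headsum (K : nat) (x : R) : C := window_sum (headw (INR K)) (S K) x.
Definition blocksum (X : nat) (x : R) : C := window_sum (blockw (INR X)) (S (2 * X)) x.

Lemma window_sum_le w N x B :
  (forall y, Rabs (w y) <= B) -> Cmod (window_sum w N x) <= INR (2 * N + 1) * B.
Proof.
  intros HB. unfold window_sum. eapply Rle_trans; [apply csum_Cmod|].
  apply rsum_le_const. intros i _. rewrite Cmod_mult, Cmod_cis, Cmod_R, Rmult_1_l. apply HB.
Qed.

Lemma headsum_le K x : (0 < K)%nat -> Cmod (headsum K x) <= 5 * INR K.
Proof.
  intros HK. assert (HK1 : 1 <= INR K) by (apply (le_INR 1); lia). eapply Rle_trans.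
  - apply (window_sum_le _ _ _ 1). intros y.
    pose proof (headw_bound (INR K) y ltac:(lra)). split_Rabs; lra.
  - rewrite plus_INR, mult_INR, (S_INR K). simpl (INR 2); simpl (INR 1). lra.
Qed.

Lemma kk_Z N i : kk N i = IZR (Z.of_nat i - Z.of_nat N).
Proof. unfold kk. rewrite minus_IZR, <- !INR_IZR_INZ. reflexivity. Qed.

Lemma Rabs_kk_le N i : (i <= 2 * N + 2)%nat -> Rabs (kk N i) <= INR N + 2.
Proof.
  intros H. apply le_INR in H. unfold kk.
  rewrite plus_INR, mult_INR in H. simpl (INR 2) in H. pose proof (pos_INR i). pose proof (pos_INR N).
  split_Rabs; lra.
Qed.

(** The phase splits into the [q]-periodic [e^{-2 pi i p k^2/q}] and the slow chirp [e^{-i s k^2}];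
    the latter joins the amplitude in [F]. *)
Lemma window_sum_approx p q N (w : R -> R) s :
  (0 < q)%nat -> rel_prime p (Z.of_nat q) -> (0 < N)%nat ->
  (forall y, INR N - 1 <= Rabs y -> w y = 0) ->
  let F i := (cis (- (s * kk N i ^ 2)) * RtoC (w (kk N i)))%C in
  Cmod (window_sum w N (2 * PI * IZR p / INR q + s)
        - gauss p q 0 * RtoC (/ INR q) * window_sum w N s)
  <= 8 * (INR q * sqrt (INR q))
     * rsum (fun i => Cmod (F (S (S i)) - F (S i) - (F (S i) - F i))) (2 * N + 1).
Proof.
  intros Hq Hp HN Hw F.
  assert (HN1 : 1 <= INR N) by (apply (le_INR 1); lia).
  assert (HF : forall i, INR N - 1 <= Rabs (kk N i) -> F i = RtoC 0).
  { intros i Hi. unfold F. rewrite Hw by assumption. ring. }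
  unfold window_sum at 1.
  rewrite (csum_ext _ (fun i =>
    (root q (- (p * (Z.of_nat i - Z.of_nat N) * (Z.of_nat i - Z.of_nat N))) * F i)%C)).
  - unfold window_sum. apply quadratic_phase_sum; try assumption; apply HF; unfold kk.
    + simpl (INR 0). split_Rabs; lra.
    + simpl (INR 1). split_Rabs; lra.
    + rewrite plus_INR, mult_INR. simpl (INR 1); simpl (INR 2). split_Rabs; lra.
    + rewrite S_INR, plus_INR, mult_INR. simpl (INR 1); simpl (INR 2). split_Rabs; lra.
  - intros i _. unfold F, root. rewrite Cmult_assoc. f_equal.
    rewrite <- cis_add. f_equal. rewrite kk_Z, opp_IZR, !mult_IZR. unfold Rdiv. ring.
Qed.

(** The three terms come from the square of the chirp's first difference, from its remaining
    contributions linear in [s], and from the amplitude alone, where about [2K] smooth differences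
    of size [1/K^2] and two kinks of size [1/K] contribute alike. *)
Lemma head_diff2_sum K s :
  (0 < K)%nat ->
  let F i := (cis (- (s * kk (S K) i ^ 2)) * RtoC (headw (INR K) (kk (S K) i)))%C in
  rsum (fun i => Cmod (F (S (S i)) - F (S i) - (F (S i) - F i))) (2 * S K + 1)
  <= 400 * (INR K ^ 3 * s ^ 2 + INR K * Rabs s + / INR K).
Proof.
  intros HK F. assert (HK1 : 1 <= INR K) by (apply (le_INR 1); lia).
  assert (HiK : 0 < / INR K) by (apply Rinv_0_lt_compat; lra).
  assert (Hn : INR (2 * S K + 1) = 2 * INR K + 3)
    by (rewrite plus_INR, mult_INR, (S_INR K); simpl (INR 2); simpl (INR 1); ring).
  eapply Rle_trans.
  - apply (chirp_sum_diff2 (headw (INR K)) s (S K) (2 * S K + 1) 1 (2 / INR K) (INR K + 3)).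
    + intros y. pose proof (headw_bound (INR K) y ltac:(lra)). split_Rabs; lra.
    + intros x y. apply headw_lipschitz. lra.
    + intros i Hi. pose proof (Rabs_kk_le (S K) (S i) ltac:(lia)) as H.
      rewrite S_INR in H. lra.
  - pose proof (kink_sum (headw (INR K)) (2 / INR K ^ 2) (4 / INR K) K (S K) (2 * S K + 1)
      ltac:(left; apply Rdiv_lt_0_compat; nra) ltac:(left; apply Rdiv_lt_0_compat; lra)
      ltac:(lia)
      ltac:(intros; apply headw_diff2; lra)
      ltac:(intros; apply headw_diff2_smooth; [lra|assumption])) as H1.
    rewrite Hn in *. set (k := INR K) in *.
    pose proof (Rabs_pos s) as Hs. set (a := Rabs s) in *.
    assert (Hs2 : s ^ 2 = a ^ 2) by (unfold a; now rewrite pow2_abs).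
    rewrite Hs2.
    assert (H2 : (2 * k + 3) * (2 / k ^ 2) + 2 * (4 / k) <= 18 * / k).
    { apply Rmult_le_reg_r with (k ^ 2); [nra|].
      replace (((2 * k + 3) * (2 / k ^ 2) + 2 * (4 / k)) * k ^ 2) with (12 * k + 6) by (field; lra).
      replace (18 * / k * k ^ 2) with (18 * k) by (field; lra). lra. }
    assert (H3 : a * (2 * (k + 3) + 1) * (2 * (2 / k)) <= 36 * a).
    { replace (a * (2 * (k + 3) + 1) * (2 * (2 / k))) with (a * ((8 * k + 28) / k)) by (field; lra).
      assert ((8 * k + 28) / k <= 36).
      { apply Rmult_le_reg_r with k; [lra|]. unfold Rdiv. rewrite Rmult_assoc, Rinv_l by lra. lra. }
      nra. }
    assert (H4 : (2 * a + 4 * (k + 3) ^ 2 * a ^ 2) * 1 <= 2 * a + 64 * k ^ 2 * a ^ 2).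
    { assert ((k + 3) ^ 2 <= 16 * k ^ 2) by nra. pose proof (pow2_ge_0 a). nra. }
    assert (H5 : (2 * k + 3) * (a * (2 * (k + 3) + 1) * (2 * (2 / k))
        + (2 * a + 4 * (k + 3) ^ 2 * a ^ 2) * 1) <= 5 * k * (38 * a + 64 * k ^ 2 * a ^ 2)).
    { apply Rle_trans with ((2 * k + 3) * (38 * a + 64 * k ^ 2 * a ^ 2)).
      - apply Rmult_le_compat_l; lra.
      - apply Rmult_le_compat_r; [|lra]. pose proof (pow2_ge_0 a). nra. }
    assert (0 <= k * a) by nra.
    assert (0 <= k ^ 3 * a ^ 2) by (apply Rmult_le_pos; [apply pow_le; lra|apply pow2_ge_0]).
    lra.
Qed.

Lemma blockw_bound X y : 1 <= X -> Rabs (blockw X y) <= / X ^ 2.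
Proof.
  intros HX. unfold blockw.
  pose proof (tailw_bound X y ltac:(lra)). pose proof (tailw_bound (2 * X) y ltac:(lra)).
  assert (/ (2 * X) ^ 2 <= / X ^ 2) by (apply Rinv_le_contravar; nra).
  split_Rabs; lra.
Qed.

Lemma blockw_outside X y : 0 < X -> 2 * X <= Rabs y -> blockw X y = 0.
Proof. intros HX Hy. unfold blockw. rewrite !tailw_outside by lra. ring. Qed.

Lemma block_diff2_sum X s :
  (0 < X)%nat ->
  let N := S (2 * X) in
  let F i := (cis (- (s * kk N i ^ 2)) * RtoC (blockw (INR X) (kk N i)))%C in
  rsum (fun i => Cmod (F (S (S i)) - F (S i) - (F (S i) - F i))) (2 * N + 1)
  <= 1000 * (INR X * s ^ 2 + Rabs s / INR X + / INR X ^ 3).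
Proof.
  intros HX N F. assert (HX1 : 1 <= INR X) by (apply (le_INR 1); lia).
  assert (HX2 : INR (2 * X) = 2 * INR X) by (rewrite mult_INR; reflexivity).
  assert (HN : INR N = 2 * INR X + 1) by (unfold N; rewrite S_INR, HX2; reflexivity).
  assert (Hn : INR (2 * N + 1) = 4 * INR X + 3)
    by (rewrite plus_INR, mult_INR, HN; simpl (INR 2); simpl (INR 1); ring).
  eapply Rle_trans.
  - apply (chirp_sum_diff2 (blockw (INR X)) s N (2 * N + 1) (/ INR X ^ 2) (3 / INR X ^ 3)
      (2 * INR X + 3)).
    + intros y. apply blockw_bound. lra.
    + intros x y Hxy. unfold blockw.
      pose proof (tailw_lipschitz (INR X) x y ltac:(lra) Hxy).
      pose proof (tailw_lipschitz (2 * INR X) x y ltac:(lra) Hxy).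
      replace (2 / (2 * INR X) ^ 3) with (1 / 4 * / INR X ^ 3) in * by (field; lra).
      assert (0 < / INR X ^ 3) by (apply Rinv_0_lt_compat, pow_lt; lra).
      unfold Rdiv in *. split_Rabs; lra.
    + intros i Hi. pose proof (Rabs_kk_le N (S i) ltac:(lia)) as H. lra.
  - assert (H1 : rsum (fun i => Rabs (diff2 (blockw (INR X)) (kk N (S i)))) (2 * N + 1)
      <= (4 * INR X + 3) * (13 / INR X ^ 4) + 9 / INR X ^ 3).
    { apply Rle_trans with (rsum (fun i => Rabs (diff2 (tailw (INR X)) (kk N (S i)))
         + Rabs (diff2 (tailw (INR (2 * X))) (kk N (S i)))) (2 * N + 1)).
      - apply rsum_le. intros i _. rewrite HX2. unfold blockw, diff2. split_Rabs; lra.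
      - rewrite rsum_plus.
        assert (HX3 : 0 < INR X ^ 3) by (apply pow_lt; lra).
        assert (HX4 : 0 < INR X ^ 4) by (apply pow_lt; lra).
        assert (HX8 : 0 < (2 * INR X) ^ 3) by (apply pow_lt; lra).
        assert (HX16 : 0 < (2 * INR X) ^ 4) by (apply pow_lt; lra).
        pose proof (kink_sum (tailw (INR X)) (12 / INR X ^ 4) (4 / INR X ^ 3) X N (2 * N + 1)
          ltac:(left; apply Rdiv_lt_0_compat; lra) ltac:(left; apply Rdiv_lt_0_compat; lra)
          ltac:(unfold N; lia)
          ltac:(intros; apply tailw_diff2; lra)
          ltac:(intros; apply tailw_diff2_smooth; assumption)) as H1.
        pose proof (kink_sum (tailw (INR (2 * X))) (12 / (2 * INR X) ^ 4) (4 / (2 * INR X) ^ 3)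
          (2 * X) N (2 * N + 1)
          ltac:(left; apply Rdiv_lt_0_compat; lra) ltac:(left; apply Rdiv_lt_0_compat; lra)
          ltac:(unfold N; lia)
          ltac:(intros; rewrite HX2; apply tailw_diff2; lra)
          ltac:(rewrite HX2; intros; apply tailw_diff2_smooth; [lra|assumption])) as H2.
        rewrite Hn in *.
        replace (12 / (2 * INR X) ^ 4) with (3 / 4 * / INR X ^ 4) in H2 by (field; lra).
        replace (4 / (2 * INR X) ^ 3) with (1 / 2 * / INR X ^ 3) in H2 by (field; lra).
        assert (0 < / INR X ^ 3) by (now apply Rinv_0_lt_compat).
        assert (0 < / INR X ^ 4) by (now apply Rinv_0_lt_compat).
        unfold Rdiv in *. nra. }
    rewrite Hn. set (k := INR X) in *.
    pose proof (Rabs_pos s) as Hs. set (a := Rabs s) in *.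
    assert (Hs2 : s ^ 2 = a ^ 2) by (unfold a; now rewrite pow2_abs). rewrite Hs2.
    assert (Hk : 0 < / k) by (apply Rinv_0_lt_compat; lra).
    assert (Hk2 : 0 < / k ^ 2) by (apply Rinv_0_lt_compat; nra).
    assert (Hk3 : 0 < / k ^ 3) by (apply Rinv_0_lt_compat, pow_lt; lra).
    assert (H2 : (4 * k + 3) * (13 / k ^ 4) + 9 / k ^ 3 <= 100 * / k ^ 3).
    { replace ((4 * k + 3) * (13 / k ^ 4)) with ((52 + 39 * / k) * / k ^ 3) by (field; lra).
      assert (/ k <= 1) by (rewrite <- Rinv_1; apply Rinv_le_contravar; lra).
      unfold Rdiv. nra. }
    assert (H3 : a * (2 * (2 * k + 3) + 1) * (2 * (3 / k ^ 3)) <= 66 * (a * / k ^ 2)).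
    { replace (a * (2 * (2 * k + 3) + 1) * (2 * (3 / k ^ 3)))
        with (a * / k ^ 2 * (24 + 42 * / k)) by (field; lra).
      assert (/ k <= 1) by (rewrite <- Rinv_1; apply Rinv_le_contravar; lra).
      assert (0 <= a * / k ^ 2) by nra. nra. }
    assert (H4 : (2 * a + 4 * (2 * k + 3) ^ 2 * a ^ 2) * / k ^ 2 <= 2 * (a * / k ^ 2) + 100 * a ^ 2).
    { replace ((2 * a + 4 * (2 * k + 3) ^ 2 * a ^ 2) * / k ^ 2)
        with (2 * (a * / k ^ 2) + 4 * a ^ 2 * (2 + 3 * / k) ^ 2) by (field; lra).
      assert (/ k <= 1) by (rewrite <- Rinv_1; apply Rinv_le_contravar; lra).
      assert ((2 + 3 * / k) ^ 2 <= 25) by nra. pose proof (pow2_ge_0 a). nra. }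
    assert (H5 : (4 * k + 3) * (a * (2 * (2 * k + 3) + 1) * (2 * (3 / k ^ 3))
        + (2 * a + 4 * (2 * k + 3) ^ 2 * a ^ 2) * / k ^ 2)
        <= 7 * k * (68 * (a * / k ^ 2) + 100 * a ^ 2)).
    { apply Rle_trans with ((4 * k + 3) * (68 * (a * / k ^ 2) + 100 * a ^ 2)).
      - apply Rmult_le_compat_l; lra.
      - apply Rmult_le_compat_r; [|lra]. pose proof (pow2_ge_0 a). nra. }
    replace (7 * k * (68 * (a * / k ^ 2) + 100 * a ^ 2))
      with (476 * (a / k) + 700 * (k * a ^ 2)) in H5 by (field; lra).
    assert (0 <= a / k) by (unfold Rdiv; nra).
    assert (0 <= k * a ^ 2) by (pose proof (pow2_ge_0 a); nra).
    lra.
Qed.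

Lemma head_approx p q K s :
  (0 < q)%nat -> rel_prime p (Z.of_nat q) -> (0 < K)%nat ->
  Cmod (headsum K (2 * PI * IZR p / INR q + s)
        - gauss p q 0 * RtoC (/ INR q) * headsum K s)
  <= 3200 * (INR q * sqrt (INR q)) * (INR K ^ 3 * s ^ 2 + INR K * Rabs s + / INR K).
Proof.
  intros Hq Hp HK. assert (0 < INR K) by (apply lt_0_INR; lia).
  eapply Rle_trans.
  - apply window_sum_approx; try assumption; try lia.
    intros y Hy. apply headw_outside; [assumption|]. rewrite S_INR in Hy. lra.
  - eapply Rle_trans; [apply Rmult_le_compat_l; [|now apply head_diff2_sum]|right; ring].
    pose proof (pos_INR q). pose proof (sqrt_pos (INR q)). nra.
Qed.

Lemma gauss_div_le p q :
  (0 < q)%nat -> rel_prime p (Z.of_nat q) ->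
  Cmod (gauss p q 0 * RtoC (/ INR q)) <= 2 / sqrt (INR q).
Proof.
  intros Hq Hp. assert (Hq0 : 0 < INR q) by (apply lt_0_INR; lia).
  pose proof (sqrt_lt_R0 _ Hq0) as Hs. pose proof (sqrt_sqrt (INR q) ltac:(lra)) as Hss.
  rewrite Cmod_mult, Cmod_R, Rabs_right by (left; now apply Rinv_0_lt_compat).
  apply Rmult_le_reg_r with (INR q); [assumption|].
  rewrite Rmult_assoc, Rinv_l, Rmult_1_r by lra.
  replace (2 / sqrt (INR q) * INR q) with (2 * sqrt (INR q))
    by (rewrite <- Hss at 3; field; lra).
  pose proof (gauss_le p q 0 Hq Hp). pose proof (Cmod_ge_0 (gauss p q 0)). nra.
Qed.

Lemma block_bound p q X s :
  (0 < q)%nat -> rel_prime p (Z.of_nat q) -> (0 < X)%nat ->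
  INR q <= 16 * INR X -> INR q * Rabs s * INR X <= 16 ->
  Cmod (blocksum X (2 * PI * IZR p / INR q + s)) <= 10 ^ 7 / (sqrt (INR q) * INR X).
Proof.
  intros Hq Hp HX HqX Hs.
  assert (Hq0 : 0 < INR q) by (apply lt_0_INR; lia).
  assert (HX1 : 1 <= INR X) by (apply (le_INR 1); lia).
  pose proof (sqrt_lt_R0 _ Hq0) as Hr. pose proof (sqrt_sqrt (INR q) ltac:(lra)) as Hss.
  assert (HX2 : INR (2 * X) = 2 * INR X) by (rewrite mult_INR; reflexivity).
  assert (H1 : Cmod (blocksum X (2 * PI * IZR p / INR q + s)
        - gauss p q 0 * RtoC (/ INR q) * blocksum X s)
     <= 8 * (INR q * sqrt (INR q)) * (1000 * (INR X * s ^ 2 + Rabs s / INR X + / INR X ^ 3))).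
  { eapply Rle_trans.
    - apply window_sum_approx; try assumption; try lia.
      intros y Hy. apply blockw_outside; [lra|]. rewrite S_INR in Hy. lra.
    - apply Rmult_le_compat_l; [nra|]. now apply block_diff2_sum. }
  assert (H2 : Cmod (gauss p q 0 * RtoC (/ INR q) * blocksum X s) <= 2 / sqrt (INR q) * (7 / INR X)).
  { rewrite Cmod_mult. apply Rmult_le_compat; try apply Cmod_ge_0.
    - now apply gauss_div_le.
    - eapply Rle_trans; [apply window_sum_le; intros; apply blockw_bound; lra|].
      rewrite plus_INR, mult_INR, (S_INR (2 * X)), HX2. simpl (INR 2); simpl (INR 1).
      apply Rmult_le_reg_r with (INR X ^ 2); [nra|].
      rewrite Rmult_assoc, Rinv_l by nra.
      replace (7 / INR X * INR X ^ 2) with (7 * INR X) by (field; lra). lra. }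
  set (W := blocksum X (2 * PI * IZR p / INR q + s)) in *.
  set (V := (gauss p q 0 * RtoC (/ INR q) * blocksum X s)%C) in *.
  assert (H3 : Cmod W <= Cmod (W - V) + Cmod V).
  { eapply Rle_trans; [|apply Cmod_triangle]. right. f_equal. ring. }
  clearbody W V. set (x := INR X) in *. set (r := sqrt (INR q)) in *.
  rewrite <- Hss in *. pose proof (Rabs_pos s) as Ha.
  rewrite <- (pow2_abs s) in H1. set (a := Rabs s) in *. clearbody a r x.
  (* Since [r^2 = q], these are the dimensionless parameters [u = q |s| X] and [v = q/X], both at
     most [16]; the error is a quadratic form in them divided by [X sqrt q]. *)
  set (u := r * r * a * x) in *. set (v := r * r / x).
  assert (Hv : 0 < v <= 16).
  { split; [apply Rdiv_lt_0_compat; nra|]. apply Rmult_le_reg_r with x; [lra|].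
    unfold v, Rdiv. rewrite Rmult_assoc, Rinv_l by lra. lra. }
  assert (Hu : 0 <= u) by (unfold u; apply Rmult_le_pos; [apply Rmult_le_pos|]; nra).
  assert (HE : 8 * (r * r * r) * (1000 * (x * a ^ 2 + a / x + / x ^ 3))
     = / (r * x) * (8000 * (u * u + u * v + v * v))).
  { unfold u, v. field. lra. }
  assert (Hrx : 0 < / (r * x)) by (apply Rinv_0_lt_compat; nra).
  assert (HB : u * u + u * v + v * v <= 768) by nra.
  replace (2 / r * (7 / x)) with (/ (r * x) * 14) in H2 by (field; lra).
  rewrite HE in H1. unfold Rdiv.
  assert (/ (r * x) * (8000 * (u * u + u * v + v * v)) <= / (r * x) * 6144000)
    by (apply Rmult_le_compat_l; lra).
  lra.
Qed.

(** [a/b] and [c/d] are neighbours around [theta] in the Farey sequence of order [n + 1]. When the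
    denominator [b + d] of the mediant becomes admissible, the mediant replaces the neighbour on its
    own side of [theta]. *)
Lemma farey_neighbours (theta : R) (n : nat) :
  exists a b c d : Z, (0 < b <= Z.of_nat (S n))%Z /\ (0 < d <= Z.of_nat (S n))%Z /\
    (Z.of_nat (S n) < b + d)%Z /\ (b * c - a * d = 1)%Z /\
    IZR a <= IZR b * theta /\ IZR d * theta <= IZR c.
Proof.
  induction n as [|n IH].
  - exists (up theta - 1)%Z, 1%Z, (up theta), 1%Z.
    destruct (archimed theta) as [H1 H2]. rewrite minus_IZR.
    repeat split; try lia; lra.
  - destruct IH as (a & b & c & d & Hb & Hd & Hbd & Hdet & Ha & Hc).
    destruct (Z_lt_le_dec (Z.of_nat (S (S n))) (b + d)) as [H|H].
    + exists a, b, c, d. repeat split; try lia; assumption.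
    + destruct (Rle_lt_dec (IZR (b + d) * theta) (IZR (a + c))) as [Hm|Hm].
      * exists a, b, (a + c)%Z, (b + d)%Z. repeat split; try lia; assumption.
      * exists (a + c)%Z, (b + d)%Z, c, d. repeat split; try lia; try assumption. lra.
Qed.

(** The chosen Farey neighbour lies on the same side of the mediant as [theta]; then its error times
    [b + d], which is at least [X + 1], is at most the determinant [b c - a d = 1]. The determinant
    also gives coprimality. *)
Lemma dirichlet_approximation (theta : R) (X : nat) :
  (0 < X)%nat ->
  exists (p : Z) (q : nat), (0 < q <= X)%nat /\ rel_prime p (Z.of_nat q) /\
    Rabs (INR q * theta - IZR p) * (INR X + 1) <= 1.
Proof.
  intros HX. destruct (farey_neighbours theta (X - 1)) as (a & b & c & d & Hb & Hd & Hbd & Hdet & Ha & Hc).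
  replace (S (X - 1)) with X in * by lia.
  assert (HbR : 0 < IZR b) by (apply (IZR_lt 0); lia).
  assert (HdR : 0 < IZR d) by (apply (IZR_lt 0); lia).
  assert (Hsum : INR X + 1 <= IZR b + IZR d).
  { rewrite INR_IZR_INZ, <- !plus_IZR. apply IZR_le. lia. }
  assert (HdetR : IZR b * IZR c - IZR a * IZR d = 1).
  { rewrite <- !mult_IZR, <- minus_IZR. now rewrite Hdet. }
  destruct (Rle_lt_dec ((IZR b + IZR d) * theta) (IZR a + IZR c)) as [Hm|Hm].
  - exists a, (Z.to_nat b). rewrite INR_IZR_INZ, Z2Nat.id by lia.
    split; [lia|split].
    + apply bezout_rel_prime. apply Bezout_intro with (- d)%Z c. lia.
    + rewrite Rabs_right by lra.
      apply Rle_trans with ((IZR b * theta - IZR a) * (IZR b + IZR d)).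
      * apply Rmult_le_compat_l; lra.
      * nra.
  - exists c, (Z.to_nat d). rewrite INR_IZR_INZ, Z2Nat.id by lia.
    split; [lia|split].
    + apply bezout_rel_prime. apply Bezout_intro with b (- a)%Z. lia.
    + rewrite Rabs_minus_sym, Rabs_right by lra.
      apply Rle_trans with ((IZR c - IZR d * theta) * (IZR b + IZR d)).
      * apply Rmult_le_compat_l; lra.
      * nra.
Qed.

Lemma rel_prime_fraction_unique p q p' q' :
  (0 < q)%nat -> (0 < q')%nat -> rel_prime p (Z.of_nat q) -> rel_prime p' (Z.of_nat q') ->
  (p' * Z.of_nat q = p * Z.of_nat q')%Z -> q = q'.
Proof.
  intros Hq Hq' Hp Hp' E.
  assert (H1 : (Z.of_nat q | Z.of_nat q')%Z).
  { apply Gauss with p; [exists p'; lia|now apply rel_prime_sym]. }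
  assert (H2 : (Z.of_nat q' | Z.of_nat q)%Z).
  { apply Gauss with p'; [exists p; lia|now apply rel_prime_sym]. }
  apply Z.divide_pos_le in H1; [|lia]. apply Z.divide_pos_le in H2; lia.
Qed.

(* For [X >= 2 q] the fraction [p/q] is replaced by a Dirichlet approximation of order [X];
   its denominator is at least [q/2], since distinct fractions repel each other. *)
Lemma block_bound_near p q X theta :
  (0 < q)%nat -> rel_prime p (Z.of_nat q) -> (0 < X)%nat -> INR q <= 16 * INR X ->
  Rabs (INR q * theta - IZR p) * INR q <= 1 ->
  Cmod (blocksum X (2 * PI * theta)) <= 2 * 10 ^ 7 / (sqrt (INR q) * INR X).
Proof.
  intros Hq Hp HX HqX Hth.
  assert (Hq0 : 0 < INR q) by (apply lt_0_INR; lia).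
  assert (HX1 : 1 <= INR X) by (apply (le_INR 1); lia).
  pose proof (sqrt_lt_R0 _ Hq0) as Hr.
  pose proof PI_4. pose proof PI_RGT_0.
  assert (Hgen : forall p' q', (0 < q')%nat ->
     2 * PI * theta = 2 * PI * IZR p' / INR q' + 2 * PI * (INR q' * theta - IZR p') / INR q').
  { intros p' q' Hq'. field. apply not_0_INR. lia. }
  assert (Habs : forall p' q', (0 < q')%nat -> INR q' *
     Rabs (2 * PI * (INR q' * theta - IZR p') / INR q') = 2 * PI * Rabs (INR q' * theta - IZR p')).
  { intros p' q' Hq'. assert (0 < INR q') by (apply lt_0_INR; lia).
    unfold Rdiv. rewrite !Rabs_mult, (Rabs_right 2), (Rabs_right PI) by lra.
    rewrite (Rabs_right (/ INR q')) by (left; now apply Rinv_0_lt_compat). field. lra. }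
  destruct (Rlt_le_dec (INR X) (2 * INR q)) as [Hc|Hc].
  - rewrite (Hgen p q Hq). eapply Rle_trans.
    + apply block_bound; try assumption. rewrite Habs by assumption.
      pose proof (Rabs_pos (INR q * theta - IZR p)).
      assert (Rabs (INR q * theta - IZR p) * INR X <= 2) by nra. nra.
    + unfold Rdiv. apply Rmult_le_compat_r; [|lra].
      left; apply Rinv_0_lt_compat; nra.
  - destruct (dirichlet_approximation theta X HX) as (p' & q' & Hq' & Hp' & Hd).
    assert (Hq'0 : 0 < INR q') by (apply lt_0_INR; lia).
    assert (Hq'X : INR q' <= INR X) by (apply le_INR; lia).
    assert (Hqq : INR q <= 2 * INR q').
    { destruct (Z.eq_dec (p' * Z.of_nat q) (p * Z.of_nat q')) as [E|E].
      - rewrite (rel_prime_fraction_unique p q p' q') by (assumption || lia). lra.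
      - assert (H1 : 1 <= Rabs (IZR p' * INR q - IZR p * INR q')).
        { rewrite !INR_IZR_INZ, <- !mult_IZR, <- minus_IZR, <- abs_IZR. apply IZR_le. lia. }
        pose proof (Rabs_triang (INR q' * (INR q * theta - IZR p))
           (- (INR q * (INR q' * theta - IZR p')))) as H2.
        replace (INR q' * (INR q * theta - IZR p) + - (INR q * (INR q' * theta - IZR p')))
          with (IZR p' * INR q - IZR p * INR q') in H2 by ring.
        rewrite Rabs_Ropp, !Rabs_mult, !(Rabs_right (INR _)) in H2 by lra.
        pose proof (Rabs_pos (INR q * theta - IZR p)).
        pose proof (Rabs_pos (INR q' * theta - IZR p')).
        set (e := Rabs (INR q * theta - IZR p)) in *.
        set (e' := Rabs (INR q' * theta - IZR p')) in *.
        assert (INR q * e' <= 1 / 2) by nra.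
        assert (1 / 2 <= INR q' * e) by lra.
        assert (INR q' * e * INR q <= INR q') by nra. nra. }
    rewrite (Hgen p' q') by lia. eapply Rle_trans.
    + apply block_bound; try assumption; try lia; try lra. rewrite Habs by lia.
      pose proof (Rabs_pos (INR q' * theta - IZR p')).
      assert (Rabs (INR q' * theta - IZR p') * INR X <= 1) by nra. nra.
    + assert (Hr' : sqrt (INR q) <= 2 * sqrt (INR q')).
      { apply Rle_trans with (sqrt (2 * 2 * INR q')).
        - apply sqrt_le_1_alt. lra.
        - rewrite sqrt_mult by lra. rewrite sqrt_square by lra. lra. }
      pose proof (sqrt_lt_R0 _ Hq'0).
      replace (2 * 10 ^ 7 / (sqrt (INR q) * INR X))
        with (10 ^ 7 * / (sqrt (INR q) / 2 * INR X)) by (field; lra).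
      unfold Rdiv at 1. apply Rmult_le_compat_l; [lra|].
      apply Rinv_le_contravar; [nra|]. apply Rmult_le_compat_r; lra.
Qed.

(** * The rescaled function and its smooth truncations *)

Lemma window_step (g : R -> C) N :
  csum (fun i => g (kk (S N) i)) (2 * S N + 1)
  = (g (- INR (S N))%R + csum (fun i => g (kk N i)) (2 * N + 1) + g (INR (S N)))%C.
Proof.
  replace (2 * S N + 1)%nat with (S (S (2 * N + 1))) by lia.
  change (csum (fun i => g (kk (S N) i)) (S (S (2 * N + 1))))
    with (csum (fun i => g (kk (S N) i)) (S (2 * N + 1)) + g (kk (S N) (S (2 * N + 1))))%C.
  rewrite csum_Sl. f_equal; [f_equal|].
  - f_equal. unfold kk. simpl (INR 0). ring.
  - apply csum_ext. intros i _. f_equal. unfold kk. rewrite !S_INR. ring.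
  - f_equal. unfold kk. rewrite !S_INR, plus_INR, mult_INR. simpl (INR 2); simpl (INR 1). ring.
Qed.

Lemma window_extend (g : R -> C) N m :
  (forall y, INR N < Rabs y -> g y = RtoC 0) ->
  csum (fun i => g (kk (N + m) i)) (2 * (N + m) + 1) = csum (fun i => g (kk N i)) (2 * N + 1).
Proof.
  intros Hg. induction m as [|m IH]; [now rewrite Nat.add_0_r|].
  rewrite Nat.add_succ_r, window_step, IH.
  assert (INR N < INR (S (N + m))) by (apply lt_INR; lia).
  pose proof (pos_INR N).
  rewrite !Hg; [ring| |]; split_Rabs; lra.
Qed.

(* At [k = 0] the factor [1 - cis 0] vanishes, so the junk value [/ 0] is harmless. *)
Definition psi_term (x y : R) : C := ((1 - cis (- (x * y ^ 2))) * RtoC (/ y ^ 2))%C.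

Definition psi_partial (N : nat) (x : R) : C :=
  ((0, x) + csum (fun i => psi_term x (kk N i)) (2 * N + 1))%C.

Definition psi (x : R) : C :=
  (4 * PI ^ 2 * fst (phi (x / (4 * PI ^ 2))), 4 * PI ^ 2 * snd (phi (x / (4 * PI ^ 2)))).

Lemma Cmod_1_minus_cis y : Cmod (1 - cis y) <= 2.
Proof. eapply Rle_trans; [apply Cmod_minus_le|]. rewrite Cmod_cis, Cmod_1. lra. Qed.

Lemma Cmod_1_minus_cis_le y : Cmod (1 - cis y) <= Rabs y.
Proof.
  rewrite <- cis_0. eapply Rle_trans; [apply Cmod_cis_minus|].
  rewrite Rabs_minus_sym, Rminus_0_r. lra.
Qed.

Lemma Rabs_fst_le_Cmod (z : C) : Rabs (fst z) <= Cmod z.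
Proof. eapply Rle_trans; [|apply Rmax_Cmod]. apply Rmax_l. Qed.

Lemma Rabs_snd_le_Cmod (z : C) : Rabs (snd z) <= Cmod z.
Proof. eapply Rle_trans; [|apply Rmax_Cmod]. apply Rmax_r. Qed.

Lemma Cmod_le_sum (z : C) : Cmod z <= Rabs (fst z) + Rabs (snd z).
Proof.
  pose proof (Rabs_pos (fst z)). pose proof (Rabs_pos (snd z)).
  unfold Cmod. rewrite <- (pow2_abs (fst z)), <- (pow2_abs (snd z)).
  rewrite <- (sqrt_square (Rabs (fst z) + Rabs (snd z))) by lra.
  apply sqrt_le_1_alt. nra.
Qed.

Lemma psi_partial_tail x N m :
  (0 < N)%nat -> Cmod (psi_partial (N + m) x - psi_partial N x) <= 4 / INR N - 4 / INR (N + m).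
Proof.
  intros HN. induction m as [|m IH].
  - rewrite Nat.add_0_r. replace (_ - _)%C with (RtoC 0) by ring. rewrite Cmod_0. lra.
  - rewrite Nat.add_succ_r. set (M := (N + m)%nat) in *.
    assert (HM : 0 < INR M) by (apply lt_0_INR; unfold M; lia).
    assert (Hstep : Cmod (psi_partial (S M) x - psi_partial M x) <= 4 / INR M - 4 / INR (S M)).
    { unfold psi_partial. rewrite (window_step (psi_term x)).
      replace (_ - _)%C with (psi_term x (- INR (S M))%R + psi_term x (INR (S M)))%C by ring.
      assert (Hb : forall y, y ^ 2 = INR (S M) ^ 2 -> Cmod (psi_term x y) <= 2 * / INR (S M) ^ 2).
      { intros y Hy. unfold psi_term. rewrite Hy, Cmod_mult, Cmod_R.
        rewrite S_INR. rewrite (Rabs_right (/ (INR M + 1) ^ 2))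
          by (left; apply Rinv_0_lt_compat; nra).
        apply Rmult_le_compat_r; [left; apply Rinv_0_lt_compat; nra|apply Cmod_1_minus_cis]. }
      eapply Rle_trans; [apply Cmod_triangle|].
      pose proof (Hb (- INR (S M)) ltac:(ring)). pose proof (Hb (INR (S M)) ltac:(ring)).
      enough (4 * / INR (S M) ^ 2 <= 4 / INR M - 4 / INR (S M)) by lra.
      rewrite S_INR. replace (4 / INR M - 4 / (INR M + 1)) with (4 * / (INR M * (INR M + 1))) by (field; lra).
      apply Rmult_le_compat_l; [lra|]. apply Rinv_le_contravar; nra. }
    replace (psi_partial (S M) x - psi_partial N x)%C
      with ((psi_partial (S M) x - psi_partial M x) + (psi_partial M x - psi_partial N x))%C by ring.
    eapply Rle_trans; [apply Cmod_triangle|]. lra.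
Qed.

Lemma psi_partial_cauchy x N M :
  (0 < N)%nat -> (N <= M)%nat -> Cmod (psi_partial M x - psi_partial N x) <= 4 / INR N.
Proof.
  intros HN HM. replace M with (N + (M - N))%nat by lia.
  eapply Rle_trans; [now apply psi_partial_tail|].
  assert (0 < 4 / INR (N + (M - N))) by (apply Rdiv_lt_0_compat; [lra|apply lt_0_INR; lia]). lra.
Qed.

(** Stated for any 1-Lipschitz [f] in order to treat real and imaginary parts at once. *)
Lemma psi_partial_converges (f : C -> R) x :
  (forall z w, Rabs (f z - f w) <= Cmod (z - w)) ->
  exists l, Un_cv (fun N => f (psi_partial N x)) l.
Proof.
  intros Hf. destruct (Rcomplete.R_complete (fun N => f (psi_partial N x))) as [l Hl]; [|now exists l].
  intros eps Heps. destruct (archimed_cor1 (eps / 4) ltac:(lra)) as [N [HN HN0]].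
  exists N. assert (HNR : 0 < INR N) by (apply lt_0_INR; lia).
  assert (Hlt : 4 / INR N < eps).
  { unfold Rdiv. apply (Rmult_lt_compat_l 4) in HN; lra. }
  assert (Hw : forall a b, (N <= a)%nat -> (a <= b)%nat ->
      Rabs (f (psi_partial b x) - f (psi_partial a x)) < eps).
  { intros a b Ha Hb. eapply Rle_lt_trans; [apply Hf|].
    eapply Rle_lt_trans; [apply psi_partial_cauchy; lia|].
    eapply Rle_lt_trans; [|exact Hlt]. unfold Rdiv. apply Rmult_le_compat_l; [lra|].
    apply Rinv_le_contravar; [assumption|]. apply le_INR; lia. }
  intros a b Ha Hb. unfold R_dist. destruct (Nat.le_ge_cases a b).
  - rewrite Rabs_minus_sym. apply Hw; lia.
  - apply Hw; lia.
Qed.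

Lemma phi_term_psi t (k : Z) :
  fst (phi_term t k) = / (4 * PI ^ 2) * fst (psi_term (4 * PI ^ 2 * t) (IZR k)) /\
  snd (phi_term t k) = / (4 * PI ^ 2) * ((if Z.eq_dec k 0 then 4 * PI ^ 2 * t else 0)
     + snd (psi_term (4 * PI ^ 2 * t) (IZR k))).
Proof.
  pose proof PI_RGT_0. unfold phi_term, psi_term.
  destruct (Z.eq_dec k 0) as [->|Hk].
  - replace (- (4 * PI ^ 2 * t * 0 ^ 2)) with 0 by ring. rewrite cis_0.
    replace ((1 - 1) * RtoC (/ 0 ^ 2))%C with (RtoC 0) by ring. simpl. split; field; lra.
  - assert (IZR k <> 0) by (now apply not_0_IZR).
    replace (4 * PI ^ 2 * t * IZR k ^ 2) with (4 * PI ^ 2 * IZR k ^ 2 * t) by ring.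
    set (th := 4 * PI ^ 2 * IZR k ^ 2 * t). cbn [fst snd cis Cmult Cminus Cplus Copp RtoC].
    rewrite cos_neg, sin_neg. split; field; split; (assumption || lra).
Qed.

Lemma rsum_kronecker N c :
  rsum (fun i => if Z.eq_dec (Z.of_nat i - Z.of_nat N) 0 then c else 0) (2 * N + 1) = c.
Proof.
  replace (2 * N + 1)%nat with (N + S N)%nat by lia. rewrite rsum_add, rsum_Sl.
  rewrite (rsum_ext _ (fun _ => 0)).
  2:{ intros i Hi. destruct (Z.eq_dec _ _); [lia|reflexivity]. }
  rewrite (rsum_ext (fun i => if Z.eq_dec (Z.of_nat (N + S i) - Z.of_nat N) 0 then c else 0) (fun _ => 0)).
  2:{ intros i Hi. destruct (Z.eq_dec _ _); [lia|reflexivity]. }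
  rewrite !rsum_const. destruct (Z.eq_dec _ _); [ring|lia].
Qed.

Lemma phi_partial_psi t N :
  fst (phi_partial t N) = / (4 * PI ^ 2) * fst (psi_partial N (4 * PI ^ 2 * t)) /\
  snd (phi_partial t N) = / (4 * PI ^ 2) * snd (psi_partial N (4 * PI ^ 2 * t)).
Proof.
  unfold phi_partial. cbn [fst snd]. rewrite !sum_f_R0_rsum.
  replace (S (2 * N)) with (2 * N + 1)%nat by lia. unfold psi_partial.
  split.
  - rewrite (rsum_ext _ (fun i => / (4 * PI ^ 2) * fst (psi_term (4 * PI ^ 2 * t) (kk N i)))).
    + rewrite rsum_scal. f_equal. cbn [fst Cplus]. rewrite fst_csum. ring.
    + intros i _. rewrite kk_Z. apply phi_term_psi.
  - rewrite (rsum_ext _ (fun i => / (4 * PI ^ 2) * ((if Z.eq_dec (Z.of_nat i - Z.of_nat N) 0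
       then 4 * PI ^ 2 * t else 0) + snd (psi_term (4 * PI ^ 2 * t) (kk N i))))).
    + rewrite rsum_scal, rsum_plus, rsum_kronecker. f_equal. cbn [snd Cplus].
      rewrite snd_csum. ring.
    + intros i _. rewrite kk_Z. apply phi_term_psi.
Qed.

(** The series converges, so the choice operator in [phi] does return its sum. *)
Lemma phi_spec t : phi_is_sum t (phi t).
Proof.
  unfold phi. apply epsilon_spec.
  destruct (psi_partial_converges fst (4 * PI ^ 2 * t)) as [l1 H1].
  { intros z w. change (fst z - fst w) with (fst (z - w)%C). apply Rabs_fst_le_Cmod. }
  destruct (psi_partial_converges snd (4 * PI ^ 2 * t)) as [l2 H2].
  { intros z w. change (snd z - snd w) with (snd (z - w)%C). apply Rabs_snd_le_Cmod. }
  exists (/ (4 * PI ^ 2) * l1, / (4 * PI ^ 2) * l2). cbn [fst snd].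
  assert (Hsc : forall u v c l, (forall n, v n = c * u n) -> Un_cv u l -> Un_cv v (c * l)).
  { intros u v c l Hv Hu. apply Un_cv_ext with (fun n => c * u n); [intros; symmetry; apply Hv|].
    apply (CV_mult (fun _ => c) u); [|exact Hu].
    intros e He. exists 0%nat. intros. unfold R_dist. rewrite Rminus_diag, Rabs_R0. exact He. }
  split.
  - apply (Hsc _ _ _ _ (fun n => proj1 (phi_partial_psi t n)) H1).
  - apply (Hsc _ _ _ _ (fun n => proj2 (phi_partial_psi t n)) H2).
Qed.

Lemma Un_cv_bound u l c N :
  Un_cv u l -> (forall n, (N <= n)%nat -> Rabs (u n - u N) <= c) -> Rabs (l - u N) <= c.
Proof.
  intros Hu Hb. apply Rle_plus_epsilon. intros e He.
  destruct (Hu e He) as [M HM]. specialize (HM (Nat.max M N) ltac:(lia)).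
  specialize (Hb (Nat.max M N) ltac:(lia)). unfold R_dist in HM. split_Rabs; lra.
Qed.

Lemma psi_psi_partial x N : (0 < N)%nat -> Cmod (psi x - psi_partial N x) <= 8 / INR N.
Proof.
  intros HN. pose proof PI_RGT_0. assert (HPI : 0 < 4 * PI ^ 2) by nra.
  destruct (phi_spec (x / (4 * PI ^ 2))) as [H1 H2].
  assert (Hx : 4 * PI ^ 2 * (x / (4 * PI ^ 2)) = x) by (field; lra).
  assert (Hb : forall n, (N <= n)%nat -> Cmod (psi_partial n x - psi_partial N x) <= 4 / INR N)
    by (intros; now apply psi_partial_cauchy).
  assert (Hgen : forall (u v : nat -> R) l, Un_cv u l ->
     (forall n, u n = / (4 * PI ^ 2) * v n) ->
     (forall n, (N <= n)%nat -> Rabs (v n - v N) <= 4 / INR N) ->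
     Rabs (4 * PI ^ 2 * l - v N) <= 4 / INR N).
  { intros u v l Hu Huv Hv.
    assert (Hl : Rabs (l - u N) <= / (4 * PI ^ 2) * (4 / INR N)).
    { apply Un_cv_bound; [exact Hu|]. intros n Hn. rewrite !Huv, <- Rmult_minus_distr_l.
      rewrite Rabs_mult, Rabs_right by (left; now apply Rinv_0_lt_compat).
      apply Rmult_le_compat_l; [left; now apply Rinv_0_lt_compat|now apply Hv]. }
    replace (4 * PI ^ 2 * l - v N) with (4 * PI ^ 2 * (l - u N)) by (rewrite Huv; field; lra).
    rewrite Rabs_mult, Rabs_right by lra.
    apply (Rmult_le_compat_l (4 * PI ^ 2)) in Hl; [|lra].
    replace (4 * PI ^ 2 * (/ (4 * PI ^ 2) * (4 / INR N))) with (4 / INR N) in Hl; [exact Hl|].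
    field. split; [apply not_0_INR; lia|lra]. }
  eapply Rle_trans; [apply Cmod_le_sum|].
  assert (Hp := phi_partial_psi (x / (4 * PI ^ 2))). rewrite Hx in Hp.
  pose proof (Hgen _ (fun n => fst (psi_partial n x)) _ H1 (fun n => proj1 (Hp n))
     (fun n Hn => Rle_trans _ _ _ (Rabs_fst_le_Cmod (psi_partial n x - psi_partial N x)) (Hb n Hn))).
  pose proof (Hgen _ (fun n => snd (psi_partial n x)) _ H2 (fun n => proj2 (Hp n))
     (fun n Hn => Rle_trans _ _ _ (Rabs_snd_le_Cmod (psi_partial n x - psi_partial N x)) (Hb n Hn))).
  unfold psi. cbn [fst snd Cminus Cplus Copp]. unfold Rminus, Rdiv in *. lra.
Qed.

(** For [y <> 0] the coefficient is [1/y^2 - 1/max(|y|,K)^2], which vanishes from [|y| = K] on;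
    differentiating in [x] restores the bounded amplitude [headw]. *)
Definition head_term (K : R) (x y : R) : C :=
  ((1 - cis (- (x * y ^ 2))) * RtoC (headw K y * / y ^ 2))%C.

Definition head (K : nat) (x : R) : C :=
  ((0, x) + csum (fun i => head_term (INR K) x (kk (S K) i)) (2 * S K + 1))%C.

Lemma headw_div K y : 0 < K -> y <> 0 -> headw K y * / y ^ 2 = / y ^ 2 - tailw K y.
Proof.
  intros HK Hy. assert (0 < Rabs y) by (now apply Rabs_pos_lt).
  unfold headw, tailw. rewrite <- (pow2_abs y). unfold Rmin, Rmax.
  destruct (Rle_dec (Rabs y) K); field; lra.
Qed.

(** Inside the window the coefficients differ by at most [1/K^2], over [2K + 3] terms with a factor
    of modulus at most [2], giving [10/K]; the tail beyond the window gives [8/K]. *)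
Lemma psi_head x K : (0 < K)%nat -> Cmod (psi x - head K x) <= 18 / INR K.
Proof.
  intros HK. assert (HK1 : 1 <= INR K) by (apply (le_INR 1); lia).
  assert (HiK : 0 < / INR K) by (apply Rinv_0_lt_compat; lra).
  replace (psi x - head K x)%C
    with ((psi x - psi_partial (S K) x) + (psi_partial (S K) x - head K x))%C by ring.
  eapply Rle_trans; [apply Cmod_triangle|].
  assert (H1 : Cmod (psi x - psi_partial (S K) x) <= 8 / INR K).
  { eapply Rle_trans; [apply psi_psi_partial; lia|]. unfold Rdiv.
    apply Rmult_le_compat_l; [lra|]. apply Rinv_le_contravar; [lra|]. rewrite S_INR; lra. }
  assert (H2 : Cmod (psi_partial (S K) x - head K x) <= 10 / INR K).
  { unfold psi_partial, head.
    replace (_ - _)%C with (csum (fun i => (psi_term x (kk (S K) i)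
       - head_term (INR K) x (kk (S K) i))%C) (2 * S K + 1)) by (rewrite csum_minus; ring).
    eapply Rle_trans; [apply csum_Cmod|].
    apply Rle_trans with (INR (2 * S K + 1) * (2 * / INR K ^ 2)).
    - apply rsum_le_const. intros i _. set (y := kk (S K) i).
      destruct (Req_dec y 0) as [E|E].
      + unfold psi_term, head_term. rewrite E. replace (- (x * 0 ^ 2)) with 0 by ring.
        rewrite cis_0. replace (_ - _)%C with (RtoC 0) by ring. rewrite Cmod_0.
        assert (0 < / INR K ^ 2) by (apply Rinv_0_lt_compat; nra). lra.
      + unfold psi_term, head_term. rewrite headw_div by (assumption || lra).
        replace (_ - _)%C with ((1 - cis (- (x * y ^ 2))) * RtoC (tailw (INR K) y))%C
          by (rewrite RtoC_minus; ring).
        rewrite Cmod_mult, Cmod_R. pose proof (tailw_bound (INR K) y ltac:(lra)).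
        rewrite (Rabs_right (tailw _ _)) by lra.
        apply Rmult_le_compat; [apply Cmod_ge_0|lra|apply Cmod_1_minus_cis|lra].
    - rewrite plus_INR, mult_INR, (S_INR K). simpl (INR 2); simpl (INR 1).
      apply Rmult_le_reg_r with (INR K ^ 2); [nra|].
      replace (((1 + 1) * (INR K + 1) + 1) * (2 * / INR K ^ 2) * INR K ^ 2)
        with (4 * INR K + 6) by (field; lra).
      replace (10 / INR K * INR K ^ 2) with (10 * INR K) by (field; lra). lra. }
  unfold Rdiv in *. lra.
Qed.

(** The coefficients [1/k^2] cancel between the two truncations and leave [blockw]. The part without
    phase is [blocksum X 0], which is independent of [x] and disappears when two points are
    compared. *)
Lemma head_double X x :
  (0 < X)%nat ->
  (head (2 * X) x - head X x)%C = (blocksum X 0 - blocksum X x)%C.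
Proof.
  intros HX. assert (HXR : 0 < INR X) by (apply lt_0_INR; lia).
  assert (HX2 : INR (2 * X) = 2 * INR X) by (rewrite mult_INR; reflexivity).
  assert (He : csum (fun i => head_term (INR X) x (kk (S X) i)) (2 * S X + 1)
     = csum (fun i => head_term (INR X) x (kk (S (2 * X)) i)) (2 * S (2 * X) + 1)).
  { replace (S (2 * X)) with (S X + X)%nat by lia.
    rewrite (window_extend (head_term (INR X) x)); [reflexivity|].
    intros y Hy. rewrite S_INR in Hy. unfold head_term.
    rewrite headw_outside by lra. rewrite Rmult_0_l. ring. }
  unfold head, blocksum, window_sum. rewrite He.
  transitivity (csum (fun i => (head_term (INR (2 * X)) x (kk (S (2 * X)) i)
      - head_term (INR X) x (kk (S (2 * X)) i))%C) (2 * S (2 * X) + 1));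
    [rewrite csum_minus; ring|].
  rewrite <- csum_minus. apply csum_ext. intros i _. set (y := kk _ i).
  unfold head_term. replace (- (0 * y ^ 2)) with 0 by ring. rewrite cis_0.
  destruct (Req_dec y 0) as [E|E].
  - rewrite E. replace (- (x * 0 ^ 2)) with 0 by ring. rewrite cis_0. ring.
  - rewrite !headw_div by (assumption || lra). unfold blockw. rewrite HX2, !RtoC_minus. ring.
Qed.

(** Telescoping over the scales [2^j K]: the block errors [(A + B)/(2^j K)] form a geometric series
    with sum [2 (A + B)/K]. The induction carries the exact remainder of that series, and [psi_head]
    closes the gap to [psi] in the limit. *)
Lemma psi_head_diff K x y A B :
  (0 < K)%nat ->
  (forall X, (K <= X)%nat -> Cmod (blocksum X x) <= A / INR X) ->
  (forall X, (K <= X)%nat -> Cmod (blocksum X y) <= B / INR X) ->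
  Cmod (psi x - psi y - (head K x - head K y)) <= 2 * (A + B) / INR K.
Proof.
  intros HK HA HB. assert (HK0 : 0 < INR K) by (apply lt_0_INR; lia).
  assert (Hj : forall j, Cmod (head (2 ^ j * K) x - head (2 ^ j * K) y - (head K x - head K y))
     <= 2 * (A + B) / INR K - 2 * (A + B) / INR (2 ^ j * K)).
  { induction j as [|j IH].
    - replace (2 ^ 0 * K)%nat with K by (simpl; lia).
      replace (_ - _)%C with (RtoC 0) by ring. rewrite Cmod_0. lra.
    - replace (2 ^ S j * K)%nat with (2 * (2 ^ j * K))%nat by (simpl; lia).
      assert (Hpow : (1 <= 2 ^ j)%nat) by (apply Nat.neq_0_lt_0, Nat.pow_nonzero; lia).
      assert (HX : (K <= 2 ^ j * K)%nat) by nia.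
      set (X := (2 ^ j * K)%nat) in *.
      assert (HX0 : 0 < INR X) by (apply lt_0_INR; lia).
      replace (head (2 * X) x - head (2 * X) y - (head K x - head K y))%C
        with ((head (2 * X) x - head X x) - (head (2 * X) y - head X y)
              + (head X x - head X y - (head K x - head K y)))%C by ring.
      rewrite !head_double by lia.
      replace (blocksum X 0 - blocksum X x - (blocksum X 0 - blocksum X y))%C
        with (blocksum X y - blocksum X x)%C by ring.
      eapply Rle_trans; [apply Cmod_triangle|].
      pose proof (Cmod_minus_le (blocksum X y) (blocksum X x)).
      specialize (HA X HX). specialize (HB X HX).
      replace (INR (2 * X)) with (2 * INR X) by (rewrite mult_INR; reflexivity).
      replace (2 * (A + B) / (2 * INR X)) with (A / INR X + B / INR X) by (field; lra).
      replace (2 * (A + B) / INR X) with (2 * (A / INR X) + 2 * (B / INR X)) in IH by (field; lra).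
      lra. }
  apply Rle_plus_epsilon. intros e He.
  assert (HAB : 0 <= A + B).
  { pose proof (HA K ltac:(lia)) as H1. pose proof (HB K ltac:(lia)) as H2.
    pose proof (Cmod_ge_0 (blocksum K x)). pose proof (Cmod_ge_0 (blocksum K y)).
    assert (H5 : 0 <= (A + B) / INR K) by (unfold Rdiv in *; lra).
    apply (Rmult_le_compat_r (INR K)) in H5; [|lra].
    unfold Rdiv in H5. rewrite Rmult_assoc, Rinv_l in H5; lra. }
  destruct (archimed_cor1 (e / 36) ltac:(lra)) as [n [Hn Hn0]].
  set (X := (2 ^ n * K)%nat).
  assert (HnX : (n <= X)%nat).
  { pose proof (Nat.pow_gt_lin_r 2 n ltac:(lia)). unfold X. nia. }
  assert (HX0 : 0 < INR X) by (apply lt_0_INR; lia).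
  assert (HXe : 18 / INR X <= e / 2).
  { apply Rle_trans with (18 * / INR n); [|lra]. unfold Rdiv. apply Rmult_le_compat_l; [lra|].
    apply Rinv_le_contravar; [apply lt_0_INR; lia|now apply le_INR]. }
  specialize (Hj n). fold X in Hj.
  assert (0 <= 2 * (A + B) / INR X)
    by (apply Rmult_le_pos; [lra|left; now apply Rinv_0_lt_compat]).
  pose proof (psi_head x X ltac:(lia)). pose proof (psi_head y X ltac:(lia)).
  replace (psi x - psi y - (head K x - head K y))%C
    with ((psi x - head X x) - (psi y - head X y)
          + (head X x - head X y - (head K x - head K y)))%C by ring.
  eapply Rle_trans; [apply Cmod_triangle|].
  pose proof (Cmod_minus_le (psi x - head X x) (psi y - head X y)). lra.
Qed.

(** Componentwise, so that [auto_derive] and the real mean value theorem apply. *)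
Definition cderiv (f : R -> C) (x : R) (d : C) : Prop :=
  is_derive (fun y => fst (f y)) x (fst d) /\ is_derive (fun y => snd (f y)) x (snd d).

Lemma cderiv_plus f g x d e :
  cderiv f x d -> cderiv g x e -> cderiv (fun y => (f y + g y)%C) x (d + e)%C.
Proof.
  intros [H1 H2] [H3 H4]. split; cbn [fst snd Cplus]; now apply @is_derive_plus.
Qed.

Lemma cderiv_const c x : cderiv (fun _ => c) x 0.
Proof. split; cbn [fst snd RtoC]; apply @is_derive_const. Qed.

Lemma cderiv_csum (f : nat -> R -> C) (d : nat -> C) x n :
  (forall i, cderiv (f i) x (d i)) -> cderiv (fun y => csum (fun i => f i y) n) x (csum d n).
Proof.
  intros H. induction n as [|n IH]; simpl; [apply cderiv_const|now apply cderiv_plus].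
Qed.

Lemma cderiv_scal c f x d : cderiv f x d -> cderiv (fun y => (c * f y)%C) x (c * d)%C.
Proof.
  intros [H1 H2]. split; cbn [fst snd Cmult].
  - apply @is_derive_minus; now apply is_derive_scal.
  - apply @is_derive_plus; now apply is_derive_scal.
Qed.

Lemma cderiv_shift f a x d : cderiv f (a + x) d -> cderiv (fun y => f (a + y)) x d.
Proof.
  intros [H1 H2].
  assert (H : forall (g : R -> R) (l : R), is_derive g (a + x) l -> is_derive (fun y => g (a + y)) x l).
  { intros g l Hg. replace l with (1 * l) by ring.
    apply (is_derive_comp g (fun y => a + y)); [exact Hg|]. auto_derive; [trivial|ring]. }
  split; [apply (H (fun y => fst (f y)))|apply (H (fun y => snd (f y)))]; assumption.
Qed.

(** The mean value theorem fails for complex values, so it is applied to each coordinate; this is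
    the origin of the factor [2]. *)
Lemma mean_value_bound (f g : R -> C) r E xi :
  (forall s, cderiv f s (g s)) ->
  (forall s, Rabs s <= r -> Cmod (g s) <= E) -> Rabs xi <= r ->
  Cmod (f xi - f 0) <= 2 * E * Rabs xi.
Proof.
  intros Hd Hb Hxi. eapply Rle_trans; [apply Cmod_le_sum|].
  assert (Hgen : forall (u v : R -> R), (forall s, is_derive u s (v s)) ->
     (forall s, Rabs s <= r -> Rabs (v s) <= E) -> Rabs (u xi - u 0) <= E * Rabs xi).
  { intros u v Hu Hv. destruct (MVT_gen u 0 xi v) as [c [Hc Heq]].
    - intros; apply Hu.
    - intros y _. apply continuity_pt_filterlim, @ex_derive_continuous. exists (v y). apply Hu.
    - rewrite Heq, Rabs_mult, Rminus_0_r. apply Rmult_le_compat_r; [apply Rabs_pos|].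
      apply Hv. revert Hc Hxi. unfold Rmin, Rmax. destruct (Rle_dec 0 xi); split_Rabs; lra. }
  pose proof (Hgen (fun y => fst (f y)) (fun s => fst (g s)) (fun s => proj1 (Hd s))
    (fun s Hs => Rle_trans _ _ _ (Rabs_fst_le_Cmod _) (Hb s Hs))) as H1.
  pose proof (Hgen (fun y => snd (f y)) (fun s => snd (g s)) (fun s => proj2 (Hd s))
    (fun s Hs => Rle_trans _ _ _ (Rabs_snd_le_Cmod _) (Hb s Hs))) as H2.
  cbn [fst snd Cminus Cplus Copp]. unfold Rminus in *. lra.
Qed.

(** Differentiation cancels [1/k^2] for [k <> 0]. The term [k = 0] of the head contributes nothing,
    and the derivative of the linear part [i x] supplies exactly the missing term of [headsum]. *)
Lemma cderiv_head K x : (0 < K)%nat -> cderiv (head K) x (Ci * headsum K x).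
Proof.
  intros HK. assert (HKR : 0 < INR K) by (apply lt_0_INR; lia). unfold head.
  replace (Ci * headsum K x)%C with (Ci + csum (fun i =>
    (Ci * cis (- (x * kk (S K) i ^ 2))
     * RtoC (headw (INR K) (kk (S K) i) * / kk (S K) i ^ 2 * kk (S K) i ^ 2))%C) (2 * S K + 1))%C.
  - apply cderiv_plus.
    + split; cbn [fst snd]; [apply @is_derive_const|apply @is_derive_id].
    + apply cderiv_csum. intros i. set (y := kk (S K) i). unfold head_term.
      set (h := headw (INR K) y * / y ^ 2). set (z := y ^ 2).
      split; cbn [fst snd cis Cmult Cminus Cplus Copp RtoC Ci];
        (auto_derive; [trivial|rewrite ?cos_neg, ?sin_neg; ring]).
  - unfold headsum, window_sum. rewrite <- csum_scal.
    set (n := (2 * S K + 1)%nat).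
    assert (Hk0 : kk (S K) (S K) = 0) by (unfold kk; ring).
    assert (Hd : csum (fun i => (Ci * (cis (- (x * kk (S K) i ^ 2)) * RtoC (headw (INR K) (kk (S K) i)))
        - Ci * cis (- (x * kk (S K) i ^ 2))
          * RtoC (headw (INR K) (kk (S K) i) * / kk (S K) i ^ 2 * kk (S K) i ^ 2))%C) n = Ci).
    { rewrite (csum_single _ n (S K)); [| unfold n; lia |].
      - rewrite Hk0. replace (- (x * 0 ^ 2)) with 0 by ring. rewrite cis_0.
        rewrite headw_inside by (rewrite ?Rabs_R0; lra).
        replace (1 - 0 ^ 2 / INR K ^ 2) with 1 by (field; lra).
        replace (1 * / 0 ^ 2 * 0 ^ 2) with 0 by ring. ring.
      - intros i _ Hi. assert (kk (S K) i <> 0).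
        { unfold kk. intros E. apply Hi. apply INR_eq. lra. }
        replace (headw (INR K) (kk (S K) i) * / kk (S K) i ^ 2 * kk (S K) i ^ 2)
          with (headw (INR K) (kk (S K) i)) by (field; assumption). ring. }
    rewrite csum_minus in Hd. rewrite <- Hd at 1. ring.
Qed.

Lemma head_0 K : head K 0 = RtoC 0.
Proof.
  unfold head. rewrite (csum_ext _ (fun _ => RtoC 0)).
  - rewrite csum_zero. unfold Cplus, RtoC; simpl. f_equal; ring.
  - intros i _. unfold head_term. rewrite Rmult_0_l, Ropp_0, cis_0. ring.
Qed.

(* Near [2 pi p/q] the smoothed curve is a copy of the one near [0], rotated and scaled
   by the normalised Gauss sum. *)
Lemma head_near_rational p q K r xi :
  (0 < q)%nat -> rel_prime p (Z.of_nat q) -> (0 < K)%nat -> Rabs xi <= r ->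
  let a := 2 * PI * IZR p / INR q in
  Cmod (head K (a + xi) - head K a - gauss p q 0 * RtoC (/ INR q) * head K xi)
  <= 6400 * (INR q * sqrt (INR q)) * (INR K ^ 3 * r ^ 2 + INR K * r + / INR K) * Rabs xi.
Proof.
  intros Hq Hp HK Hxi a. set (c := (gauss p q 0 * RtoC (/ INR q))%C).
  assert (HK0 : 0 < INR K) by (apply lt_0_INR; lia).
  pose proof (pos_INR q). pose proof (sqrt_pos (INR q)).
  set (f := fun y => (head K (a + y) + - c * head K y)%C).
  replace (head K (a + xi) - head K a - c * head K xi)%C with (f xi - f 0)%C.
  2:{ unfold f. rewrite head_0, Rplus_0_r. ring. }
  eapply Rle_trans.
  - apply (mean_value_bound f (fun s => (Ci * headsum K (a + s) + - c * (Ci * headsum K s))%C) r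
     (3200 * (INR q * sqrt (INR q)) * (INR K ^ 3 * r ^ 2 + INR K * r + / INR K))).
    + intros s. unfold f. apply cderiv_plus.
      * apply (cderiv_shift (head K)). now apply cderiv_head.
      * apply cderiv_scal. now apply cderiv_head.
    + intros s Hs.
      replace (Ci * headsum K (a + s) + - c * (Ci * headsum K s))%C
        with (Ci * (headsum K (a + s) - c * headsum K s))%C by ring.
      rewrite Cmod_mult, Cmod_Ci, Rmult_1_l. eapply Rle_trans; [now apply head_approx|].
      apply Rmult_le_compat_l; [nra|]. apply Rplus_le_compat_r, Rplus_le_compat.
      * rewrite <- (pow2_abs s). apply Rmult_le_compat_l; [apply pow_le; lra|].
        apply pow_incr. split; [apply Rabs_pos|assumption].
      * apply Rmult_le_compat_l; lra.
    + exact Hxi.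
  - right; ring.
Qed.

(** * Behaviour near rational points *)

Lemma psi_head_near p q K theta theta' :
  (0 < q)%nat -> rel_prime p (Z.of_nat q) -> (0 < K)%nat -> INR q <= 16 * INR K ->
  Rabs (INR q * theta - IZR p) * INR q <= 1 ->
  Rabs (INR q * theta' - IZR p) * INR q <= 1 ->
  Cmod (psi (2 * PI * theta) - psi (2 * PI * theta')
        - (head K (2 * PI * theta) - head K (2 * PI * theta')))
  <= 8 * 10 ^ 7 / (sqrt (INR q) * INR K).
Proof.
  intros Hq Hp HK HqK H1 H2.
  assert (Hq0 : 0 < INR q) by (apply lt_0_INR; lia).
  assert (HK0 : 0 < INR K) by (apply lt_0_INR; lia).
  pose proof (sqrt_lt_R0 _ Hq0) as Hr.
  assert (Hb : forall th X, Rabs (INR q * th - IZR p) * INR q <= 1 -> (K <= X)%nat ->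
     Cmod (blocksum X (2 * PI * th)) <= 2 * 10 ^ 7 / sqrt (INR q) / INR X).
  { intros th X Hth HX. apply le_INR in HX as HXR. eapply Rle_trans.
    - apply (block_bound_near p q X th); try assumption; try lia. lra.
    - right. field. split; lra. }
  eapply Rle_trans.
  - apply (psi_head_diff K _ _ (2 * 10 ^ 7 / sqrt (INR q)) (2 * 10 ^ 7 / sqrt (INR q)) HK).
    + intros X HX. now apply Hb.
    + intros X HX. now apply Hb.
  - right. field. split; lra.
Qed.

Lemma head_lipschitz K x y :
  (0 < K)%nat -> Cmod (head K y - head K x) <= 10 * INR K * Rabs (y - x).
Proof.
  intros HK.
  pose proof (mean_value_bound (fun s => head K (x + s)) (fun s => (Ci * headsum K (x + s))%C)
    (Rabs (y - x)) (5 * INR K) (y - x)) as Hm.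
  cbv beta in Hm. rewrite Rplus_0_r in Hm. replace (x + (y - x)) with y in Hm by ring.
  eapply Rle_trans; [apply Hm|right; ring].
  - intros s. apply (cderiv_shift (head K)). now apply cderiv_head.
  - intros s _. rewrite Cmod_mult, Cmod_Ci, Rmult_1_l. now apply headsum_le.
  - lra.
Qed.

Lemma head_le K xi : (0 < K)%nat -> Cmod (head K xi) <= 10 * INR K * Rabs xi.
Proof.
  intros HK. pose proof (head_lipschitz K 0 xi HK) as H.
  rewrite head_0, Rminus_0_r in H. now replace (head K xi) with (head K xi - 0)%C by ring.
Qed.

(** With [K = q] and [|xi| <= 8/q^2] all errors have size [q^(-3/2)]: the blocks give
    [q^(-1/2) q^(-1)], the comparison of heads [q^(3/2) q^(-1) q^(-2)], and the rotated head
    [q^(-1/2) q q^(-2)]. *)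
Lemma psi_near_rational p q theta :
  (0 < q)%nat -> rel_prime p (Z.of_nat q) ->
  Rabs (INR q * theta - IZR p) * INR q <= 1 ->
  Cmod (psi (2 * PI * theta) - psi (2 * PI * IZR p / INR q)) <= 10 ^ 8 / (INR q * sqrt (INR q)).
Proof.
  intros Hq Hp Hth.
  assert (Hq0 : 0 < INR q) by (apply lt_0_INR; lia).
  pose proof (sqrt_lt_R0 _ Hq0) as Hr. pose proof (sqrt_sqrt (INR q) ltac:(lra)) as Hss.
  pose proof PI_4. pose proof PI_RGT_0.
  assert (H1 := psi_head_near p q q theta (IZR p / INR q) Hq Hp Hq ltac:(lra) Hth).
  replace (INR q * (IZR p / INR q) - IZR p) with 0 in H1 by (field; lra).
  rewrite Rabs_R0 in H1. specialize (H1 ltac:(lra)).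
  replace (2 * PI * (IZR p / INR q)) with (2 * PI * IZR p / INR q) in H1 by (field; lra).
  set (xi := 2 * PI * (INR q * theta - IZR p) / INR q).
  assert (Hxi : Rabs xi <= 8 / INR q ^ 2).
  { unfold xi, Rdiv. rewrite !Rabs_mult, (Rabs_right 2), (Rabs_right PI) by lra.
    rewrite (Rabs_right (/ INR q)) by (left; now apply Rinv_0_lt_compat).
    apply Rmult_le_reg_r with (INR q ^ 2); [nra|].
    rewrite (Rmult_assoc 8), Rinv_l by nra.
    replace (2 * PI * Rabs (INR q * theta - IZR p) * / INR q * INR q ^ 2)
      with (2 * PI * (Rabs (INR q * theta - IZR p) * INR q)) by (field; lra).
    pose proof (Rabs_pos (INR q * theta - IZR p)).
    assert (0 <= Rabs (INR q * theta - IZR p) * INR q) by nra. nra. }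
  assert (H2 := head_near_rational p q q (8 / INR q ^ 2) xi Hq Hp Hq Hxi). cbv zeta in H2.
  assert (H3 : Cmod (gauss p q 0 * RtoC (/ INR q) * head q xi)
     <= 2 / sqrt (INR q) * (10 * INR q * (8 / INR q ^ 2))).
  { rewrite Cmod_mult. apply Rmult_le_compat; try apply Cmod_ge_0.
    - now apply gauss_div_le.
    - eapply Rle_trans; [now apply head_le|]. apply Rmult_le_compat_l; lra. }
  assert (H4 : 6400 * (INR q * sqrt (INR q)) * (INR q ^ 3 * (8 / INR q ^ 2) ^ 2
      + INR q * (8 / INR q ^ 2) + / INR q) * Rabs xi
      <= 6400 * (INR q * sqrt (INR q)) * (INR q ^ 3 * (8 / INR q ^ 2) ^ 2
      + INR q * (8 / INR q ^ 2) + / INR q) * (8 / INR q ^ 2)).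
  { apply Rmult_le_compat_l; [|assumption].
    assert (0 < / INR q) by (now apply Rinv_0_lt_compat).
    replace (INR q ^ 3 * (8 / INR q ^ 2) ^ 2 + INR q * (8 / INR q ^ 2) + / INR q)
      with (73 * / INR q) by (field; lra).
    apply Rmult_le_pos; nra. }
  set (a := 2 * PI * IZR p / INR q) in *.
  replace (a + xi) with (2 * PI * theta) in H2 by (unfold a, xi; field; lra).
  set (t := 2 * PI * theta) in *.
  replace (psi t - psi a)%C with ((psi t - psi a - (head q t - head q a))
     + ((head q t - head q a - gauss p q 0 * RtoC (/ INR q) * head q xi)
        + gauss p q 0 * RtoC (/ INR q) * head q xi))%C by ring.
  eapply Rle_trans; [apply Cmod_triangle|].
  eapply Rle_trans; [apply Rplus_le_compat_l, Cmod_triangle|].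
  eapply Rle_trans.
  - apply Rplus_le_compat; [exact H1|apply Rplus_le_compat; [exact (Rle_trans _ _ _ H2 H4)|exact H3]].
  - set (r := sqrt (INR q)) in *. rewrite <- Hss.
    assert (Hrr : 0 < / (r * r * r)) by (apply Rinv_0_lt_compat; nra).
    replace (8 * 10 ^ 7 / (r * (r * r)) + (6400 * (r * r * r) * ((r * r) ^ 3 * (8 / (r * r) ^ 2) ^ 2
      + r * r * (8 / (r * r) ^ 2) + / (r * r)) * (8 / (r * r) ^ 2)
      + 2 / r * (10 * (r * r) * (8 / (r * r) ^ 2))))
      with (83737760 * / (r * r * r)) by (field; lra).
    unfold Rdiv. lra.
Qed.

(** Square root growth at the origin: each of the [2n + 1] terms with [|k| <= n] has modulus at most
    [|xi| <= 1/n^2], and the higher frequencies sum to [O(1/n)]. The constant is [4 + 8 + 18]. *)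
Lemma head_le_sqrt K n xi :
  (0 < n <= K)%nat -> Rabs xi <= / INR n ^ 2 -> Cmod (head K xi) <= 30 / INR n.
Proof.
  intros Hn Hxi. assert (Hn1 : 1 <= INR n) by (apply (le_INR 1); lia).
  assert (HnK : INR n <= INR K) by (apply le_INR; lia).
  pose proof (psi_head xi K ltac:(lia)) as H1.
  pose proof (psi_psi_partial xi n ltac:(lia)) as H2.
  assert (H3 : Cmod (psi_partial n xi) <= 4 / INR n).
  { unfold psi_partial. eapply Rle_trans; [apply Cmod_triangle|].
    assert (Ha : Cmod (0, xi) <= / INR n ^ 2).
    { eapply Rle_trans; [apply Cmod_le_sum|]. cbn [fst snd]. rewrite Rabs_R0. lra. }
    assert (Hb : Cmod (csum (fun i => psi_term xi (kk n i)) (2 * n + 1))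
        <= INR (2 * n + 1) * / INR n ^ 2).
    { eapply Rle_trans; [apply csum_Cmod|]. apply rsum_le_const. intros i _.
      set (y := kk n i). unfold psi_term. rewrite Cmod_mult, Cmod_R.
      assert (Hn2 : 0 < / INR n ^ 2) by (apply Rinv_0_lt_compat; nra).
      destruct (Req_dec y 0) as [E|E].
      - rewrite E. replace (- (xi * 0 ^ 2)) with 0 by ring. rewrite cis_0.
        replace (1 - 1)%C with (RtoC 0) by ring. rewrite Cmod_0. lra.
      - assert (Hy : 0 < y ^ 2) by (rewrite <- pow2_abs; apply pow_lt, Rabs_pos_lt; exact E).
        rewrite (Rabs_right (/ y ^ 2)) by (left; now apply Rinv_0_lt_compat).
        apply Rmult_le_reg_r with (y ^ 2); [assumption|].
        rewrite Rmult_assoc, Rinv_l, Rmult_1_r by lra.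
        eapply Rle_trans; [apply Cmod_1_minus_cis_le|].
        rewrite Rabs_Ropp, Rabs_mult, (Rabs_right (y ^ 2)) by lra. nra. }
    rewrite plus_INR, mult_INR in Hb. simpl (INR 2) in Hb; simpl (INR 1) in Hb.
    assert (H4 : / INR n ^ 2 + ((1 + 1) * INR n + 1) * / INR n ^ 2 <= 4 / INR n).
    { apply Rmult_le_reg_r with (INR n ^ 2); [nra|].
      replace ((/ INR n ^ 2 + ((1 + 1) * INR n + 1) * / INR n ^ 2) * INR n ^ 2)
        with (2 * INR n + 2) by (field; lra).
      replace (4 / INR n * INR n ^ 2) with (4 * INR n) by (field; lra). lra. }
    lra. }
  replace (head K xi) with ((psi xi - psi_partial n xi) - (psi xi - head K xi)
     + psi_partial n xi)%C by ring.
  eapply Rle_trans; [apply Cmod_triangle|].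
  pose proof (Cmod_minus_le (psi xi - psi_partial n xi) (psi xi - head K xi)).
  assert (18 / INR K <= 18 / INR n).
  { unfold Rdiv. apply Rmult_le_compat_l; [lra|]. apply Rinv_le_contravar; lra. }
  unfold Rdiv in *. lra.
Qed.

(** * Lower bounds for the truncated curve near the origin *)

Lemma one_minus_cos_ge y : 0 <= y <= 1 -> y ^ 2 / 4 <= 1 - cos y.
Proof.
  intros Hy. pose proof PI2_1. pose proof PI_RGT_0.
  destruct (pre_cos_bound y 0 ltac:(lra) ltac:(lra)) as [_ H1].
  unfold cos_approx, cos_term in H1; simpl in H1.
  assert (0 <= y * y * (1 - y * y)) by (apply Rmult_le_pos; nra).
  pose proof (pow2_ge_0 y). lra.
Qed.

Lemma rsum_sq_ge n : INR n ^ 3 / 3 <= rsum (fun j => INR (S j) ^ 2) n.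
Proof.
  induction n as [|n IH]; [simpl; lra|].
  cbn [rsum]. pose proof (pos_INR n). rewrite S_INR. nra.
Qed.

Lemma window_sum_ge (g : R -> R) N n :
  (n <= N)%nat -> (forall y, 0 <= g y) ->
  rsum (fun j => g (INR (S j))) n <= rsum (fun i => g (kk N i)) (2 * N + 1).
Proof.
  intros Hn Hg. replace (2 * N + 1)%nat with (S N + (n + (N - n)))%nat by lia.
  rewrite !rsum_add.
  pose proof (rsum_ge0 (fun i => g (kk N i)) (S N) ltac:(intros; apply Hg)).
  pose proof (rsum_ge0 (fun i => g (kk N (S N + (n + i)))) (N - n) ltac:(intros; apply Hg)).
  rewrite (rsum_ext (fun j => g (INR (S j))) (fun i => g (kk N (S N + i)))); [lra|].
  intros i _. f_equal. unfold kk. rewrite plus_INR, !S_INR. ring.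
Qed.

Lemma fst_head_term K x y :
  fst (head_term K x y) = (1 - cos (x * y ^ 2)) * (headw K y * / y ^ 2).
Proof.
  unfold head_term. cbn [fst snd cis Cmult Cminus Cplus Copp RtoC]. rewrite cos_neg. ring.
Qed.

Lemma snd_head_term K x y :
  snd (head_term K x y) = sin (x * y ^ 2) * (headw K y * / y ^ 2).
Proof.
  unfold head_term. cbn [fst snd cis Cmult Cminus Cplus Copp RtoC]. rewrite sin_neg. ring.
Qed.

Lemma fst_head K x :
  fst (head K x) = rsum (fun i => (1 - cos (x * kk (S K) i ^ 2))
    * (headw (INR K) (kk (S K) i) * / kk (S K) i ^ 2)) (2 * S K + 1).
Proof.
  unfold head. cbn [fst Cplus]. rewrite fst_csum, Rplus_0_l.
  apply rsum_ext. intros; apply fst_head_term.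
Qed.

Lemma snd_head K x :
  snd (head K x) = x + rsum (fun i => sin (x * kk (S K) i ^ 2)
    * (headw (INR K) (kk (S K) i) * / kk (S K) i ^ 2)) (2 * S K + 1).
Proof.
  unfold head. cbn [snd Cplus]. rewrite snd_csum.
  f_equal. apply rsum_ext. intros; apply snd_head_term.
Qed.

Lemma head_opp K x : fst (head K (- x)) = fst (head K x) /\ snd (head K (- x)) = - snd (head K x).
Proof.
  rewrite !fst_head, !snd_head. split.
  - apply rsum_ext. intros i _. rewrite Ropp_mult_distr_l_reverse, cos_neg. reflexivity.
  - rewrite Ropp_plus_distr. f_equal.
    transitivity (-1 * rsum (fun i => sin (x * kk (S K) i ^ 2)
      * (headw (INR K) (kk (S K) i) * / kk (S K) i ^ 2)) (2 * S K + 1)); [|ring].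
    rewrite <- rsum_scal. apply rsum_ext. intros i _.
    rewrite Ropp_mult_distr_l_reverse, sin_neg. ring.
Qed.

Lemma inv_sq_ge0 y : 0 <= / y ^ 2.
Proof.
  destruct (Req_dec y 0) as [->|E].
  - rewrite pow_i by lia. rewrite Rinv_0. lra.
  - left. apply Rinv_0_lt_compat. rewrite <- pow2_abs. apply pow_lt, Rabs_pos_lt, E.
Qed.

(** Here [3/16] is [1/4] times [3/4]: the phase is at most [1], so [1 - cos y >= y^2/4] applies, and
    a frequency at most [K/2] keeps the weight above [3/4]. *)
Lemma head_weight_ge (K n : nat) j :
  (2 * n <= K)%nat -> (j < n)%nat ->
  3 / 16 * (INR (S j) ^ 4 / INR n ^ 4)
  <= (1 - cos (/ INR n ^ 2 * INR (S j) ^ 2)) * headw (INR K) (INR (S j)).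
Proof.
  intros HnK Hj. assert (Hn1 : 1 <= INR n) by (apply (le_INR 1); lia).
  assert (Hj1 : 1 <= INR (S j)) by (apply (le_INR 1); lia).
  assert (Hjn : INR (S j) <= INR n) by (apply le_INR; lia).
  apply le_INR in HnK. rewrite mult_INR in HnK. simpl (INR 2) in HnK.
  set (k := INR (S j)) in *. set (u := INR n) in *. set (v := INR K) in *.
  assert (H1 : 3 / 4 <= headw v k).
  { rewrite headw_inside by (try lra; rewrite Rabs_right; lra).
    enough (k ^ 2 / v ^ 2 <= 1 / 4) by lra.
    apply Rmult_le_reg_r with (v ^ 2); [nra|]. unfold Rdiv.
    rewrite Rmult_assoc, Rinv_l by nra. nra. }
  assert (H2 : 0 <= / u ^ 2 * k ^ 2 <= 1).
  { split; [apply Rmult_le_pos; [apply inv_sq_ge0|nra]|].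
    apply Rmult_le_reg_l with (u ^ 2); [nra|].
    rewrite <- Rmult_assoc, Rinv_r by nra. nra. }
  pose proof (one_minus_cos_ge _ H2) as H3.
  replace ((/ u ^ 2 * k ^ 2) ^ 2 / 4) with (1 / 4 * (k ^ 4 / u ^ 4)) in H3 by (field; lra).
  assert (0 <= k ^ 4 / u ^ 4).
  { apply Rmult_le_pos; [apply pow_le; lra|left; apply Rinv_0_lt_compat, pow_lt; lra]. }
  pose proof (headw_bound v k ltac:(lra)). nra.
Qed.

(** All terms of the real part are nonnegative, so it suffices to keep [1 <= k <= n], where [k^2]
    sums to at least [n^3/3]. *)
Lemma fst_head_ge K n : (0 < n)%nat -> (2 * n <= K)%nat -> / (16 * INR n) <= fst (head K (/ INR n ^ 2)).
Proof.
  intros Hn HnK. assert (Hn1 : 1 <= INR n) by (apply (le_INR 1); lia).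
  assert (HK0 : 0 < INR K) by (apply lt_0_INR; lia).
  rewrite fst_head. eapply Rle_trans.
  2:{ apply (window_sum_ge (fun y => (1 - cos (/ INR n ^ 2 * y ^ 2)) * (headw (INR K) y * / y ^ 2))
        (S K) n ltac:(lia)).
      intros y. pose proof (COS_bound (/ INR n ^ 2 * y ^ 2)).
      pose proof (headw_bound (INR K) y HK0). pose proof (inv_sq_ge0 y).
      apply Rmult_le_pos; [lra|]. apply Rmult_le_pos; lra. }
  apply Rle_trans with (rsum (fun j => 3 / 16 / INR n ^ 4 * INR (S j) ^ 2) n).
  - rewrite rsum_scal. pose proof (rsum_sq_ge n).
    apply Rle_trans with (3 / 16 / INR n ^ 4 * (INR n ^ 3 / 3)); [right; field; lra|].
    apply Rmult_le_compat_l; [|assumption].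
    left. apply Rdiv_lt_0_compat; [lra|apply pow_lt; lra].
  - apply rsum_le. intros j Hj. pose proof (head_weight_ge K n j HnK Hj) as H.
    assert (Hj1 : 1 <= INR (S j)) by (apply (le_INR 1); lia).
    apply (Rmult_le_compat_r (/ INR (S j) ^ 2)) in H; [|apply inv_sq_ge0].
    eapply Rle_trans; [|eapply Rle_trans; [exact H|right; ring]].
    right. field. split; lra.
Qed.

(* The antiderivative of [snd (head K)] has nonnegative terms, although [snd (head K)] has not. *)
Lemma snd_head_not_small K n e :
  (0 < n)%nat -> (2 * n <= K)%nat ->
  (forall s, 0 <= s <= / INR n ^ 2 -> snd (head K s) <= e) -> 3 / (16 * INR n) <= e.
Proof.
  intros Hn HnK He. assert (Hn1 : 1 <= INR n) by (apply (le_INR 1); lia).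
  assert (HK0 : 0 < INR K) by (apply lt_0_INR; lia).
  set (g := fun s y => (1 - cos (s * y ^ 2)) * (headw (INR K) y * (/ y ^ 2 * / y ^ 2))).
  set (Y := fun s => s * s / 2 + rsum (fun i => g s (kk (S K) i)) (2 * S K + 1)).
  assert (HY : forall s, is_derive Y s (snd (head K s))).
  { intros s. rewrite snd_head. unfold Y.
    apply @is_derive_plus; [auto_derive; [trivial|field]|].
    generalize (2 * S K + 1)%nat. intros l. induction l as [|m IH]; cbn [rsum].
    { exact (is_derive_const (0 : R) s). }
    apply @is_derive_plus; [exact IH|].
    set (y := kk (S K) m). unfold g.
    destruct (Req_dec y 0) as [E|E].
    - rewrite E. apply is_derive_ext with (fun _ => 0).
      + intros t. replace (t * 0 ^ 2) with 0 by ring. rewrite cos_0, Rminus_diag.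
        symmetry. apply Rmult_0_l.
      + replace (s * 0 ^ 2) with 0 by ring. rewrite sin_0, Rmult_0_l.
        exact (is_derive_const (0 : R) s).
    - assert (Hz : y ^ 2 <> 0) by (now apply pow_nonzero).
      set (h := headw (INR K) y). set (z := y ^ 2) in *. clearbody h z.
      auto_derive; [trivial|]. field. exact Hz. }
  set (xi := / INR n ^ 2). assert (Hxi : 0 < xi) by (apply Rinv_0_lt_compat; nra).
  (* [Y] vanishes at [0] and is at least [3/(16 n^3)] at [xi = 1/n^2], so the mean of [snd (head K)]
     over [[0, xi]] is at least [3/(16 n)]. *)
  destruct (MVT_gen Y 0 xi (fun s => snd (head K s))) as [c [Hc Heq]].
  - intros; apply HY.
  - intros y _. apply continuity_pt_filterlim, @ex_derive_continuous. eexists; apply HY.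
  - rewrite Rmin_left, Rmax_right in Hc by lra.
    assert (HY0 : Y 0 = 0).
    { unfold Y. rewrite (rsum_ext _ (fun _ => 0)); [rewrite rsum_const; field|].
      intros i _. unfold g. rewrite Rmult_0_l, cos_0. ring. }
    assert (HYxi : 3 / 16 / INR n ^ 3 <= Y xi).
    { unfold Y. pose proof (window_sum_ge (g xi) (S K) n ltac:(lia)) as H.
      assert (Hg : forall y, 0 <= g xi y).
      { intros y. unfold g. pose proof (COS_bound (xi * y ^ 2)).
        pose proof (headw_bound (INR K) y HK0). pose proof (inv_sq_ge0 y).
        apply Rmult_le_pos; [lra|]. apply Rmult_le_pos; [lra|]. now apply Rmult_le_pos. }
      specialize (H Hg).
      assert (H2 : rsum (fun _ => 3 / 16 / INR n ^ 4) n <= rsum (fun j => g xi (INR (S j))) n).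
      { apply rsum_le. intros j Hj. pose proof (head_weight_ge K n j HnK Hj) as H2.
        assert (Hj1 : 1 <= INR (S j)) by (apply (le_INR 1); lia).
        pose proof (inv_sq_ge0 (INR (S j))) as H3.
        apply (Rmult_le_compat_r (/ INR (S j) ^ 2 * / INR (S j) ^ 2)) in H2;
          [|now apply Rmult_le_pos].
        unfold g. eapply Rle_trans; [|eapply Rle_trans; [exact H2|right; unfold xi; ring]].
        right. field. split; lra. }
      rewrite rsum_const in H2.
      replace (3 / 16 / INR n ^ 3) with (INR n * (3 / 16 / INR n ^ 4)) by (field; lra).
      assert (0 <= xi * xi / 2) by nra. lra. }
    specialize (He c Hc). rewrite HY0, !Rminus_0_r in Heq. rewrite Heq in HYxi.
    apply (Rmult_le_compat_r xi) in He; [|lra].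
    apply Rmult_le_reg_r with xi; [assumption|].
    replace (3 / (16 * INR n) * xi) with (3 / 16 / INR n ^ 3) by (unfold xi; field; lra).
    lra.
Qed.

Lemma dot_le v (z : C) : on_S1 v -> Rabs (dot v z) <= Cmod z.
Proof.
  unfold on_S1, dot, Cmod. intros Hv. rewrite <- sqrt_Rsqr_abs. apply sqrt_le_1_alt.
  unfold Rsqr. pose proof (pow2_ge_0 (fst v * snd z - snd v * fst z)). nra.
Qed.

Lemma dot_minus v (z w : C) : dot v (z - w)%C = dot v z - dot v w.
Proof. unfold dot. cbn [fst snd Cplus Cminus Copp]. ring. Qed.

(* With [K = lam n] and [n = lam^2 q], the rescaled head has size [1/n] on [|xi| <= 1/n^2],
   which dominates all error terms by a factor [lam]. *)
Lemma psi_corner_approx p q lam xi :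
  (0 < q)%nat -> rel_prime p (Z.of_nat q) -> (0 < lam)%nat ->
  Rabs xi <= / INR (lam * lam * q) ^ 2 ->
  let a := 2 * PI * IZR p / INR q in
  Cmod (psi (a + xi) - psi a
        - gauss p q 0 * RtoC (/ INR q) * head (lam * (lam * lam * q)) xi)
  <= 10 ^ 8 / (INR lam ^ 3 * INR q * sqrt (INR q)).
Proof.
  intros Hq Hp Hl Hxi a. set (K := (lam * (lam * lam * q))%nat).
  assert (Hq1 : 1 <= INR q) by (apply (le_INR 1); lia).
  assert (Hl1 : 1 <= INR lam) by (apply (le_INR 1); lia).
  assert (HKn : (0 < K)%nat) by (unfold K; nia).
  assert (HK : INR K = INR lam ^ 3 * INR q) by (unfold K; rewrite !mult_INR; ring).
  rewrite !mult_INR in Hxi.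
  pose proof (sqrt_lt_R0 (INR q) ltac:(lra)) as Hr.
  pose proof (sqrt_sqrt (INR q) ltac:(lra)) as Hss.
  pose proof PI2_1. pose proof PI_RGT_0.
  assert (Hl3 : 1 <= INR lam ^ 3) by (apply pow_R1_Rle; lra).
  set (u := INR lam) in *. set (m := INR q) in *.
  assert (Hxi2 : Rabs xi * m ^ 2 <= 1).
  { apply Rle_trans with (/ (u * u * m) ^ 2 * m ^ 2).
    - apply Rmult_le_compat_r; [nra|assumption].
    - replace (/ (u * u * m) ^ 2 * m ^ 2) with (/ (u ^ 4)) by (field; lra).
      rewrite <- Rinv_1. apply Rinv_le_contravar; [lra|]. apply pow_R1_Rle; lra. }
  assert (H1 := psi_head_near p q K ((a + xi) / (2 * PI)) (a / (2 * PI)) Hq Hp HKn).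
  replace (2 * PI * ((a + xi) / (2 * PI))) with (a + xi) in H1 by (field; lra).
  replace (2 * PI * (a / (2 * PI))) with a in H1 by (field; lra).
  fold m in H1. rewrite HK in H1.
  replace (m * ((a + xi) / (2 * PI)) - IZR p) with (m * xi / (2 * PI)) in H1
    by (unfold a; fold m; field; lra).
  replace (m * (a / (2 * PI)) - IZR p) with 0 in H1 by (unfold a; fold m; field; lra).
  rewrite Rabs_R0 in H1.
  specialize (H1 ltac:(nra)).
  assert (Hc : Rabs (m * xi / (2 * PI)) * m <= 1).
  { unfold Rdiv. rewrite !Rabs_mult, (Rabs_right m) by lra.
    rewrite (Rabs_right (/ (2 * PI))) by (left; apply Rinv_0_lt_compat; lra).
    assert (/ (2 * PI) <= 1) by (rewrite <- Rinv_1; apply Rinv_le_contravar; lra).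
    assert (0 < / (2 * PI)) by (apply Rinv_0_lt_compat; lra).
    replace (m * Rabs xi * / (2 * PI) * m) with (Rabs xi * m ^ 2 * / (2 * PI)) by ring.
    pose proof (Rabs_pos xi). assert (0 <= Rabs xi * m ^ 2) by nra. nra. }
  specialize (H1 Hc ltac:(lra)).
  assert (H2 := head_near_rational p q K (/ (u * u * m) ^ 2) xi Hq Hp HKn Hxi).
  cbv zeta in H2. fold m in H2. fold a in H2. rewrite HK in H2.
  (* The three summands equal [u/m], [1/(u m)] and [1/(u^3 m)]; the first dominates. *)
  set (B := (u ^ 3 * m) ^ 3 * (/ (u * u * m) ^ 2) ^ 2
      + u ^ 3 * m * / (u * u * m) ^ 2 + / (u ^ 3 * m)) in H2.
  assert (HB : 0 <= B <= 3 * u / m).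
  { replace B with ((u + / u + / (u ^ 3)) * / m) by (unfold B; field; lra).
    assert (0 < / m) by (apply Rinv_0_lt_compat; lra).
    assert (0 < / u <= 1) by (split; [apply Rinv_0_lt_compat|rewrite <- Rinv_1; apply Rinv_le_contravar]; lra).
    assert (0 < / u ^ 3 <= 1) by (split; [apply Rinv_0_lt_compat|rewrite <- Rinv_1; apply Rinv_le_contravar]; lra).
    unfold Rdiv. split; [apply Rmult_le_pos; lra|]. apply Rmult_le_compat_r; lra. }
  assert (H3 : 6400 * (m * sqrt m) * B * Rabs xi
     <= 6400 * (m * sqrt m) * (3 * u / m) * / (u * u * m) ^ 2).
  { pose proof (Rabs_pos xi).
    apply Rmult_le_compat; [| assumption | | assumption].
    - apply Rmult_le_pos; [nra|lra].
    - apply Rmult_le_compat_l; [nra|lra]. }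
  replace (psi (a + xi) - psi a - gauss p q 0 * RtoC (/ m) * head K xi)%C
    with ((psi (a + xi) - psi a - (head K (a + xi) - head K a))
      + (head K (a + xi) - head K a - gauss p q 0 * RtoC (/ m) * head K xi))%C by ring.
  eapply Rle_trans; [apply Cmod_triangle|].
  eapply Rle_trans; [apply Rplus_le_compat; [exact H1|exact (Rle_trans _ _ _ H2 H3)]|].
  set (r := sqrt m) in *. rewrite <- Hss.
  replace (8 * 10 ^ 7 / (r * (u ^ 3 * (r * r))) + 6400 * (r * r * r) * (3 * u / (r * r))
     * / (u * u * (r * r)) ^ 2) with (80019200 * / (u ^ 3 * (r * r) * r)) by (field; lra).
  assert (0 < / (u ^ 3 * (r * r) * r)) by (apply Rinv_0_lt_compat; apply Rmult_lt_0_compat; nra).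
  unfold Rdiv. lra.
Qed.

Lemma psi_corner_upper p q lam xi :
  (0 < q)%nat -> rel_prime p (Z.of_nat q) -> (0 < lam)%nat ->
  Rabs xi <= / INR (lam * lam * q) ^ 2 ->
  let a := 2 * PI * IZR p / INR q in
  Cmod (psi (a + xi) - psi a) <= 2 * 10 ^ 8 / (INR lam ^ 2 * INR q * sqrt (INR q)).
Proof.
  intros Hq Hp Hl Hxi a.
  assert (H1 := psi_corner_approx p q lam xi Hq Hp Hl Hxi). cbv zeta in H1. fold a in H1.
  set (n := (lam * lam * q)%nat) in *.
  assert (Hn0 : (0 < n)%nat) by (unfold n; nia).
  assert (H2 := head_le_sqrt (lam * n) n xi ltac:(nia) Hxi).
  set (d := (gauss p q 0 * RtoC (/ INR q) * head (lam * n) xi)%C) in *.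
  assert (Hq1 : 1 <= INR q) by (apply (le_INR 1); lia).
  assert (Hl1 : 1 <= INR lam) by (apply (le_INR 1); lia).
  pose proof (sqrt_lt_R0 (INR q) ltac:(lra)) as Hr.
  assert (Hn : INR n = INR lam ^ 2 * INR q) by (unfold n; rewrite !mult_INR; ring).
  assert (H3 : Cmod d <= 2 / sqrt (INR q) * (30 / INR n)).
  { unfold d. rewrite Cmod_mult. apply Rmult_le_compat; try apply Cmod_ge_0; [|exact H2].
    now apply gauss_div_le. }
  rewrite Hn in H3.
  replace (psi (a + xi) - psi a)%C with ((psi (a + xi) - psi a - d) + d)%C by ring.
  eapply Rle_trans; [apply Cmod_triangle|].
  set (u := INR lam) in *. set (m := INR q) in *. set (r := sqrt m) in *.
  assert (Hi : 0 < / (u ^ 2 * m * r)) by (apply Rinv_0_lt_compat; apply Rmult_lt_0_compat; nra).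
  replace (2 / r * (30 / (u ^ 2 * m))) with (60 * / (u ^ 2 * m * r)) in H3 by (field; lra).
  replace (10 ^ 8 / (u ^ 3 * m * r)) with (10 ^ 8 * / u * / (u ^ 2 * m * r)) in H1 by (field; lra).
  assert (Hu : / u <= 1) by (rewrite <- Rinv_1; apply Rinv_le_contravar; lra).
  assert (10 ^ 8 * / u * / (u ^ 2 * m * r) <= 10 ^ 8 * / (u ^ 2 * m * r))
    by (apply Rmult_le_compat_r; lra).
  unfold Rdiv. lra.
Qed.

(* The values at [xi] and [-xi] are conjugate up to the Gauss factor, so a line capturing both
   must be one of the two symmetry axes, and neither axis captures all [xi]. *)
Lemma psi_corner_lower p q lam v :
  (0 < q)%nat -> rel_prime p (Z.of_nat q) -> on_S1 v ->
  INR q <= Cmod (gauss p q 0) * Cmod (gauss p q 0) -> 10 ^ 12 <= INR lam ->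
  let a := 2 * PI * IZR p / INR q in
  exists xi, Rabs xi <= / INR (lam * lam * q) ^ 2 /\
    / (128 * (INR lam ^ 2 * INR q * sqrt (INR q))) <= Rabs (dot v (psi (a + xi) - psi a)%C).
Proof.
  intros Hq Hp Hv HG Hlam a. apply NNPP. intros Hno.
  assert (Hl : (2 <= lam)%nat).
  { apply INR_le. simpl (INR 2). lra. }
  set (n := (lam * lam * q)%nat) in *. set (K := (lam * n)%nat).
  assert (Hn0 : (0 < n)%nat) by (unfold n; nia).
  assert (HnK : (2 * n <= K)%nat) by (unfold K; nia).
  assert (Hq1 : 1 <= INR q) by (apply (le_INR 1); lia).
  pose proof (sqrt_lt_R0 (INR q) ltac:(lra)) as Hr.
  pose proof (sqrt_sqrt (INR q) ltac:(lra)) as Hss.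
  assert (Hn : INR n = INR lam ^ 2 * INR q) by (unfold n; rewrite !mult_INR; ring).
  assert (Hn1 : 1 <= INR n) by (apply (le_INR 1); lia).
  set (c := (gauss p q 0 * RtoC (/ INR q))%C).
  assert (Hc : / INR q <= Cmod c ^ 2).
  { unfold c. rewrite Cmod_mult, Cmod_R, Rabs_right by (left; apply Rinv_0_lt_compat; lra).
    replace ((Cmod (gauss p q 0) * / INR q) ^ 2)
      with (Cmod (gauss p q 0) * Cmod (gauss p q 0) * (/ INR q * / INR q)) by ring.
    apply Rle_trans with (INR q * (/ INR q * / INR q)); [right; field; lra|].
    apply Rmult_le_compat_r; [|exact HG].
    assert (0 < / INR q) by (apply Rinv_0_lt_compat; lra). nra. }
  (* The constant [1/100] absorbs the supposed bound [1/128] and the approximation error, at most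
     [1/1000] because [lam >= 10^12]. *)
  set (D := / (100 * (INR n * sqrt (INR q)))).
  assert (HD : forall xi, Rabs xi <= / INR n ^ 2 -> Rabs (dot v (c * head K xi)%C) <= D).
  { intros xi Hxi.
    assert (H1 := psi_corner_approx p q lam xi Hq Hp ltac:(lia) Hxi). cbv zeta in H1.
    fold a n c K in H1.
    assert (H2 : Rabs (dot v (psi (a + xi) - psi a)%C) < / (128 * (INR n * sqrt (INR q)))).
    { apply Rnot_le_lt. intros H. apply Hno. exists xi. split; [exact Hxi|].
      rewrite <- Hn. exact H. }
    pose proof (dot_le v (psi (a + xi) - psi a - c * head K xi)%C Hv) as H3.
    replace (dot v (c * head K xi)%C) with (dot v (psi (a + xi) - psi a)%C
      - dot v (psi (a + xi) - psi a - c * head K xi)%C) by (rewrite (dot_minus v _ (c * _)%C); ring).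
    assert (H4 : 10 ^ 8 / (INR lam ^ 3 * INR q * sqrt (INR q))
       <= 1 / 1000 * / (INR n * sqrt (INR q))).
    { rewrite Hn. replace (10 ^ 8 / (INR lam ^ 3 * INR q * sqrt (INR q)))
        with (10 ^ 8 * / INR lam * / (INR lam ^ 2 * INR q * sqrt (INR q))) by (field; lra).
      assert (0 < / (INR lam ^ 2 * INR q * sqrt (INR q)))
        by (apply Rinv_0_lt_compat; apply Rmult_lt_0_compat; nra).
      apply Rmult_le_compat_r; [lra|].
      assert (/ INR lam <= / 10 ^ 12) by (apply Rinv_le_contravar; lra). lra. }
    assert (Hi : 0 < / (INR n * sqrt (INR q))) by (apply Rinv_0_lt_compat; nra).
    rewrite Rinv_mult in H2. unfold D. rewrite Rinv_mult.
    eapply Rle_trans; [apply Rabs_triang|]. rewrite Rabs_Ropp. lra. }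
  (* [al + i be] is [v] times the conjugate of [c], so multiplication by the Gauss factor is moved
     from the curve to the direction. *)
  set (al := fst v * fst c + snd v * snd c). set (be := snd v * fst c - fst v * snd c).
  assert (Hdot : forall z : C, dot v (c * z)%C = al * fst z + be * snd z).
  { intros z. unfold dot, al, be. cbn [fst snd Cmult]. ring. }
  assert (Hab : / INR q <= al ^ 2 + be ^ 2).
  { replace (al ^ 2 + be ^ 2) with ((fst v ^ 2 + snd v ^ 2) * (fst c ^ 2 + snd c ^ 2))
      by (unfold al, be; ring).
    rewrite Hv, Rmult_1_l. unfold Cmod in Hc. rewrite pow2_sqrt in Hc; [exact Hc|].
    pose proof (pow2_ge_0 (fst c)). pose proof (pow2_ge_0 (snd c)). lra. }
  (* Half the sum and half the difference of the values at [xi] and [-xi] separate the two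
     coordinates. *)
  assert (Hboth : forall xi, Rabs xi <= / INR n ^ 2 ->
     Rabs (al * fst (head K xi)) <= D /\ Rabs (be * snd (head K xi)) <= D).
  { intros xi Hxi. pose proof (HD xi Hxi) as H1.
    pose proof (HD (- xi) ltac:(now rewrite Rabs_Ropp)) as H2. rewrite !Hdot in *.
    destruct (head_opp K xi) as [E1 E2]. rewrite E1, E2 in H2.
    split; split_Rabs; lra. }
  (* As [al^2 + be^2 >= 1/q], one of the two squares is at least [1/(2 q)]; the corresponding
     coordinate of the head is then at most [1/(50 n)] on the whole range, against [1/(16 n)] or
     [3/(16 n)]. *)
  assert (Hcase : forall g h, / (2 * INR q) <= g ^ 2 -> Rabs (g * h) <= D -> Rabs h <= / (50 * INR n)).
  { intros g h Hg Hgh. rewrite Rabs_mult in Hgh. rewrite <- (pow2_abs g) in Hg.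
    pose proof (Rabs_pos g). pose proof (Rabs_pos h).
    assert (Hg2 : / (2 * sqrt (INR q)) <= Rabs g).
    { apply Rnot_lt_le. intros Hlt.
      assert (Rabs g ^ 2 < (/ (2 * sqrt (INR q))) ^ 2).
      { nra. }
      replace ((/ (2 * sqrt (INR q))) ^ 2) with (/ (4 * INR q)) in *
        by (rewrite <- Hss at 1; field; lra).
      assert (/ (4 * INR q) <= / (2 * INR q)) by (apply Rinv_le_contravar; lra). lra. }
    assert (H3 : / (2 * sqrt (INR q)) * Rabs h <= D) by nra.
    apply (Rmult_le_compat_l (2 * sqrt (INR q))) in H3; [|lra].
    rewrite <- Rmult_assoc, Rinv_r, Rmult_1_l in H3 by lra.
    eapply Rle_trans; [exact H3|]. unfold D. right. field. lra. }
  assert (Hn2 : 0 < / INR n ^ 2) by (apply Rinv_0_lt_compat; nra).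
  assert (Hin : 0 < / INR n) by (apply Rinv_0_lt_compat; lra).
  assert (Hhalf : / (2 * INR q) = / 2 * / INR q) by (field; lra).
  destruct (Rle_lt_dec (/ (2 * INR q)) (al ^ 2)) as [Hal|Hal].
  - destruct (Hboth (/ INR n ^ 2)) as [H1 _]; [rewrite Rabs_right; lra|].
    pose proof (Hcase _ _ Hal H1) as H2. pose proof (fst_head_ge K n Hn0 HnK) as H3.
    rewrite !Rinv_mult in *. pose proof (Rle_abs (fst (head K (/ INR n ^ 2)))). lra.
  - pose proof (snd_head_not_small K n (/ (50 * INR n)) Hn0 HnK) as H1.
    assert (H2 : 3 / (16 * INR n) <= / (50 * INR n)).
    { apply H1. intros s Hs. eapply Rle_trans; [apply Rle_abs|].
      apply (Hcase be); [lra|]. apply Hboth. rewrite Rabs_right; lra. }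
    unfold Rdiv in H2. rewrite !Rinv_mult in H2. lra.
Qed.

(** * Rational points with vanishing Gauss sum *)

Section ChirpRatio.

(** For a chirp the ratio of consecutive exponentials is [cis (y i)] with [y] in arithmetic
    progression of step [-2 s]. As long as it keeps distance [1/M] from [1], the inverse ratio [c]
    varies slowly enough to sum by parts twice. *)
Variables (M s : R) (y : nat -> R) (n : nat).
Hypothesis y_step : forall i, y (S i) = y i - 2 * s.
Hypothesis y_away : forall i, (i <= n)%nat -> 1 <= M * Cmod (cis (y i) - 1).

Let z i := cis (y i).
Let c i := (/ (z i - 1))%C.

Lemma ratio_neq0 i : (i <= n)%nat -> (z i - 1)%C <> RtoC 0.
Proof.
  intros Hi E. specialize (y_away i Hi). fold (z i) in y_away.
  rewrite E, Cmod_0 in y_away. lra.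
Qed.

Lemma ratio_inv_le i : (i <= n)%nat -> Cmod (c i) <= M.
Proof.
  intros Hi. unfold c. rewrite Cmod_inv by (now apply ratio_neq0).
  pose proof (proj1 (Cmod_gt_0 _) (ratio_neq0 i Hi)) as H0.
  apply Rmult_le_reg_r with (Cmod (z i - 1)); [assumption|].
  rewrite Rinv_l by lra. apply y_away. exact Hi.
Qed.

Lemma ratio_step_le i : Cmod (z i - z (S i)) <= 2 * Rabs s.
Proof.
  unfold z. eapply Rle_trans; [apply Cmod_cis_minus|]. rewrite y_step.
  replace (y i - (y i - 2 * s)) with (2 * s) by ring.
  rewrite Rabs_mult, (Rabs_right 2) by lra. lra.
Qed.

Lemma ratio_diff2_le i : Cmod (z (S i) - z (S (S i)) - (z i - z (S i))) <= 4 * Rabs s ^ 2.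
Proof.
  replace (z (S i)) with (cis (- (2 * s)) * z i)%C
    by (unfold z; rewrite <- cis_add, y_step; f_equal; ring).
  replace (z (S (S i))) with (cis (- (2 * s)) * (cis (- (2 * s)) * z i))%C
    by (unfold z; rewrite <- !cis_add, !y_step; f_equal; ring).
  set (w := cis (- (2 * s))).
  replace (w * z i - w * (w * z i) - (z i - w * z i))%C
    with (- ((1 - w) * (1 - w) * z i))%C by ring.
  rewrite Cmod_opp, !Cmod_mult. unfold z at 1. rewrite Cmod_cis, Rmult_1_r.
  pose proof (Cmod_1_minus_cis_le (- (2 * s))) as H. fold w in H.
  rewrite Rabs_Ropp, Rabs_mult, (Rabs_right 2) in H by lra.
  pose proof (Cmod_ge_0 (1 - w)). nra.
Qed.

Lemma ratio_inv_step i : (S i <= n)%nat -> Cmod (c (S i) - c i) <= 2 * Rabs s * M ^ 2.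
Proof.
  intros Hi. pose proof (ratio_neq0 i ltac:(lia)). pose proof (ratio_neq0 (S i) Hi).
  replace (c (S i) - c i)%C with ((z i - z (S i)) * c i * c (S i))%C
    by (unfold c; field; now split).
  rewrite !Cmod_mult. pose proof (ratio_step_le i).
  pose proof (ratio_inv_le i ltac:(lia)). pose proof (ratio_inv_le (S i) Hi).
  pose proof (Cmod_ge_0 (c i)). pose proof (Cmod_ge_0 (c (S i))).
  pose proof (Cmod_ge_0 (z i - z (S i))).
  replace (2 * Rabs s * M ^ 2) with (2 * Rabs s * M * M) by ring.
  apply Rmult_le_compat; try assumption; [now apply Rmult_le_pos|].
  apply Rmult_le_compat; assumption.
Qed.

(** Discrete form of [(1/f)'' = 2 f'^2/f^3 - f''/f^2] for [f = z - 1]. *)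
Lemma ratio_inv_diff2 i :
  (S (S i) <= n)%nat ->
  Cmod (c (S (S i)) - c (S i) - (c (S i) - c i)) <= (4 * M ^ 2 + 8 * M ^ 3) * Rabs s ^ 2.
Proof.
  intros Hi. pose proof (ratio_neq0 i ltac:(lia)). pose proof (ratio_neq0 (S i) ltac:(lia)).
  pose proof (ratio_neq0 (S (S i)) Hi).
  replace (c (S (S i)) - c (S i) - (c (S i) - c i))%C
    with (c (S i) * ((z (S i) - z (S (S i)) - (z i - z (S i))) * c (S (S i))
      + (z i - z (S i)) * ((c (S (S i)) - c (S i)) + (c (S i) - c i))))%C
    by (unfold c; field; repeat split; assumption).
  pose proof (ratio_inv_le (S i) ltac:(lia)) as H2.
  pose proof (ratio_inv_le (S (S i)) Hi) as H3.
  pose proof (ratio_inv_step i ltac:(lia)) as H4. pose proof (ratio_inv_step (S i) Hi) as H5.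
  pose proof (ratio_step_le i) as H6. pose proof (ratio_diff2_le i) as H7.
  pose proof (Rabs_pos s) as Hs. set (a := Rabs s) in *.
  rewrite Cmod_mult.
  apply Rle_trans with (M * (4 * a ^ 2 * M + 2 * a * (2 * a * M ^ 2 + 2 * a * M ^ 2)));
    [|right; ring].
  apply Rmult_le_compat; try apply Cmod_ge_0; [exact H2|].
  eapply Rle_trans; [apply Cmod_triangle|]. rewrite !Cmod_mult.
  apply Rplus_le_compat; apply Rmult_le_compat; try apply Cmod_ge_0; try assumption.
  eapply Rle_trans; [apply Cmod_triangle|]. lra.
Qed.

Lemma chirp_sum_bound (F E : nat -> C) :
  (2 <= n)%nat ->
  (forall i, Cmod (E i) <= 1) -> (forall i, E (S i) = (z i * E i)%C) ->
  F O = RtoC 0 -> F 1%nat = RtoC 0 -> F (n - 1)%nat = RtoC 0 -> F n = RtoC 0 ->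
  Cmod (csum (fun i => (F i * E i)%C) (n - 1))
  <= rsum (fun i => M ^ 2 * Cmod (F (S (S i)) - F (S i) - (F (S i) - F i))
       + 2 * M ^ 3 * Rabs s * (Cmod (F (S (S i)) - F (S i)) + 2 * Cmod (F (S i) - F i))
       + (4 * M ^ 3 + 12 * M ^ 4) * Rabs s ^ 2 * Cmod (F i)) (n - 1).
Proof.
  intros Hn HE HES F0 F1 Fn1 Fn.
  eapply Rle_trans.
  - apply (double_summation_by_parts F c E (n - 1) M (2 * Rabs s * M ^ 2)
      ((4 * M ^ 2 + 8 * M ^ 3) * Rabs s ^ 2)); try assumption.
    + intros i Hi. rewrite HES. unfold c. field. apply ratio_neq0. lia.
    + intros i Hi. apply ratio_inv_le. lia.
    + intros i Hi. apply ratio_inv_step. lia.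
    + intros i Hi. apply ratio_inv_diff2. lia.
    + replace (S (n - 1)) with n by lia. exact Fn.
  - right. apply rsum_ext. intros i _. ring.
Qed.

End ChirpRatio.

Lemma sin_ge_on_interval b w :
  (2 <= b)%nat -> PI / (2 * INR b) <= w <= PI - PI / (2 * INR b) ->
  sin (PI / (2 * INR b)) <= sin w.
Proof.
  intros Hb Hw. apply le_INR in Hb. simpl (INR 2) in Hb. pose proof PI_RGT_0.
  assert (H0 : 0 < PI / (2 * INR b) <= PI / 2).
  { split; [apply Rdiv_lt_0_compat; lra|]. unfold Rdiv. apply Rmult_le_compat_l; [lra|].
    apply Rinv_le_contravar; lra. }
  destruct (Rle_lt_dec w (PI / 2)).
  - apply sin_incr_1; lra.
  - rewrite <- (sin_PI_x w). apply sin_incr_1; lra.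
Qed.

(* Only the non-zero frequencies [m/b] occur, and for [|s| (2 K + 7) <= pi / b] the local
   frequency [m/b - s k / pi] stays away from the integers. *)
Lemma headsum_vanishing p b :
  (2 <= b)%nat -> rel_prime p (Z.of_nat b) -> gauss p b 0 = RtoC 0 ->
  exists A, 0 <= A /\ forall K s, (0 < K)%nat -> Rabs s * (2 * INR K + 7) <= PI / INR b ->
    Cmod (headsum K (2 * PI * IZR p / INR b + s)) <= A / INR K.
Proof.
  intros Hb Hp HG. pose proof PI_RGT_0. pose proof PI_4.
  assert (Hb2 : 2 <= INR b) by (apply (le_INR 2) in Hb; simpl (INR 2) in Hb; lra).
  assert (Hmu : 0 < sin (PI / (2 * INR b))).
  { apply sin_gt_0; [apply Rdiv_lt_0_compat; lra|].
    unfold Rdiv. rewrite <- (Rmult_1_r PI) at 2. apply Rmult_lt_compat_l; [lra|].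
    rewrite <- Rinv_1. apply Rinv_lt_contravar; lra. }
  set (M := / (2 * sin (PI / (2 * INR b)))).
  assert (HM : 0 < M) by (apply Rinv_0_lt_compat; lra).
  (* With at most [5 K] indices and [|s| <= 4/K], the three kinds of terms of [chirp_sum_bound] give
     [18], [5 * 2 * 4 * 6] and [5 * 16], each over [K]. *)
  set (A := 18 * M ^ 2 + 240 * M ^ 3 + 80 * (4 * M ^ 3 + 12 * M ^ 4)).
  assert (HA : 0 <= A).
  { unfold A. pose proof (pow_lt M 2 HM). pose proof (pow_lt M 3 HM). pose proof (pow_lt M 4 HM). lra. }
  pose proof (sqrt_pos (2 * INR b)) as Hsq.
  exists (sqrt (2 * INR b) * A). split; [now apply Rmult_le_pos|].
  intros K s HK Hs.
  assert (HK1 : 1 <= INR K) by (apply (le_INR 1); lia).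
  set (N := S K). set (n := (2 * N + 1)%nat).
  set (F := fun i => RtoC (headw (INR K) (kk N i))).
  assert (HS : forall m, (0 < m < b)%nat ->
     Cmod (csum (fun i => (root b (Z.of_nat m * (Z.of_nat i - Z.of_nat N))
        * (cis (- (s * kk N i ^ 2)) * F i))%C) n) <= A / INR K).
  { intros m Hm.
    assert (Hm1 : 1 <= INR m) by (apply (le_INR 1); lia).
    assert (Hmb : INR m + 1 <= INR b) by (rewrite <- S_INR; apply le_INR; lia).
    set (y := fun i => 2 * PI * INR m / INR b - s * (2 * kk N i + 1)).
    set (E := fun i => cis (2 * PI * INR m / INR b * kk N i - s * kk N i ^ 2)).
    rewrite (csum_ext _ (fun i => (F i * E i)%C)).
    2:{ intros i _. unfold E, root. rewrite mult_IZR, <- kk_Z, <- INR_IZR_INZ.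
        replace (2 * PI * INR m / INR b * kk N i - s * kk N i ^ 2)
          with (2 * PI * (INR m * kk N i) / INR b + - (s * kk N i ^ 2)) by (field; lra).
        rewrite cis_add. ring. }
    replace n with (S n - 1)%nat by lia.
    assert (HF : forall i, INR K <= Rabs (kk N i) -> F i = RtoC 0).
    { intros i Hi. unfold F. now rewrite headw_outside by lra. }
    assert (Hstep : forall i, Cmod (F (S i) - F i) <= 2 / INR K).
    { intros i. unfold F. rewrite <- RtoC_minus, Cmod_R. apply headw_lipschitz; [lra|].
      rewrite kk_S. replace (kk N i + 1 - kk N i) with 1 by ring. rewrite Rabs_R1; lra. }
    assert (HF1 : forall i, Cmod (F i) <= 1).
    { intros i. unfold F. rewrite Cmod_R. pose proof (headw_bound (INR K) (kk N i) ltac:(lra)).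
      rewrite Rabs_right; lra. }
    eapply Rle_trans.
    - apply (chirp_sum_bound M s y (S n)).
      + intros i. unfold y. rewrite kk_S. ring.
      + intros i Hi. rewrite Cmod_cis_minus_1.
        pose proof (Rabs_kk_le N i ltac:(unfold n in Hi; lia)) as Hk.
        unfold N in Hk at 2. rewrite S_INR in Hk.
        assert (Hsk : Rabs (s * (2 * kk N i + 1)) <= PI / INR b).
        { rewrite Rabs_mult. eapply Rle_trans; [|exact Hs].
          apply Rmult_le_compat_l; [apply Rabs_pos|]. split_Rabs; lra. }
        (* Since [0 < m < b], the point [pi m/b] is at distance at least [pi/b] from [0] and [pi].
           The chirp moves it by at most half of that, because [|k| <= K + 3] gives
           [|2k + 1| <= 2K + 7]. *)
        assert (Hy : PI / (2 * INR b) <= y i / 2 <= PI - PI / (2 * INR b)).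
        { assert (Hib : 0 < / INR b) by (apply Rinv_0_lt_compat; lra).
          set (f := PI / INR b) in *.
          assert (Hf : 0 < f) by (unfold f, Rdiv; nra).
          assert (Hf1 : PI = f * INR b) by (unfold f; field; lra).
          replace (PI / (2 * INR b)) with (f / 2) by (unfold f; field; lra).
          assert (Hyi : y i = 2 * (f * INR m) - s * (2 * kk N i + 1))
            by (unfold y, f; field; lra).
          rewrite Hyi, Hf1.
          assert (f * 1 <= f * INR m) by (apply Rmult_le_compat_l; lra).
          assert (f * (INR m + 1) <= f * INR b) by (apply Rmult_le_compat_l; lra).
          split_Rabs; lra. }
        pose proof (sin_ge_on_interval b (y i / 2) Hb Hy) as Hsin.
        rewrite Rabs_right by lra. unfold M.
        apply Rmult_le_reg_l with (2 * sin (PI / (2 * INR b))); [lra|].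
        rewrite <- Rmult_assoc, Rinv_r by lra. lra.
      + unfold n; lia.
      + intros i. unfold E. rewrite Cmod_cis. lra.
      + intros i. unfold E, y. rewrite <- cis_add. f_equal. rewrite kk_S. field. lra.
      + apply HF. unfold kk, N. rewrite S_INR. simpl (INR 0). split_Rabs; lra.
      + apply HF. unfold kk, N. rewrite (S_INR K). simpl (INR 1). split_Rabs; lra.
      + apply HF. replace (S n - 1)%nat with (N + (N + 1))%nat by (unfold n; lia).
        unfold kk, N. rewrite !plus_INR, (S_INR K). simpl (INR 1). split_Rabs; lra.
      + apply HF. replace (S n) with (N + (N + 2))%nat by (unfold n; lia).
        unfold kk, N. rewrite !plus_INR, (S_INR K). simpl (INR 2). split_Rabs; lra.
    - replace (S n - 1)%nat with n by lia.
      assert (Hs4 : Rabs s <= 4 / INR K).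
      { pose proof (Rabs_pos s). assert (PI / INR b <= 4).
        { apply Rmult_le_reg_r with (INR b); [lra|]. unfold Rdiv.
          rewrite Rmult_assoc, Rinv_l by lra. lra. }
        apply Rmult_le_reg_r with (INR K); [lra|]. unfold Rdiv.
        rewrite Rmult_assoc, Rinv_l by lra. nra. }
      assert (Hkink : rsum (fun i => Cmod (F (S (S i)) - F (S i) - (F (S i) - F i))) n <= 18 / INR K).
      { pose proof (kink_sum (headw (INR K)) (2 / INR K ^ 2) (4 / INR K) K N n
          ltac:(left; apply Rdiv_lt_0_compat; nra) ltac:(left; apply Rdiv_lt_0_compat; lra)
          ltac:(unfold N; lia)
          ltac:(intros; apply headw_diff2; lra)
          ltac:(intros; apply headw_diff2_smooth; [lra|assumption])) as H1.
        rewrite (rsum_ext _ (fun i => Rabs (diff2 (headw (INR K)) (kk N (S i))))).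
        - eapply Rle_trans; [exact H1|]. unfold n, N.
          rewrite plus_INR, mult_INR, (S_INR K). simpl (INR 2); simpl (INR 1).
          apply Rmult_le_reg_r with (INR K ^ 2); [nra|].
          replace ((((1 + 1) * (INR K + 1) + 1) * (2 / INR K ^ 2) + 2 * (4 / INR K)) * INR K ^ 2)
            with (12 * INR K + 6) by (field; lra).
          replace (18 / INR K * INR K ^ 2) with (18 * INR K) by (field; lra). lra.
        - intros i _. unfold F, diff2. rewrite <- !RtoC_minus, Cmod_R. f_equal.
          rewrite !kk_S. replace (kk N i + 1 - 1) with (kk N i) by ring. reflexivity. }
      apply Rle_trans with (M ^ 2 * (18 / INR K) + INR n * (2 * M ^ 3 * (4 / INR K) * (6 / INR K)
         + (4 * M ^ 3 + 12 * M ^ 4) * (4 / INR K) ^ 2 * 1)).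
      + rewrite <- rsum_const.
        eapply Rle_trans; [|apply Rplus_le_compat_r, Rmult_le_compat_l; [apply pow_le; lra|exact Hkink]].
        rewrite <- rsum_scal, <- rsum_plus. apply rsum_le. intros i _.
        pose proof (Hstep i). pose proof (Hstep (S i)). pose proof (HF1 i).
        pose proof (Cmod_ge_0 (F i)). pose proof (Cmod_ge_0 (F (S i) - F i)).
        pose proof (Cmod_ge_0 (F (S (S i)) - F (S i))). pose proof (Rabs_pos s).
        pose proof (pow_lt M 3 HM). pose proof (pow_lt M 4 HM).
        assert (Rabs s ^ 2 <= (4 / INR K) ^ 2) by (apply pow_incr; lra).
        pose proof (pow_le _ 2 (Rabs_pos s)).
        rewrite Rplus_assoc. apply Rplus_le_compat_l. apply Rplus_le_compat.
        * apply Rmult_le_compat; [nra|lra| |lra]. apply Rmult_le_compat_l; lra.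
        * apply Rmult_le_compat; [nra|lra| |lra]. apply Rmult_le_compat_l; lra.
      + apply Rle_trans with (M ^ 2 * (18 / INR K) + 5 * INR K * (2 * M ^ 3 * (4 / INR K) * (6 / INR K)
         + (4 * M ^ 3 + 12 * M ^ 4) * (4 / INR K) ^ 2 * 1)).
        * apply Rplus_le_compat_l, Rmult_le_compat_r.
          -- pose proof (pow_lt M 3 HM). pose proof (pow_lt M 4 HM).
             assert (0 < / INR K) by (apply Rinv_0_lt_compat; lra).
             assert (0 < 4 / INR K) by (unfold Rdiv; lra).
             assert (0 < 6 / INR K) by (unfold Rdiv; lra).
             apply Rplus_le_le_0_compat.
             ++ apply Rmult_le_pos; [apply Rmult_le_pos|]; lra.
             ++ rewrite Rmult_1_r. apply Rmult_le_pos; [lra|]. apply pow_le; lra.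
          -- unfold n, N. rewrite plus_INR, mult_INR, (S_INR K). simpl (INR 2); simpl (INR 1). lra.
        * right. unfold A. field. lra. }
  assert (Hsum : (RtoC (INR b) * headsum K (2 * PI * IZR p / INR b + s))%C
     = csum (fun m => (gauss p b (Z.of_nat m) * csum (fun i =>
        (root b (Z.of_nat m * (Z.of_nat i - Z.of_nat N)) * (cis (- (s * kk N i ^ 2)) * F i))%C) n)%C) b).
  { unfold headsum, window_sum. fold N n. rewrite <- csum_scal.
    rewrite (csum_ext _ (fun i => csum (fun m => (gauss p b (Z.of_nat m)
       * (root b (Z.of_nat m * (Z.of_nat i - Z.of_nat N)) * (cis (- (s * kk N i ^ 2)) * F i)))%C) b)).
    - rewrite csum_switch. apply csum_ext. intros m _. now rewrite csum_scal.
    - intros i _.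
      rewrite (csum_ext _ (fun m => (gauss p b (Z.of_nat m)
        * root b (Z.of_nat m * (Z.of_nat i - Z.of_nat N))
        * (cis (- (s * kk N i ^ 2)) * F i))%C)) by (intros; ring).
      rewrite csum_scal_r, <- gauss_inversion by lia. unfold F.
      replace (cis (- ((2 * PI * IZR p / INR b + s) * kk N i ^ 2)))
        with (root b (- (p * (Z.of_nat i - Z.of_nat N) * (Z.of_nat i - Z.of_nat N)))
              * cis (- (s * kk N i ^ 2)))%C.
      + ring.
      + unfold root. rewrite <- cis_add. f_equal. rewrite opp_IZR, !mult_IZR, <- kk_Z.
        field. lra. }
  apply (f_equal Cmod) in Hsum. rewrite Cmod_mult, Cmod_R, Rabs_right in Hsum by lra.
  apply Rmult_le_reg_l with (INR b); [lra|]. rewrite Hsum.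
  eapply Rle_trans; [apply csum_Cmod|].
  apply rsum_le_const. intros m Hm. rewrite Cmod_mult.
  assert (HAK : 0 <= A / INR K) by (apply Rmult_le_pos; [lra|left; apply Rinv_0_lt_compat; lra]).
  replace (sqrt (2 * INR b) * A / INR K) with (sqrt (2 * INR b) * (A / INR K)) by (field; lra).
  destruct m as [|m].
  - change (Z.of_nat 0) with 0%Z. rewrite HG, Cmod_0, Rmult_0_l. now apply Rmult_le_pos.
  - apply Rmult_le_compat; try apply Cmod_ge_0; [|apply HS; lia].
    rewrite <- (sqrt_square (Cmod (gauss p b (Z.of_nat (S m))))) by apply Cmod_ge_0.
    apply sqrt_le_1_alt. apply gauss_le; [lia|assumption].
Qed.

(** Exactly at the rational point the main term vanishes with the Gauss sum and [s = 0], so only the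
    amplitude error [1/X^3] survives. *)
Lemma blocksum_vanishing p b X :
  (0 < b)%nat -> rel_prime p (Z.of_nat b) -> gauss p b 0 = RtoC 0 -> (0 < X)%nat ->
  Cmod (blocksum X (2 * PI * IZR p / INR b)) <= 8000 * (INR b * sqrt (INR b)) / INR X ^ 3.
Proof.
  intros Hb Hp HG HX. assert (HX0 : 0 < INR X) by (apply lt_0_INR; lia).
  assert (HX2 : INR (2 * X) = 2 * INR X) by (rewrite mult_INR; reflexivity).
  assert (H := window_sum_approx p b (S (2 * X)) (blockw (INR X)) 0 Hb Hp ltac:(lia)).
  cbv zeta in H. rewrite Rplus_0_r, HG in H.
  specialize (H ltac:(intros y Hy; apply blockw_outside; [lra|]; rewrite S_INR in Hy; lra)).
  fold (blocksum X (2 * PI * IZR p / INR b)) in H.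
  replace (blocksum X (2 * PI * IZR p / INR b) - 0 * RtoC (/ INR b)
    * window_sum (blockw (INR X)) (S (2 * X)) 0)%C
    with (blocksum X (2 * PI * IZR p / INR b)) in H by ring.
  eapply Rle_trans; [exact H|].
  assert (H2 := block_diff2_sum X 0 HX). cbv zeta in H2. rewrite Rabs_R0 in H2.
  pose proof (pos_INR b). pose proof (sqrt_pos (INR b)).
  eapply Rle_trans; [apply Rmult_le_compat_l; [nra|exact H2]|].
  right. field. lra.
Qed.

(** The determinant condition places the two points at distance [2 pi/(b q)]. Over this long
    interval the head moves by only [O(1/K)] times the length, by [headsum_vanishing], that is by
    [O(q^(-2))]; the blocks at [p/q] contribute [O(q^(-3/2))]. *)
Lemma psi_near_vanishing a b :
  (2 <= b)%nat -> rel_prime a (Z.of_nat b) -> gauss a b 0 = RtoC 0 ->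
  exists A, 0 <= A /\ forall p q, (100 <= q)%nat -> rel_prime p (Z.of_nat q) ->
    (p * Z.of_nat b - a * Z.of_nat q = 1)%Z ->
    Cmod (psi (2 * PI * IZR a / INR b) - psi (2 * PI * IZR p / INR q)) <= A / (INR q * sqrt (INR q)).
Proof.
  intros Hb Hp HG. destruct (headsum_vanishing a b Hb Hp HG) as (A & HA & Hhead).
  assert (Hb2 : 2 <= INR b) by (apply (le_INR 2) in Hb; simpl (INR 2) in Hb; lra).
  pose proof (sqrt_lt_R0 (INR b) ltac:(lra)) as Hrb.
  pose proof PI_RGT_0. pose proof PI_4.
  set (B := INR b * sqrt (INR b)). assert (HB : 0 < B) by (unfold B; nra).
  exists (256 * A + 64 * 10 ^ 7 + 8000 * 8192 * B). split; [lra|].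
  intros p q Hq Hpq Hdet.
  (* Small enough that [xi (2K + 7) <= pi/b], large enough that [q <= 16 K] for the block bounds. *)
  set (K := (q / 8)%nat).
  assert (HKq : (8 * K <= q < 8 * K + 8)%nat).
  { unfold K. pose proof (Nat.div_mod_eq q 8). pose proof (Nat.mod_upper_bound q 8). lia. }
  assert (HK0 : (0 < K)%nat) by lia.
  assert (HqK : 16 * INR K >= INR q).
  { apply Rle_ge. replace 16 with (INR 16) by (simpl; ring). rewrite <- mult_INR. apply le_INR. lia. }
  assert (HKK : 2 * INR K + 7 <= INR q / 2).
  { assert (4 * K + 14 <= q)%nat as H1 by lia. apply le_INR in H1.
    rewrite plus_INR, mult_INR in H1. simpl in H1. simpl in *. lra. }
  assert (Hq100 : 100 <= INR q).
  { replace 100 with (INR 100) by (simpl; ring). now apply le_INR. }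
  assert (HK1 : 1 <= INR K) by (apply (le_INR 1); lia).
  set (x := 2 * PI * IZR a / INR b). set (xi := 2 * PI / (INR b * INR q)).
  assert (Hxi0 : 0 < xi) by (apply Rdiv_lt_0_compat; nra).
  assert (Hx : 2 * PI * IZR p / INR q = x + xi).
  { assert (HdetR : IZR p * INR b - IZR a * INR q = 1).
    { rewrite !INR_IZR_INZ, <- !mult_IZR, <- minus_IZR. now rewrite Hdet. }
    unfold x, xi. replace (2 * PI) with (2 * PI * (IZR p * INR b - IZR a * INR q)) at 3
      by (rewrite HdetR; ring). field. split; lra. }
  rewrite Hx.
  assert (Hhd : Cmod (head K (x + xi) - head K x) <= 2 * (A / INR K) * Rabs xi).
  { pose proof (mean_value_bound (fun y => head K (x + y))
      (fun s => (Ci * headsum K (x + s))%C) xi (A / INR K) xi) as Hm.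
    cbv beta in Hm. rewrite Rplus_0_r in Hm. apply Hm.
    - intros s. apply (cderiv_shift (head K)). now apply cderiv_head.
    - intros s Hs. rewrite Cmod_mult, Cmod_Ci, Rmult_1_l. apply Hhead; [assumption|].
      apply Rle_trans with (xi * (INR q / 2)).
      + pose proof (Rabs_pos s). apply Rmult_le_compat; lra.
      + right. unfold xi. field. split; lra.
    - rewrite Rabs_right; lra. }
  assert (Hps : Cmod (psi (x + xi) - psi x - (head K (x + xi) - head K x))
     <= 2 * (2 * 10 ^ 7 / sqrt (INR q) + 8000 * B / INR K ^ 2) / INR K).
  { apply psi_head_diff; [assumption| |].
    - intros X HX. apply le_INR in HX as HXR. rewrite <- Hx.
      replace (2 * PI * IZR p / INR q) with (2 * PI * (IZR p / INR q)) by (field; lra).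
      eapply Rle_trans.
      + apply (block_bound_near p q X (IZR p / INR q)); try assumption; try lia; try lra.
        replace (INR q * (IZR p / INR q) - IZR p) with 0 by (field; lra). rewrite Rabs_R0. lra.
      + pose proof (sqrt_lt_R0 (INR q) ltac:(lra)). right. field. split; lra.
    - intros X HX. apply le_INR in HX as HXR. eapply Rle_trans.
      + apply blocksum_vanishing; try assumption; lia.
      + fold B. replace (8000 * B / INR X ^ 3) with (8000 * B * / INR X ^ 2 * / INR X) by (field; lra).
        unfold Rdiv. apply Rmult_le_compat_r; [left; apply Rinv_0_lt_compat; lra|].
        apply Rmult_le_compat_l; [lra|]. apply Rinv_le_contravar; nra. }
  rewrite <- Cmod_opp. replace (- (psi x - psi (x + xi)))%C
    with ((psi (x + xi) - psi x - (head K (x + xi) - head K x)) + (head K (x + xi) - head K x))%C by ring.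
  eapply Rle_trans; [apply Cmod_triangle|].
  eapply Rle_trans; [apply Rplus_le_compat; [exact Hps|exact Hhd]|].
  rewrite (Rabs_right xi) by lra.
  pose proof (sqrt_lt_R0 (INR q) ltac:(lra)) as Hr.
  pose proof (sqrt_sqrt (INR q) ltac:(lra)) as Hss.
  assert (Hr1 : 10 <= sqrt (INR q)).
  { rewrite <- (sqrt_square 10) by lra. apply sqrt_le_1_alt. lra. }
  set (r := sqrt (INR q)) in *.
  assert (HiK : / INR K <= 16 * / INR q).
  { apply Rmult_le_reg_l with (INR K * INR q); [nra|].
    replace (INR K * INR q * / INR K) with (INR q) by (field; lra).
    replace (INR K * INR q * (16 * / INR q)) with (16 * INR K) by (field; lra). lra. }
  assert (HiK0 : 0 < / INR K) by (apply Rinv_0_lt_compat; lra).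
  assert (Hir : 0 < / r) by (apply Rinv_0_lt_compat; lra).
  assert (Hir1 : / r <= 1) by (rewrite <- Rinv_1; apply Rinv_le_contravar; lra).
  assert (Hiq : / INR q = / r * / r) by (rewrite <- Hss; field; lra).
  set (g := / r) in *. set (k := / INR K) in *.
  assert (Hk16 : k <= 16 * (g * g)) by lra.
  assert (Hxi8 : xi <= 4 * (g * g)).
  { unfold xi. rewrite <- Hiq. replace (2 * PI / (INR b * INR q)) with (2 * PI * / INR b * / INR q) by (field; lra).
    apply Rmult_le_compat_r; [rewrite Hiq; nra|].
    apply Rmult_le_reg_r with (INR b); [lra|]. rewrite Rmult_assoc, Rinv_l by lra. lra. }
  replace (2 * (2 * 10 ^ 7 / r + 8000 * B / INR K ^ 2) / INR K + 2 * (A / INR K) * xi)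
    with (4 * 10 ^ 7 * (g * k) + 16000 * B * (k * k * k) + 2 * A * (k * xi))
    by (unfold g, k; field; lra).
  replace ((256 * A + 64 * 10 ^ 7 + 8000 * 8192 * B) / (INR q * r))
    with ((256 * A + 64 * 10 ^ 7 + 8000 * 8192 * B) * (g * g * g))
    by (unfold g; rewrite <- Hss; field; lra).
  assert (Hg3 : 0 < g * g * g) by (apply Rmult_lt_0_compat; nra).
  assert (H1 : g * k <= 16 * (g * g * g)) by nra.
  assert (H2 : k * k <= 256 * (g * g * g)).
  { apply Rle_trans with (16 * (g * g) * (16 * (g * g))); [apply Rmult_le_compat; lra|].
    assert (g * g * g * g <= g * g * g) by nra. nra. }
  assert (Hk1 : k <= 1) by (unfold k; rewrite <- Rinv_1; apply Rinv_le_contravar; lra).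
  assert (H3 : k * k * k <= 256 * (g * g * g)) by nra.
  assert (H4 : k * xi <= 64 * (g * g * g)).
  { apply Rle_trans with (16 * (g * g) * (4 * (g * g))); [apply Rmult_le_compat; lra|].
    assert (g * g * g * g <= g * g * g) by nra. nra. }
  assert (A * (k * xi) <= A * (64 * (g * g * g))) by (apply Rmult_le_compat_l; lra).
  assert (B * (k * k * k) <= B * (256 * (g * g * g))) by (apply Rmult_le_compat_l; lra).
  nra.
Qed.

(** * Escaping from every line *)

(** On arbitrarily small scales [h], some point of the curve within [h] of [psi x] is at distance at
    least [c h] from the line through [psi x] orthogonal to [v], with [c] independent of the
    scale. *)
Definition escapes (x : R) (v : pt) : Prop :=
  exists c, 0 < c /\ forall delta, 0 < delta -> exists h s, 0 < h < delta /\
    Cmod (psi s - psi x) <= h /\ c * h <= Rabs (dot v (psi s - psi x)%C).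

(** Reduced fractions with [q] odd or divisible by [4] qualify; for [q = 2 mod 4] the Gauss sum is
    zero. *)
Definition good_fraction (p : Z) (q : nat) : Prop :=
  (0 < q)%nat /\ rel_prime p (Z.of_nat q) /\
  INR q <= Cmod (gauss p q 0) * Cmod (gauss p q 0).

Lemma good_fraction_odd p q : rel_prime p (Z.of_nat q) -> Nat.odd q = true -> good_fraction p q.
Proof.
  intros Hp Ho. split; [destruct q; [discriminate|lia]|split; [assumption|]].
  rewrite gauss_odd by assumption. lra.
Qed.

Lemma nat_above (r : R) : exists n : nat, (0 < n)%nat /\ r <= INR n.
Proof.
  destruct (INR_unbounded r) as [n Hn]. exists (S n). split; [lia|]. rewrite S_INR. lra.
Qed.

(** Here [q] is fixed and [lam] grows. Both the upper and the lower corner bound scale like [1/m],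
    so their ratio gives a constant [c]. *)
Lemma escapes_corner p q v :
  good_fraction p q -> on_S1 v -> escapes (2 * PI * IZR p / INR q) v.
Proof.
  intros (Hq & Hp & HG) Hv. exists (/ (256 * 10 ^ 8)). split; [lra|]. intros delta Hd.
  assert (Hq1 : 1 <= INR q) by (apply (le_INR 1); lia).
  assert (Hr1 : 1 <= sqrt (INR q)) by (rewrite <- sqrt_1; apply sqrt_le_1_alt; lra).
  destruct (nat_above (10 ^ 12 + 4 * 10 ^ 8 / delta)) as (lam & Hl & Hlam).
  assert (H0 : 0 < 4 * 10 ^ 8 / delta) by (apply Rdiv_lt_0_compat; lra).
  destruct (psi_corner_lower p q lam v Hq Hp Hv HG ltac:(lra)) as (xi & Hxi & Hlow).
  pose proof (psi_corner_upper p q lam xi Hq Hp Hl Hxi) as Hup. cbv zeta in Hup.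
  set (m := INR lam ^ 2 * INR q * sqrt (INR q)) in *.
  assert (Hm : INR lam <= m).
  { unfold m. assert (INR lam <= INR lam ^ 2) by nra.
    assert (INR lam ^ 2 * 1 <= INR lam ^ 2 * INR q) by (apply Rmult_le_compat_l; nra).
    assert (INR lam ^ 2 * INR q * 1 <= INR lam ^ 2 * INR q * sqrt (INR q))
      by (apply Rmult_le_compat_l; nra). lra. }
  exists (2 * 10 ^ 8 / m), (2 * PI * IZR p / INR q + xi). repeat split.
  - apply Rdiv_lt_0_compat; lra.
  - apply Rmult_lt_reg_r with m; [lra|]. unfold Rdiv. rewrite Rmult_assoc, Rinv_l by lra.
    assert (H1 : delta * (4 * 10 ^ 8 / delta) = 4 * 10 ^ 8) by (field; lra).
    assert (delta * (4 * 10 ^ 8 / delta) < delta * m) by (apply Rmult_lt_compat_l; lra). lra.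
  - exact Hup.
  - eapply Rle_trans; [|exact Hlow]. right. field. lra.
Qed.

(** Here [lam] is fixed and [q] grows. The corner and its distance from [psi x] are both of size
    [q^(-3/2)], so the scale [h] is the sum of the two bounds. *)
Lemma escapes_approx x v A :
  0 <= A -> on_S1 v ->
  (forall Q, exists p q, Q <= INR q /\ good_fraction p q /\
     Cmod (psi x - psi (2 * PI * IZR p / INR q)) <= A / (INR q * sqrt (INR q))) ->
  escapes x v.
Proof.
  intros HA Hv Happ.
  destruct (nat_above (10 ^ 12)) as (lam & Hl & Hlam).
  set (L := INR lam ^ 2). assert (HL : 1 <= L) by (unfold L; nra).
  assert (HAL : 0 <= A * L) by nra.
  exists (/ (256 * (A * L + 2 * 10 ^ 8))). split; [apply Rinv_0_lt_compat; lra|].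
  intros delta Hd.
  destruct (Happ ((A * L + 4 * 10 ^ 8) / delta)) as (p & q & HQ & (Hq & Hp & HG) & Hx).
  assert (Hq1 : 1 <= INR q) by (apply (le_INR 1); lia).
  assert (Hr1 : 1 <= sqrt (INR q)) by (rewrite <- sqrt_1; apply sqrt_le_1_alt; lra).
  destruct (psi_corner_lower p q lam v Hq Hp Hv HG Hlam) as (xi & Hxi & Hlow).
  pose proof (psi_corner_upper p q lam xi Hq Hp Hl Hxi) as Hup. cbv zeta in Hup.
  fold L in Hlow, Hup. set (m := L * INR q * sqrt (INR q)) in *.
  set (a := 2 * PI * IZR p / INR q) in *.
  assert (Hm : INR q <= m).
  { unfold m. assert (1 * INR q <= L * INR q) by (apply Rmult_le_compat_r; lra).
    assert (L * INR q * 1 <= L * INR q * sqrt (INR q)) by (apply Rmult_le_compat_l; nra). lra. }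
  replace (A / (INR q * sqrt (INR q))) with (A * L / m) in Hx by (unfold m; field; lra).
  set (h := (A * L + 2 * 10 ^ 8) / m).
  assert (Hh : 0 < h < delta).
  { split; [apply Rdiv_lt_0_compat; lra|].
    apply Rmult_lt_reg_r with m; [lra|]. unfold h, Rdiv. rewrite Rmult_assoc, Rinv_l by lra.
    assert (H1 : delta * ((A * L + 4 * 10 ^ 8) / delta) = A * L + 4 * 10 ^ 8) by (field; lra).
    assert (delta * ((A * L + 4 * 10 ^ 8) / delta) <= delta * m) by (apply Rmult_le_compat_l; lra).
    lra. }
  assert (Hsum : h = A * L / m + 2 * 10 ^ 8 / m) by (unfold h; field; lra).
  assert (Hpos : 0 <= 2 * 10 ^ 8 / m) by (left; apply Rdiv_lt_0_compat; lra).
  assert (Hc : / (256 * (A * L + 2 * 10 ^ 8)) * h = / (256 * m)) by (unfold h; field; lra).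
  rewrite <- Cmod_opp in Hx. replace (- (psi x - psi a))%C with (psi a - psi x)%C in Hx by ring.
  replace (psi (a + xi) - psi a)%C with ((psi (a + xi) - psi x) - (psi a - psi x))%C in Hlow by ring.
  rewrite dot_minus in Hlow.
  (* Either the corner point itself is far from the line through [psi x], or its offset is less than
     half of [1/(128 m)] and the point [a + xi] keeps the other half. *)
  destruct (Rle_lt_dec (/ (256 * m)) (Rabs (dot v (psi a - psi x)%C))) as [H|H].
  - exists h, a. repeat split; try apply Hh; [lra|]. now rewrite Hc.
  - exists h, (a + xi). repeat split; try apply Hh.
    + replace (psi (a + xi) - psi x)%C with ((psi (a + xi) - psi a) + (psi a - psi x))%C by ring.
      eapply Rle_trans; [apply Cmod_triangle|]. lra.
    + rewrite Hc. replace (/ (128 * m)) with (2 * / (256 * m)) in Hlow by (field; lra).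
      revert Hlow H. split_Rabs; lra.
Qed.

(** * Approximation of irrationals by fractions with odd denominator *)

Definition irrational (theta : R) : Prop :=
  forall (p : Z) (q : nat), (0 < q)%nat -> INR q * theta <> IZR p.

(** Forces large denominators: an approximation with error below [e] cannot have a denominator less
    than [Q]. *)
Lemma far_from_integers theta :
  irrational theta -> forall Q : nat,
  exists e, 0 < e /\ forall (p : Z) (q : nat), (0 < q < Q)%nat -> e <= Rabs (INR q * theta - IZR p).
Proof.
  intros Hirr Q. induction Q as [|Q IH].
  - exists 1. split; [lra|]. intros; lia.
  - destruct IH as (e & He & Hb). destruct (Nat.eq_dec Q 0) as [->|HQ].
    { exists e. split; [assumption|]. intros; lia. }
    set (y := INR Q * theta). destruct (archimed y) as [H1 H2].
    assert (H3 : y <> IZR (up y - 1)) by (apply Hirr; lia). rewrite minus_IZR in H3.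
    set (d := Rmin (y - (IZR (up y) - 1)) (IZR (up y) - y)).
    assert (Hd : 0 < d) by (apply Rmin_glb_lt; lra).
    exists (Rmin e d). split; [now apply Rmin_glb_lt|]. intros p q Hq.
    destruct (Nat.eq_dec q Q) as [->|HqQ].
    + apply Rle_trans with d; [apply Rmin_r|]. fold y.
      pose proof (Rmin_l (y - (IZR (up y) - 1)) (IZR (up y) - y)) as H4.
      pose proof (Rmin_r (y - (IZR (up y) - 1)) (IZR (up y) - y)) as H5. fold d in H4, H5.
      assert (p <= up y - 1 \/ up y <= p)%Z as [H|H] by lia; apply IZR_le in H;
        rewrite ?minus_IZR in H; split_Rabs; lra.
    + apply Rle_trans with e; [apply Rmin_l|]. apply Hb. lia.
Qed.

(* Of two consecutive best approximations [a/b] and [p/q] at least one has an odd denominator,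
   because [a q - b p] is [1] or [-1]. *)
Lemma odd_approximations theta (Q : nat) :
  irrational theta ->
  exists (p : Z) (q : nat), (Q <= q)%nat /\ rel_prime p (Z.of_nat q) /\ Nat.odd q = true /\
    Rabs (INR q * theta - IZR p) * INR q <= 1.
Proof.
  intros Hirr. destruct (far_from_integers theta Hirr Q) as (e & He & Hfar).
  destruct (nat_above (/ e)) as (X & HX & HXe).
  assert (HXR : 1 <= INR X) by (apply (le_INR 1); lia).
  assert (HeX : 1 <= e * INR X).
  { apply (Rmult_le_compat_l e) in HXe; [|lra]. rewrite Rinv_r in HXe; lra. }
  destruct (dirichlet_approximation theta X HX) as (a & b & Hb & Hab & Hd).
  set (rho := Rabs (INR b * theta - IZR a)) in *.
  assert (Hrho : 0 < rho).
  { apply Rabs_pos_lt. intros E. apply (Hirr a b); [lia|lra]. }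
  assert (Hrhoe : rho < e) by nra.
  assert (Hlarge : forall p q, (0 < q)%nat -> Rabs (INR q * theta - IZR p) < e -> (Q <= q)%nat).
  { intros p q Hq Hlt. destruct (Nat.le_gt_cases Q q) as [H|H]; [assumption|].
    specialize (Hfar p q ltac:(lia)). lra. }
  assert (HbR : 0 < INR b <= INR X) by (split; [apply lt_0_INR|apply le_INR]; lia).
  destruct (Nat.odd b) eqn:Hodd.
  { exists a, b. repeat split; try assumption; try apply Hab.
    - apply (Hlarge a); [lia|assumption].
    - fold rho. nra. }
  assert (Hrho1 : rho < 1) by nra.
  (* [N] is the integer part of [1/rho]: a denominator [q <= N] has [q rho <= 1], while an
     approximation of order [N] has error at most [1/(N + 1)], strictly below [rho]. *)
  set (N := Z.to_nat (up (/ rho) - 1)).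
  destruct (archimed (/ rho)) as [Hu1 Hu2].
  assert (Hir : 1 < / rho) by (rewrite <- Rinv_1; apply Rinv_lt_contravar; lra).
  assert (Hup : (1 < up (/ rho))%Z) by (apply lt_IZR; lra).
  assert (HN : INR N = IZR (up (/ rho)) - 1).
  { unfold N. rewrite INR_IZR_INZ, Z2Nat.id by lia. now rewrite minus_IZR. }
  assert (HN0 : (0 < N)%nat) by (unfold N; lia).
  assert (HNrho : INR N * rho <= 1 /\ 1 < (INR N + 1) * rho).
  { assert (/ rho * rho = 1) by (apply Rinv_l; lra). rewrite HN. split; nra. }
  destruct (dirichlet_approximation theta N HN0) as (p & q & Hq & Hpq & Hd').
  set (rho' := Rabs (INR q * theta - IZR p)) in *.
  assert (Hrho' : 0 <= rho' < rho) by (split; [apply Rabs_pos|nra]).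
  assert (HqR : 0 < INR q <= INR N) by (split; [apply lt_0_INR|apply le_INR]; lia).
  assert (Hq_odd : Nat.odd q = true).
  (* If both denominators were even, this determinant would be even, hence zero, and the two
     fractions would coincide, contradicting the strictly smaller error of the second. *)
  { assert (Hdet : Rabs (IZR a * INR q - INR b * IZR p) < 2).
    { replace (IZR a * INR q - INR b * IZR p)
        with (- (INR q * (INR b * theta - IZR a)) + INR b * (INR q * theta - IZR p)) by ring.
      eapply Rle_lt_trans; [apply Rabs_triang|].
      rewrite Rabs_Ropp, !Rabs_mult, !(Rabs_right (INR _)) by lra. fold rho rho'. nra. }
    rewrite !INR_IZR_INZ, <- !mult_IZR, <- minus_IZR, <- abs_IZR in Hdet. apply lt_IZR in Hdet.
    destruct (Nat.odd q) eqn:E; [reflexivity|exfalso].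
    assert (Hbe : exists k, b = (2 * k)%nat).
    { apply Nat.even_spec. now rewrite <- Nat.negb_odd, Hodd. }
    assert (Hqe : exists k, q = (2 * k)%nat).
    { apply Nat.even_spec. now rewrite <- Nat.negb_odd, E. }
    destruct Hbe as [k ->]. destruct Hqe as [l ->].
    assert (Hzero : (a * Z.of_nat (2 * l) = p * Z.of_nat (2 * k))%Z) by lia.
    assert (Heq : (2 * l = 2 * k)%nat).
    { apply (rel_prime_fraction_unique p (2 * l) a (2 * k)); try assumption; lia. }
    assert (Hap : a = p) by (rewrite Heq in Hzero; nia).
    unfold rho, rho' in Hrho'. rewrite Heq, Hap in Hrho'. lra. }
  exists p, q. repeat split; try assumption; try apply Hpq.
  - apply (Hlarge p); [lia|]. fold rho'. lra.
  - fold rho'. nra.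
Qed.

Lemma reduced_fraction (p : Z) (q : nat) :
  (0 < q)%nat -> exists (a : Z) (b : nat), (0 < b)%nat /\ rel_prime a (Z.of_nat b) /\
    IZR p / INR q = IZR a / INR b.
Proof.
  intros Hq. set (g := Z.gcd p (Z.of_nat q)).
  assert (Hg : (0 < g)%Z).
  { pose proof (Z.gcd_nonneg p (Z.of_nat q)).
    assert (g <> 0)%Z by (unfold g; intros E; apply Z.gcd_eq_0_r in E; lia). unfold g in *; lia. }
  destruct (Z.gcd_divide_l p (Z.of_nat q)) as [a Ha].
  destruct (Z.gcd_divide_r p (Z.of_nat q)) as [b Hb]. fold g in Ha, Hb.
  assert (Hb0 : (0 < b)%Z) by nia.
  exists a, (Z.to_nat b). rewrite Z2Nat.id by lia. split; [lia|split].
  - apply Zgcd_1_rel_prime.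
    assert (E : (g = Z.gcd a b * g)%Z).
    { transitivity (Z.gcd (a * g) (b * g)); [unfold g at 1; now rewrite Ha, Hb at 1|].
      rewrite Z.gcd_mul_mono_r, Z.abs_eq by lia. reflexivity. }
    nia.
  - rewrite !INR_IZR_INZ, Z2Nat.id by lia. rewrite Hb, Ha, !mult_IZR.
    field. split; apply not_0_IZR; lia.
Qed.

Lemma escapes_vanishing a b v :
  (2 <= b)%nat -> Nat.even b = true -> rel_prime a (Z.of_nat b) -> gauss a b 0 = RtoC 0 ->
  on_S1 v -> escapes (2 * PI * IZR a / INR b) v.
Proof.
  intros Hb Heven Hab HG Hv.
  destruct (psi_near_vanishing a b Hb Hab HG) as (A & HA & Hnear).
  apply (escapes_approx _ v A HA Hv). intros Q.
  destruct (nat_above Q) as (n & _ & Hn).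
  destruct (rel_prime_bezout _ _ Hab) as [u w Huw].
  (* The Bezout relation yields a whole family of solutions of [p b - a q = 1]; this [j] makes [q]
     exceed both [n] and the threshold [100]. Such a [q] is odd because [b] is even. *)
  set (j := (Z.abs u + Z.of_nat n + 100)%Z).
  set (q := Z.to_nat (- u + j * Z.of_nat b)).
  assert (Hqz : Z.of_nat q = (- u + j * Z.of_nat b)%Z) by (unfold q; apply Z2Nat.id; nia).
  set (p := (w + j * a)%Z).
  assert (Hdet : (p * Z.of_nat b - a * Z.of_nat q = 1)%Z) by (rewrite Hqz; unfold p; nia).
  assert (Hqn : (n + 100 <= q)%nat) by (apply Nat2Z.inj_le; rewrite Hqz; nia).
  assert (Hpq : rel_prime p (Z.of_nat q)).
  { apply bezout_rel_prime. apply Bezout_intro with (Z.of_nat b) (- a)%Z. lia. }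
  exists p, q. split; [|split].
  - eapply Rle_trans; [exact Hn|]. apply le_INR. lia.
  - apply good_fraction_odd; [assumption|].
    destruct (Nat.odd q) eqn:E; [reflexivity|exfalso].
    apply Nat.even_spec in Heven as [k ->].
    assert (Hqe : Nat.even q = true) by (now rewrite <- Nat.negb_odd, E).
    apply Nat.even_spec in Hqe as [l Hl]. rewrite Hl in Hdet. lia.
  - apply Hnear; try assumption. lia.
Qed.

Lemma psi_escapes x v : on_S1 v -> escapes x v.
Proof.
  intros Hv. pose proof PI_RGT_0. set (theta := x / (2 * PI)).
  assert (Hx : x = 2 * PI * theta) by (unfold theta; field; lra).
  destruct (classic (irrational theta)) as [Hirr|Hrat].
  - apply (escapes_approx x v (10 ^ 8)); [lra|assumption|]. intros Q.
    destruct (nat_above Q) as (n & _ & Hn).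
    destruct (odd_approximations theta n Hirr) as (p & q & Hq & Hp & Ho & Hd).
    exists p, q. split; [|split].
    + eapply Rle_trans; [exact Hn|]. now apply le_INR.
    + now apply good_fraction_odd.
    + rewrite Hx. apply psi_near_rational; try assumption. destruct q; [discriminate|lia].
  - apply not_all_ex_not in Hrat as [p Hrat]. apply not_all_ex_not in Hrat as [q Hrat].
    apply imply_to_and in Hrat as [Hq Hrat]. apply NNPP in Hrat.
    assert (Hq0 : INR q <> 0) by (apply not_0_INR; lia).
    destruct (reduced_fraction p q Hq) as (a & b & Hb & Hab & E).
    assert (Hb0 : INR b <> 0) by (apply not_0_INR; lia).
    assert (Hx' : x = 2 * PI * IZR a / INR b).
    { rewrite Hx. transitivity (2 * PI * (IZR a / INR b)); [|field; assumption].
      rewrite <- E. rewrite <- Hrat. field. assumption. }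
    rewrite Hx'. clear E.
    destruct (Nat.odd b) eqn:Hodd; [apply escapes_corner; [now apply good_fraction_odd|assumption]|].
    assert (Heven : Nat.even b = true) by (now rewrite <- Nat.negb_odd, Hodd).
    pose proof Heven as Hk. apply Nat.even_spec in Hk as [k Hk].
    destruct (Nat.Even_or_Odd k) as [[l Hl]|[l Hl]].
    + apply escapes_corner; [|assumption]. split; [assumption|split; [assumption|]].
      replace b with (4 * l)%nat in * by lia. rewrite gauss_0mod4 by (assumption || lia).
      pose proof (pos_INR (4 * l)). lra.
    + apply escapes_vanishing; try assumption; [lia|].
      replace b with (4 * l + 2)%nat in * by lia. now apply gauss_2mod4.
Qed.

(** * Hausdorff content *)

(** Countable subadditivity of length without extracting a finite subcover: the supremum of the
    points reached by finitely many intervals cannot stop inside the open interval that covers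
    it. *)
Lemma interval_cover_length (l r : nat -> R) a b S :
  a <= b -> (forall i, l i <= r i) ->
  (forall x, a <= x <= b -> exists i, l i < x < r i) ->
  (forall n, rsum (fun i => r i - l i) n <= S) -> b - a <= S.
Proof.
  intros Hab Hlr Hcov HS.
  (* [g i x] is the length of the part of the [i]-th interval to the left of [x]; its increments are
     additive in the endpoints and nonnegative. *)
  set (g := fun i x => Rmin (Rmax x (l i)) (r i) - l i).
  assert (Hmono : forall i x y, x <= y -> g i x <= g i y).
  { intros i x y Hxy. unfold g, Rmin, Rmax.
    destruct (Rle_dec x (l i)), (Rle_dec y (l i)); repeat destruct (Rle_dec _ (r i)); lra. }
  assert (Hbnd : forall i x, 0 <= g i x <= r i - l i).
  { intros i x. specialize (Hlr i). unfold g, Rmin, Rmax.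
    destruct (Rle_dec x (l i)); destruct (Rle_dec _ (r i)); lra. }
  assert (Hslope : forall i x y, l i < x -> x <= y -> y < r i -> g i y - g i x = y - x).
  { intros i x y H1 H2 H3. unfold g. rewrite !Rmax_left, !Rmin_left by lra. ring. }
  set (inc := fun n x y => rsum (fun i => g i y - g i x) n).
  assert (Hinc : forall n x y, x <= y -> 0 <= inc n x y).
  { intros n x y Hxy. apply rsum_ge0. intros i _. specialize (Hmono i x y Hxy). lra. }
  assert (Hinc_n : forall n m x y, x <= y -> inc n x y <= inc (n + m)%nat x y).
  { intros n m x y Hxy. unfold inc. rewrite rsum_add.
    pose proof (rsum_ge0 (fun i => g (n + i)%nat y - g (n + i)%nat x) m) as H.
    assert (0 <= rsum (fun i => g (n + i)%nat y - g (n + i)%nat x) m); [|lra].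
    apply H. intros i _. specialize (Hmono (n + i)%nat x y Hxy). lra. }
  assert (Hinc_i : forall i n x y, (i < n)%nat -> l i < x -> x <= y -> y < r i -> y - x <= inc n x y).
  { intros i n x y Hi H1 H2 H3.
    apply Rle_trans with (inc (Datatypes.S i) x y).
    - unfold inc. cbn [rsum]. pose proof (Hinc i x y H2). unfold inc in *.
      rewrite (Hslope i x y) by assumption. lra.
    - replace n with (Datatypes.S i + (n - Datatypes.S i))%nat by lia. now apply Hinc_n. }
  assert (Hinc_add : forall n x y z, inc n x y + inc n y z = inc n x z).
  { intros n x y z. unfold inc. rewrite <- rsum_plus. apply rsum_ext. intros; ring. }
  set (A := fun x => a <= x <= b /\ exists n, x - a <= inc n a x).
  assert (HAa : A a).
  { split; [lra|]. exists O. unfold inc; simpl. lra. }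
  destruct (completeness A) as [s [Hub Hlub]].
  { exists b. intros x [Hx _]. lra. }
  { now exists a. }
  assert (Has : a <= s) by (now apply Hub).
  assert (Hsb : s <= b) by (apply Hlub; intros x [Hx _]; lra).
  destruct (Hcov s ltac:(lra)) as [i [Hi1 Hi2]].
  assert (Hx : exists x, A x /\ l i < x <= s).
  { apply NNPP. intros Hno. assert (s <= Rmax (l i) (s - 1)); [|revert H; unfold Rmax; destruct (Rle_dec _ _); lra].
    apply Hlub. intros x Hx. destruct (Rle_lt_dec x (l i)) as [H|H].
    - eapply Rle_trans; [exact H|apply Rmax_l].
    - exfalso. apply Hno. exists x. split; [assumption|]. split; [assumption|now apply Hub]. }
  destruct Hx as (x & [Hxab [n Hn]] & Hxl & Hxs).
  assert (Hext : forall y, x <= y -> y <= b -> y < r i -> A y).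
  { intros y H1 H2 H3. split; [lra|]. exists (n + Datatypes.S i)%nat.
    rewrite <- (Hinc_add _ a x y).
    pose proof (Hinc_n n (Datatypes.S i) a x ltac:(lra)).
    pose proof (Hinc_i i (n + Datatypes.S i)%nat x y ltac:(lia) Hxl H1 H3). lra. }
  assert (Hend : A b).
  { destruct (Rlt_le_dec s b) as [H|H].
    - exfalso. set (y := Rmin b ((s + r i) / 2)).
      assert (Hy : s < y) by (unfold y; apply Rmin_glb_lt; lra).
      pose proof (Rmin_l b ((s + r i) / 2)) as Hy1. pose proof (Rmin_r b ((s + r i) / 2)) as Hy2.
      fold y in Hy1, Hy2.
      specialize (Hub y (Hext y ltac:(lra) ltac:(lra) ltac:(lra))). lra.
    - apply Hext; lra. }
  destruct Hend as [_ [m Hm]].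
  eapply Rle_trans; [exact Hm|]. eapply Rle_trans; [|apply (HS m)].
  apply rsum_le. intros j _. pose proof (Hbnd j a). pose proof (Hbnd j b). lra.
Qed.

(** * Diameters, covers and lower bounds for the content *)

Lemma dist_Cmod p q : dist p q = Cmod (p - q)%C.
Proof. reflexivity. Qed.

Lemma dist_sym p q : dist p q = dist q p.
Proof.
  rewrite !dist_Cmod, <- Cmod_opp. f_equal. unfold Cminus, Copp, Cplus; simpl. f_equal; ring.
Qed.

Lemma dist_triangle p q r : dist p r <= dist p q + dist q r.
Proof.
  rewrite !dist_Cmod. eapply Rle_trans; [|apply Cmod_triangle]. right. f_equal.
  unfold Cminus, Copp, Cplus; simpl. f_equal; ring.
Qed.

Lemma dist_refl p : dist p p = 0.
Proof.
  rewrite dist_Cmod. replace (p - p)%C with (RtoC 0); [apply Cmod_0|].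
  unfold Cminus, Copp, Cplus, RtoC; simpl. f_equal; ring.
Qed.

Lemma is_diam_ge0 U d : is_diam U d -> 0 <= d.
Proof.
  intros [[_ ->]|[Hub Hlub]]; [lra|].
  destruct (classic (exists x, U x)) as [[x Hx]|Hno].
  - rewrite <- (dist_refl x). apply Hub. now exists x, x.
  - exfalso. specialize (Hlub (d - 1)). assert (d <= d - 1); [|lra].
    apply Hlub. intros r (x & y & Hx & _). destruct Hno. now exists x.
Qed.

Lemma is_diam_dist U d x y : is_diam U d -> U x -> U y -> dist x y <= d.
Proof.
  intros [[Hno _]|[Hub _]] Hx Hy; [now destruct (Hno x)|]. apply Hub. now exists x, y.
Qed.

Lemma rsum_geometric n : rsum (fun i => (1 / 2) ^ S i) n <= 1.
Proof.
  enough (rsum (fun i => (1 / 2) ^ S i) n = 1 - (1 / 2) ^ n).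
  { pose proof (pow_lt (1 / 2) n ltac:(lra)). lra. }
  induction n as [|n IH]; [simpl; lra|]. cbn [rsum]. rewrite IH. simpl. field.
Qed.

(* The factor 2 comes from enclosing the image of a set of diameter [d] in an interval of
   radius [d] around the image of one of its points. *)
Lemma cover_value_ge (J : pt -> R) (F : pt -> Prop) a b s :
  (forall p q, Rabs (J p - J q) <= dist p q) -> a <= b ->
  (forall y, a <= y <= b -> exists p, F p /\ J p = y) ->
  cover_value F s -> (b - a) / 2 <= s.
Proof.
  intros HJ Hab HF (U & d & Hcov & Hdiam & Hsum).
  assert (Hd0 : forall i, 0 <= d i) by (intros i; now apply (is_diam_ge0 (U i))).
  (* For an empty [U i] the chosen point is arbitrary, and its interval is harmless. *)
  set (ctr := fun i => J (epsilon (inhabits (0, 0)) (U i))).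
  assert (Hctr : forall i p, U i p -> Rabs (J p - ctr i) <= d i).
  { intros i p Hp. eapply Rle_trans; [apply HJ|].
    apply (is_diam_dist (U i)); [apply Hdiam|assumption|]. apply epsilon_spec. now exists p. }
  assert (Hpart : forall n, rsum d n <= s).
  { intros [|n].
    - simpl. eapply Rle_trans; [|apply (sum_incr d 0 s Hsum Hd0)]. apply Hd0.
    - rewrite <- sum_f_R0_rsum. now apply sum_incr. }
  apply Rle_plus_epsilon. intros e He.
  enough (b - a <= 2 * s + 2 * e) by lra.
  (* The widening turns the enclosing intervals into open ones, even around single points, at a
     total cost of at most [2 e]. *)
  set (w := fun i => d i + e * (1 / 2) ^ S i).
  assert (Hw : forall i, d i < w i).
  { intros i. unfold w. pose proof (pow_lt (1 / 2) (S i) ltac:(lra)). nra. }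
  apply (interval_cover_length (fun i => ctr i - w i) (fun i => ctr i + w i)); [assumption| | |].
  - intros i. pose proof (Hw i). pose proof (Hd0 i). lra.
  - intros y Hy. destruct (HF y Hy) as (p & Hp & <-). destruct (Hcov p Hp) as [i Hi].
    exists i. pose proof (Hctr i p Hi). pose proof (Hw i). split_Rabs; lra.
  - intros n. rewrite (rsum_ext _ (fun i => 2 * d i + 2 * e * (1 / 2) ^ S i))
      by (intros; unfold w; ring).
    rewrite rsum_plus, !rsum_scal. pose proof (Hpart n). pose proof (rsum_geometric n). nra.
Qed.

(** [F] itself, padded with empty sets, is a cover; this makes the set of cover values nonempty, so
    that the content is a genuine infimum. *)
Lemma bounded_cover_exists (F : pt -> Prop) x h :
  (forall p, F p -> dist x p <= h) -> exists s, cover_value F s.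
Proof.
  intros HF.
  assert (HD : exists D, is_diam F D).
  { destruct (classic (exists p, F p)) as [[p Hp]|Hno].
    - destruct (completeness (fun r => exists u v, F u /\ F v /\ r = dist u v)) as [D HD].
      + exists (2 * h). intros r (u & v & Hu & Hv & ->).
        pose proof (dist_triangle u x v) as H. rewrite (dist_sym u x) in H.
        pose proof (HF u Hu). pose proof (HF v Hv). lra.
      + exists (dist p p), p, p. auto.
      + exists D. now right.
    - exists 0. left. split; [|reflexivity]. intros p Hp. apply Hno. now exists p. }
  destruct HD as [D HD].
  exists D, (fun i p => i = O /\ F p), (fun i => match i with O => D | S _ => 0 end).
  split; [|split].
  - intros p Hp. exists O. auto.
  - intros [|i].
    + destruct HD as [[Hno ->]|[Hub Hlub]].
      * left. split; [|reflexivity]. intros p [_ Hp]. now apply (Hno p).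
      * right. split.
        -- intros r (u & v & [_ Hu] & [_ Hv] & ->). apply Hub. now exists u, v.
        -- intros m Hm. apply Hlub. intros r (u & v & Hu & Hv & ->). apply Hm. now exists u, v.
    + left. split; [|reflexivity]. intros p [E _]. discriminate.
  - intros e He. exists O. intros n _. unfold R_dist.
    replace (sum_f_R0 _ n) with D; [rewrite Rminus_diag, Rabs_R0; exact He|].
    induction n as [|n IH]; simpl; [reflexivity|]. rewrite <- IH. ring.
Qed.

(** The infimum exists, as the opposite of a supremum of opposite values, so the choice operator in
    [H1inf] returns it and every lower bound of the cover values passes to it. *)
Lemma H1inf_ge (F : pt -> Prop) x h m :
  (forall p, F p -> dist x p <= h) ->
  (forall s, cover_value F s -> m <= s) -> m <= H1inf F.
Proof.
  intros HF Hm.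
  assert (Hex : exists i, is_H1inf F i).
  { destruct (completeness (fun r => cover_value F (- r))) as [i [Hub Hlub]].
    - exists (- m). intros r Hr. specialize (Hm _ Hr). lra.
    - destruct (bounded_cover_exists F x h HF) as [s Hs]. exists (- s). now rewrite Ropp_involutive.
    - exists (- i). split.
      + intros s Hs. specialize (Hub (- s)). cbv beta in Hub. rewrite Ropp_involutive in Hub. specialize (Hub Hs). lra.
      + intros m' Hm'. specialize (Hlub (- m')). assert (i <= - m'); [|lra].
        apply Hlub. intros r Hr. specialize (Hm' _ Hr). lra. }
  pose proof (epsilon_spec (inhabits 0) (is_H1inf F) Hex) as [_ H2]. now apply H2.
Qed.

(** * Non-existence of tangents *)

(** Uniform error of the head plus its Lipschitz bound; letting [K] grow first and [y - x] shrink
    afterwards gives uniform continuity. *)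
Lemma psi_modulus K x y :
  (0 < K)%nat -> Cmod (psi y - psi x) <= 36 / INR K + 10 * INR K * Rabs (y - x).
Proof.
  intros HK. pose proof (psi_head x K HK). pose proof (psi_head y K HK).
  pose proof (head_lipschitz K x y HK).
  replace (psi y - psi x)%C with ((psi y - head K y) - (psi x - head K x) + (head K y - head K x))%C by ring.
  eapply Rle_trans; [apply Cmod_triangle|].
  pose proof (Cmod_minus_le (psi y - head K y) (psi x - head K x)).
  unfold Rdiv in *. lra.
Qed.

Lemma phi_psi t : (4 * PI ^ 2 * fst (phi t), 4 * PI ^ 2 * snd (phi t)) = psi (4 * PI ^ 2 * t).
Proof.
  pose proof PI_RGT_0. unfold psi. replace (4 * PI ^ 2 * t / (4 * PI ^ 2)) with t by (field; lra).
  reflexivity.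
Qed.

Lemma dist_phi s t :
  dist (phi s) (phi t) = / (4 * PI ^ 2) * Cmod (psi (4 * PI ^ 2 * s) - psi (4 * PI ^ 2 * t)).
Proof.
  pose proof PI_RGT_0. assert (0 < 4 * PI ^ 2) by nra.
  rewrite <- !phi_psi, dist_Cmod.
  replace (((4 * PI ^ 2 * fst (phi s))%R, (4 * PI ^ 2 * snd (phi s))%R)
     - ((4 * PI ^ 2 * fst (phi t))%R, (4 * PI ^ 2 * snd (phi t))%R))%C
    with (RtoC (4 * PI ^ 2) * (phi s - phi t))%C
    by (apply injective_projections; simpl; ring).
  rewrite Cmod_mult, Cmod_R, Rabs_right by lra. field. lra.
Qed.

Lemma dot_phi v s t :
  dot v (phi s - phi t)%C
  = / (4 * PI ^ 2) * dot v (psi (4 * PI ^ 2 * s) - psi (4 * PI ^ 2 * t))%C.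
Proof.
  pose proof PI_RGT_0. rewrite <- !phi_psi. unfold dot.
  cbn [fst snd Cminus Cplus Copp]. field. lra.
Qed.

Lemma phi_lipschitz_comp_continuous (J : pt -> R) :
  (forall p q, Rabs (J p - J q) <= dist p q) -> continuity (fun s => J (phi s)).
Proof.
  intros HJ s e He. pose proof PI_RGT_0. assert (HPI : 0 < 4 * PI ^ 2) by nra.
  destruct (nat_above (72 / (4 * PI ^ 2 * e) + 1)) as (K & HK & HKe).
  assert (HK1 : 1 <= INR K) by (apply (le_INR 1); lia).
  exists (e / (40 * INR K)). split; [apply Rdiv_lt_0_compat; lra|].
  intros y [_ Hy]. simpl in Hy |- *. unfold R_dist in Hy |- *.
  eapply Rle_lt_trans; [apply HJ|]. rewrite dist_phi.
  pose proof (psi_modulus K (4 * PI ^ 2 * s) (4 * PI ^ 2 * y) HK) as Hm.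
  rewrite <- Rmult_minus_distr_l, Rabs_mult, (Rabs_right (4 * PI ^ 2)) in Hm by lra.
  apply (Rmult_le_compat_l (/ (4 * PI ^ 2))) in Hm; [|left; now apply Rinv_0_lt_compat].
  eapply Rle_lt_trans; [exact Hm|].
  replace (/ (4 * PI ^ 2) * (36 / INR K + 10 * INR K * (4 * PI ^ 2 * Rabs (y - s))))
    with (36 / (4 * PI ^ 2) / INR K + 10 * INR K * Rabs (y - s)) by (field; lra).
  assert (H1 : 36 / (4 * PI ^ 2) / INR K < e / 2).
  { apply Rmult_lt_reg_r with (INR K); [lra|]. unfold Rdiv at 1. rewrite Rmult_assoc, Rinv_l by lra.
    replace (36 / (4 * PI ^ 2) * 1) with (e / 2 * (72 / (4 * PI ^ 2 * e))) by (field; lra).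
    apply Rmult_lt_compat_l; lra. }
  assert (H2 : 10 * INR K * Rabs (y - s) < e / 4 + e / 4).
  { apply (Rmult_lt_compat_l (10 * INR K)) in Hy; [|lra].
    replace (10 * INR K * (e / (40 * INR K))) with (e / 4) in Hy by (field; lra). lra. }
  lra.
Qed.

Definition perp (v : pt) : pt := (- snd v, fst v).

Lemma perp_on_S1 v : on_S1 v -> on_S1 (perp v).
Proof. unfold on_S1, perp. simpl. lra. Qed.

Lemma acos_gt_0 k : 0 <= k < 1 -> 0 < acos k.
Proof.
  intros Hk. destruct (acos_bound k) as [H0 _].
  destruct (Req_dec (acos k) 0) as [E|E]; [|lra].
  pose proof (cos_acos k ltac:(lra)) as H. rewrite E, cos_0 in H. lra.
Qed.

Lemma sqrt_1_minus_sq c : 0 < c <= 1 -> 0 <= sqrt (1 - c ^ 2) < 1.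
Proof.
  intros Hc. split; [apply sqrt_pos|].
  rewrite <- sqrt_1 at 2. apply sqrt_lt_1_alt. split; nra.
Qed.

(** A point whose distance to the axis exceeds [c] times its distance to the vertex makes an angle
    at least [acos (sqrt (1 - c^2)) = asin c] with the axis, and this exceeds half the opening angle
    because [asin c] is positive. *)
Lemma off_cone_wide x v p c :
  on_S1 v -> 0 < c <= 1 ->
  c * Cmod (p - x)%C < Rabs (dot (perp v) (p - x)%C) ->
  ~ cone x v (acos (sqrt (1 - c ^ 2))) p.
Proof.
  intros Hv Hc Hp Hcone. set (w := (p - x)%C) in *.
  set (k := sqrt (1 - c ^ 2)) in *.
  assert (Hk : 0 <= k < 1) by (now apply sqrt_1_minus_sq).
  destruct (acos_bound k) as [_ Ha1]. pose proof (acos_gt_0 k Hk) as Hak.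
  assert (Hw : 0 < Cmod w).
  { pose proof (dot_le (perp v) w (perp_on_S1 v Hv)). pose proof (Cmod_ge_0 w).
    destruct (Req_dec (Cmod w) 0) as [E|E]; [|lra]. rewrite E in *. lra. }
  destruct Hcone as [E|Hcone].
  { unfold w in Hw. rewrite E, <- dist_Cmod, dist_refl in Hw. lra. }
  change (acos (Rabs (dot v w) / Cmod w) <= acos k / 2) in Hcone.
  set (rho := Rabs (dot v w) / Cmod w) in *.
  assert (Hpyth : dot v w ^ 2 + dot (perp v) w ^ 2 = Cmod w ^ 2).
  { unfold Cmod. rewrite pow2_sqrt by (pose proof (pow2_ge_0 (fst w)); pose proof (pow2_ge_0 (snd w)); lra).
    clearbody w. unfold dot, perp. cbn [fst snd].
    transitivity ((fst v ^ 2 + snd v ^ 2) * (fst w ^ 2 + snd w ^ 2)); [ring|]. rewrite Hv. ring. }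
  assert (Hrho : 0 <= rho <= k).
  { split; [apply Rmult_le_pos; [apply Rabs_pos|left; now apply Rinv_0_lt_compat]|].
    assert (Hsq : rho ^ 2 <= 1 - c ^ 2).
    { unfold rho. apply Rmult_le_reg_r with (Cmod w ^ 2); [nra|].
      replace ((Rabs (dot v w) / Cmod w) ^ 2 * Cmod w ^ 2) with (Rabs (dot v w) ^ 2) by (field; lra).
      rewrite pow2_abs. pose proof (pow2_abs (dot (perp v) w)) as H2.
      assert (0 <= c * Cmod w) by nra.
      assert ((c * Cmod w) ^ 2 <= Rabs (dot (perp v) w) ^ 2) by (apply pow_incr; lra). nra. }
    unfold k. rewrite <- (sqrt_pow2 rho).
    - now apply sqrt_le_1_alt.
    - apply Rmult_le_pos; [apply Rabs_pos|left; now apply Rinv_0_lt_compat]. }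
  destruct (acos_bound rho) as [Hb0 Hb1].
  assert (Hcos : cos (acos k) < cos (acos rho)) by (apply cos_decreasing_1; lra).
  rewrite !cos_acos in Hcos by lra. lra.
Qed.

Theorem theorem3 :
  forall (t : R) (v : pt), on_S1 v ->
  exists varphi : R, 0 < varphi /\
    ~ (forall eps : R, 0 < eps ->
         exists delta : R, 0 < delta /\
           forall h : R, 0 < h < delta ->
             Rabs (H1inf (off_cone_part t v varphi h) / h) < eps).
Proof.
  intros t v Hv. pose proof PI_RGT_0. assert (HPI : 0 < 4 * PI ^ 2) by nra.
  (* The normal [perp v] is used because the scalar product with it measures the distance to the
     line in direction [v]. *)
  destruct (psi_escapes (4 * PI ^ 2 * t) (perp v) (perp_on_S1 v Hv)) as (c & Hc & Hesc).
  assert (Hc1 : c <= 1).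
  { destruct (Hesc 1 ltac:(lra)) as (h & s & Hh & H1 & H2).
    pose proof (dot_le (perp v) (psi s - psi (4 * PI ^ 2 * t))%C (perp_on_S1 v Hv)).
    nra. }
  (* In the ball of radius [2 h], a point at distance more than [c h/2] from the line is off the
     axis by more than [c/4] times its distance to the vertex. *)
  exists (acos (sqrt (1 - (c / 4) ^ 2))). split; [apply acos_gt_0, sqrt_1_minus_sq; lra|].
  (* [c/16] is the content bound [(c h/2 - c h/4)/2] divided by the radius [2 h]. *)
  intros Hlim. destruct (Hlim (c / 16) ltac:(lra)) as (delta & Hd & Hlim').
  destruct (Hesc (4 * PI ^ 2 * (delta / 2)) ltac:(apply Rmult_lt_0_compat; lra))
    as (h0 & s0 & Hh0 & Hclose & Hfar).
  set (h := h0 / (4 * PI ^ 2)). set (s := s0 / (4 * PI ^ 2)).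
  assert (Hs : s0 = 4 * PI ^ 2 * s) by (unfold s; field; lra).
  assert (Hhh : h0 = 4 * PI ^ 2 * h) by (unfold h; field; lra).
  assert (Hh : 0 < h < delta / 2).
  { split; [apply Rdiv_lt_0_compat; lra|]. apply Rmult_lt_reg_l with (4 * PI ^ 2); lra. }
  assert (Hdist : dist (phi s) (phi t) <= h).
  { rewrite dist_phi, <- Hs. apply Rmult_le_reg_l with (4 * PI ^ 2); [lra|].
    rewrite <- Rmult_assoc, Rinv_r by lra. lra. }
  assert (Hdot : c * h <= Rabs (dot (perp v) (phi s - phi t)%C)).
  { rewrite dot_phi, <- Hs, Rabs_mult, Rabs_right by (left; now apply Rinv_0_lt_compat).
    apply Rmult_le_reg_l with (4 * PI ^ 2); [lra|].
    rewrite <- (Rmult_assoc _ (/ (4 * PI ^ 2))), Rinv_r by lra. rewrite Hhh in Hfar. lra. }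
  (* A 1-Lipschitz function that is positive only inside the ball of radius [2 h] and at
     distance more than [c h / 2] from the line. *)
  set (J := fun p : pt => Rmin (Rabs (dot (perp v) (p - phi t)%C) - c * h / 2)
                               (2 * h - dist (phi t) p)).
  assert (HJ : forall p q, Rabs (J p - J q) <= dist p q).
  { intros p q. unfold J.
    assert (H1 : Rabs (Rabs (dot (perp v) (p - phi t)%C) - Rabs (dot (perp v) (q - phi t)%C)) <= dist p q).
    { eapply Rle_trans; [apply Rabs_triang_inv2|]. rewrite <- dot_minus.
      eapply Rle_trans; [apply dot_le, perp_on_S1, Hv|]. right. rewrite dist_Cmod. f_equal.
      apply injective_projections; simpl; ring. }
    pose proof (dist_triangle (phi t) p q) as H2. pose proof (dist_triangle (phi t) q p) as H3.
    rewrite (dist_sym q p) in H3.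
    unfold Rmin. destruct (Rle_dec _ _), (Rle_dec _ _); split_Rabs; lra. }
  assert (Hcont := phi_lipschitz_comp_continuous J HJ).
  assert (HJt : J (phi t) <= 0).
  { unfold J. eapply Rle_trans; [apply Rmin_l|].
    replace (dot (perp v) (phi t - phi t)%C) with 0 by (unfold dot; simpl; ring).
    rewrite Rabs_R0. nra. }
  assert (HJs : c * h / 2 <= J (phi s)).
  { unfold J. rewrite (dist_sym (phi t)). apply Rmin_glb; nra. }
  set (F := off_cone_part t v (acos (sqrt (1 - (c / 4) ^ 2))) (2 * h)).
  assert (HF : forall p, phi_image p -> 0 < J p -> F p).
  { intros p Hp HJp. unfold J in HJp.
    pose proof (Rmin_l (Rabs (dot (perp v) (p - phi t)%C) - c * h / 2) (2 * h - dist (phi t) p)).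
    pose proof (Rmin_r (Rabs (dot (perp v) (p - phi t)%C) - c * h / 2) (2 * h - dist (phi t) p)).
    split; [assumption|split; [unfold Defs.ball; lra|]].
    apply off_cone_wide; [assumption|lra|]. rewrite <- dist_Cmod, dist_sym. nra. }
  assert (Hcontent : (c * h / 2 - c * h / 4) / 2 <= H1inf F).
  { apply (H1inf_ge F (phi t) (2 * h)).
    - intros p (_ & Hb & _). exact Hb.
    - intros r Hr. apply (cover_value_ge J F _ _ r HJ); [nra| |exact Hr].
      intros y Hy. assert (0 < c * h) by nra.
      (* Every value in [[c h/4, c h/2]] lies between [J (phi t) <= 0] and [J (phi s)], and is
         positive, so it is attained at a point of the curve inside the ball and off the cone. *)
      destruct (IVT_gen (fun s => J (phi s)) t s y Hcont) as [z [_ Hz]].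
      + pose proof (Rmin_l (J (phi t)) (J (phi s))). pose proof (Rmax_r (J (phi t)) (J (phi s))). lra.
      + exists (phi z). split; [|exact Hz]. apply HF; [now exists z|lra]. }
  specialize (Hlim' (2 * h) ltac:(lra)). fold F in Hlim'.
  pose proof (Rle_abs (H1inf F / (2 * h))).
  assert (H2 : c / 16 <= H1inf F / (2 * h)).
  { apply Rmult_le_reg_r with (2 * h); [lra|]. unfold Rdiv at 2. rewrite Rmult_assoc, Rinv_l by lra. lra. }
  lra.
Qed.
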